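(* Let $B=B^*$ and let $L_{C,D}(Q)$ be a complete accumulative (respectively, complete dissipative) operator. Then for any $\lambda\in\mathbb C_+$ (respectively, $\lambda\in\mathbb C_-$) the operator $T(\lambda):=(L_{C,D}(Q)-\lambda)^{-1}$ exists and admits the spectral synthesis.
   Context: Let $B=\operatorname{diag}(b_1,\dots,b_n)\in\mathbb C^{n\times n}$ be nonsingular, $Q\in L^1([0,1];\mathbb C^{n\times n})$, and $C,D\in\mathbb C^{n\times n}$ with $\operatorname{rank}\begin{pmatrix}C&D\end{pmatrix}=n$. The operator $L_{C,D}(Q)$ acts in $L^2([0,1];\mathbb C^n)$ by $y\mapsto -iB^{-1}y'+Q(x)y$ on the domain $\{y\in W^{1,1}([0,1];\mathbb C^n): -iB^{-1}y'+Qy\in L^2([0,1];\mathbb C^n),\ Cy(0)+Dy(1)=0\}$. $\mathbb C_\pm$ denote the open upper and lower half-planes. An operator $T$ in a Hilbert space is accumulative (dissipative) if $\operatorname{Im}(Tf,f)\le0$ ($\ge0$) for all $f\in\operatorname{dom}(T)$. A compact operator $T$ in a separable Hilbert space $\mathfrak H$ is complete if the system of its root vectors (eigenvectors and associated vectors) is complete in $\mathfrak H$, i.e. has closed linear span $\mathfrak H$. A compact complete operator $T$ admits the spectral synthesis if for any (closed) invariant subspace $\mathfrak H_1$ of $T$ the restriction $T\upharpoonright_{\mathfrak H_1}$ is complete in $\mathfrak H_1$. A closed operator with nonempty resolvent set is called complete if its resolvent is compact and complete. *)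

(* Defs.v *)
From HB Require Import structures.
From mathcomp Require Import all_boot all_order all_algebra.
From mathcomp Require Import complex.
From mathcomp Require Import all_classical all_reals all_analysis measurable_realfun.
From mathcomp Require Import ring lra.

Set Implicit Arguments.
Unset Strict Implicit.
Unset Printing Implicit Defensive.

Import Order.TTheory GRing.Theory Num.Theory.
Import numFieldNormedType.Exports.

Local Open Scope classical_set_scope.
Local Open Scope ring_scope.
Local Open Scope quotient_scope.

(** Functions on [0,1] are represented by functions on [R] whose values outside
    [unit_itv] are irrelevant: measurability, integrals and almost-everywhere
    equality all refer to [unit_itv]. *)

Section UnitInterval.
Context {R : realType}.
Local Notation mu := (@lebesgue_measure R).

Definition unit_itv : set R := `[0, 1]%classic.

Definition L2real (u : R -> R) : Prop :=
  measurable_fun unit_itv u /\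
  mu.-integrable unit_itv (EFin \o (fun x => u x ^+ 2)).

Definition cintegrable (h : R -> R[i]) : Prop :=
  mu.-integrable unit_itv (EFin \o (fun x => complex.Re (h x))) /\
  mu.-integrable unit_itv (EFin \o (fun x => complex.Im (h x))).

Definition cintegral (D : set R) (h : R -> R[i]) : R[i] :=
  Complex (Rintegral mu D (fun x => complex.Re (h x)))
          (Rintegral mu D (fun x => complex.Im (h x))).

Lemma measurable_unit_itv : measurable (unit_itv : set (measurableTypeR R)).
Proof. exact: measurable_itv. Qed.

Local Notation rint f := (mu.-integrable unit_itv (EFin \o f)).

Lemma rintD (u v : R -> R) : rint u -> rint v -> rint (fun x => u x + v x).
Proof.
by move=> iu iv; have h := integrableD measurable_unit_itv iu iv; exact: h.
Qed.

Lemma rintZ (a : R) (u : R -> R) : rint u -> rint (fun x => a * u x).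
Proof. by move=> iu; have h := integrableZl measurable_unit_itv a iu; exact: h. Qed.

Lemma L2real_mul (u v : R -> R) : L2real u -> L2real v ->
  rint (fun x => u x * v x).
Proof.
move=> [mu_ iu] [mv iv].
have /= h := rintD iu iv.
apply: le_integrable h => //=; first exact: measurable_unit_itv.
  by apply/measurable_EFinP; exact: measurable_funM.
move=> x _ /=; rewrite lee_fin [leRHS]ger0_norm ?addr_ge0 ?sqr_ge0//.
rewrite ler_norml; apply/andP; split; nra.
Qed.

Lemma L2real0 : L2real (cst 0).
Proof.
split; first exact: measurable_cst.
rewrite (_ : _ \o _ = cst 0%E); first exact: integrable0.
by apply/funext => x /=; rewrite expr0n.
Qed.

Lemma L2realD (u v : R -> R) : L2real u -> L2real v -> L2real (u \+ v).
Proof.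
move=> hu hv; have iuv := L2real_mul hu hv.
case: hu hv => [mu_ iu] [mv iv]; split; first exact: measurable_funD.
have := rintD (rintD iu iv) (rintD iuv iuv).
by congr (mu.-integrable _ _); apply/funext => x /=; congr (_%:E); ring.
Qed.

Lemma L2realZ (a : R) (u : R -> R) : L2real u -> L2real (fun x => a * u x).
Proof.
move=> [mu_ iu]; split; first by apply: measurable_funM => //; exact: measurable_cst.
have := rintZ (a ^+ 2) iu.
by congr (mu.-integrable _ _); apply/funext => x /=; congr (_%:E); ring.
Qed.

Lemma L2realB (u v : R -> R) : L2real u -> L2real v -> L2real (u \- v).
Proof.
move=> hu hv; have := L2realD hu (L2realZ (-1) hv).
by congr (L2real _); apply/funext => x /=; rewrite mulN1r.
Qed.

End UnitInterval.

Section L2.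
Context (R : realType) (n : nat).
Local Notation mu := (@lebesgue_measure R).
Local Notation C := R[i].

(** Linear in the first argument, conjugate-linear in the second. *)
Definition cdot (a b : 'cV[C]_n) : C := \sum_k a k ord0 * (b k ord0)^*%C.

Definition L2pred : {pred R -> 'cV[C]_n} :=
  mem [set f : R -> 'cV[C]_n |
    forall k, L2real (fun x => complex.Re (f x k ord0)) /\
              L2real (fun x => complex.Im (f x k ord0))].

Lemma L2pred_submod_closed : submod_closed L2pred.
Proof.
split=> [|z f g /[!inE] hf hg].
  by rewrite inE => k; split; move: (@L2real0 R); congr (L2real _);
    apply/funext => x /=; rewrite mxE.
move=> k; have [fr fi] := hf k; have [gr gi] := hg k; split.
  have := L2realD (L2realB (L2realZ (complex.Re z) fr) (L2realZ (complex.Im z) fi)) gr.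
  congr (L2real _); apply/funext => x /=; rewrite !mxE.
  by case: z (f x k ord0) (g x k ord0) => [? ?] [? ?] [? ?].
have := L2realD (L2realD (L2realZ (complex.Re z) fi) (L2realZ (complex.Im z) fr)) gi.
congr (L2real _); apply/funext => x /=; rewrite !mxE.
by case: z (f x k ord0) (g x k ord0) => [? ?] [? ?] [? ?].
Qed.

HB.instance Definition _ :=
  GRing.isSubmodClosed.Build _ _ L2pred L2pred_submod_closed.

Record L2fun := MkL2fun { L2fun_val :> R -> 'cV[C]_n ; _ : L2fun_val \in L2pred }.

HB.instance Definition _ := [isSub for L2fun_val].
HB.instance Definition _ := [Choice of L2fun by <:].
HB.instance Definition _ := [SubChoice_isSubLmodule of L2fun by <:].


Lemma L2funP (f : L2fun) k : L2real (fun x => complex.Re (f x k ord0)) /\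
  L2real (fun x => complex.Im (f x k ord0)).
Proof. by have := valP f; rewrite inE => /(_ k). Qed.

Lemma L2fun0E x : (0 : L2fun) x = 0. Proof. by []. Qed.
Lemma L2funDE (f g : L2fun) x : (f + g) x = f x + g x. Proof. by []. Qed.
Lemma L2funBE (f g : L2fun) x : (f - g) x = f x - g x. Proof. by []. Qed.
Lemma L2funZE a (f : L2fun) x : (a *: f) x = a *: f x. Proof. by []. Qed.

(** The quotient by [L2null] identifies functions equal almost everywhere. *)
Definition L2null : {pred L2fun} :=
  mem [set f : L2fun | ae_eq mu unit_itv (f : R -> 'cV[C]_n) (cst 0)].

Lemma L2null_zmod_closed : zmod_closed L2null.
Proof.
split=> [|f g /[!inE] hf hg]; first by rewrite inE; exact: ae_eq_refl.
apply: filterS2 hf hg => x fx gx xI.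
by rewrite L2funBE fx// gx//= subr0.
Qed.

HB.instance Definition _ := GRing.isZmodClosed.Build _ L2null L2null_zmod_closed.

Definition L2 : Type := Quotient.quot L2null.
HB.instance Definition _ := Choice.on L2.
HB.instance Definition _ := EqQuotient.on L2.
HB.instance Definition _ := GRing.Zmodule.on L2.

Definition L2_to_fun (u : L2) : R -> 'cV[C]_n := repr u.
Coercion L2_to_fun : L2 >-> Funclass.


Lemma L2_eqP (f g : L2fun) :
  (\pi f : L2) = \pi g <-> ae_eq mu unit_itv (f : R -> 'cV[C]_n) g.
Proof.
split=> [/eqP|h].
  rewrite -Quotient.idealrBE inE; apply: filterS => x fx xI.
  by apply/eqP; rewrite -subr_eq0 -L2funBE fx.
apply/eqP; rewrite -Quotient.idealrBE inE.
by apply: filterS h => x fx xI; rewrite L2funBE fx// subrr.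
Qed.

Lemma L2_pi_ae (f : L2fun) : ae_eq mu unit_itv ((\pi f : L2) : R -> 'cV[C]_n) f.
Proof. by apply/L2_eqP; rewrite /L2_to_fun reprK. Qed.

Lemma L2_ext (u v : L2) : ae_eq mu unit_itv (u : R -> 'cV[C]_n) v -> u = v.
Proof. by move=> /L2_eqP; rewrite !reprK. Qed.

Lemma L2D_ae (u v : L2) :
  ae_eq mu unit_itv ((u + v : L2) : R -> 'cV[C]_n) (fun x => u x + v x).
Proof.
rewrite -[u in X in ae_eq _ _ X]reprK -[v in X in ae_eq _ _ X]reprK.
rewrite -[_ + _]/(\pi_L2 _ + \pi_L2 _).
have -> : \pi_L2 (repr u) + \pi_L2 (repr v) = \pi_L2 (repr u + repr v).
  by rewrite !piE.
exact: L2_pi_ae.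
Qed.

Definition L2scale (a : C) (u : L2) : L2 := \pi_L2 (a *: (repr u : L2fun)).

Lemma L2scale_pi a (f : L2fun) : L2scale a (\pi_L2 f) = \pi_L2 (a *: f).
Proof.
apply/L2_eqP; have := L2_pi_ae f.
by apply: filterS => x fx xI; rewrite !L2funZE; congr (_ *: _); exact: fx.
Qed.

Lemma L2scaleA a b u : L2scale a (L2scale b u) = L2scale (a * b) u.
Proof. by rewrite -[u]reprK (L2scale_pi b (repr u)) !L2scale_pi scalerA. Qed.

Lemma L2scale1 : left_id 1 L2scale.
Proof. by move=> u; rewrite -[u]reprK L2scale_pi scale1r. Qed.

Lemma L2scaleDr : right_distributive L2scale +%R.
Proof.
move=> a u v; rewrite -[u]reprK -[v]reprK.
have piD (f g : L2fun) : \pi_L2 f + \pi_L2 g = \pi_L2 (f + g) by rewrite !piE.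
by rewrite piD (L2scale_pi _ (repr u + repr v)) !L2scale_pi piD scalerDr.
Qed.

Lemma L2scaleDl u : {morph L2scale^~ u : a b / a + b}.
Proof.
move=> a b; rewrite -[u]reprK.
have piD (f g : L2fun) : \pi_L2 f + \pi_L2 g = \pi_L2 (f + g) by rewrite !piE.
by rewrite !L2scale_pi piD scalerDl.
Qed.

HB.instance Definition _ := GRing.Zmodule_isLmodule.Build C L2
  L2scaleA L2scale1 L2scaleDr L2scaleDl.

Lemma L2Z_ae a (u : L2) :
  ae_eq mu unit_itv ((a *: u : L2) : R -> 'cV[C]_n) (fun x => a *: u x).
Proof. exact: L2_pi_ae. Qed.

Definition L2dot (u v : L2) : C := cintegral unit_itv (fun x => cdot (u x) (v x)).


Lemma cdotE (a b : 'cV[C]_n) : complex.Re (cdot a b) =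
  \sum_k (complex.Re (a k ord0) * complex.Re (b k ord0) +
          complex.Im (a k ord0) * complex.Im (b k ord0)).
Proof.
rewrite /cdot (big_morph (@complex.Re R) (id1 := 0) (op1 := +%R)); last by [].
- apply: eq_bigr => k _; case: (a k ord0) (b k ord0) => [? ?] [? ?] /=.
  by rewrite mulrN opprK.
- by move=> [? ?] [? ?].
Qed.

Let rdot (f g : R -> 'cV[C]_n) (x : R) : R := complex.Re (cdot (f x) (g x)).
Let ridot (f g : R -> 'cV[C]_n) : R := Rintegral mu unit_itv (rdot f g).

Local Notation rint f := (mu.-integrable unit_itv (EFin \o f)).

Let rint_dot (f g : L2fun) : rint (rdot f g).
Proof.
have h k : true -> mu.-integrable unit_itv (EFin \o (fun x =>
  (complex.Re (f x k ord0) * complex.Re (g x k ord0) +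
   complex.Im (f x k ord0) * complex.Im (g x k ord0)))).
  move=> _; have [fr fi] := L2funP f k; have [gr gi] := L2funP g k.
  exact: rintD (L2real_mul fr gr) (L2real_mul fi gi).
have := integrable_sum (@measurable_unit_itv R) (index_enum 'I_n) h.
congr (mu.-integrable _ _); apply/funext => x /=.
by rewrite /rdot cdotE sumEFin.
Qed.

Let ridot_ae (f g f' g' : L2fun) :
  ae_eq mu unit_itv (f : R -> 'cV[C]_n) f' ->
  ae_eq mu unit_itv (g : R -> 'cV[C]_n) g' -> ridot f g = ridot f' g'.
Proof.
move=> ff' gg'; rewrite /ridot /Rintegral; congr fine.
apply: ae_eq_integral.
- exact: measurable_unit_itv.
- exact: (measurable_int mu (rint_dot f g)).
- exact: (measurable_int mu (rint_dot f' g')).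
- by apply: filterS2 ff' gg' => x fx gx xI; rewrite /rdot /= fx// gx.
Qed.

Let ridot_ge0 f : 0 <= ridot f f.
Proof.
apply: Rintegral_ge0 => x _; rewrite /rdot cdotE.
by apply: sumr_ge0 => k _; rewrite -!expr2 addr_ge0 ?sqr_ge0.
Qed.

Let ridot_quad (f g : L2fun) (t : R) :
  ridot (f + (t%:C)%C *: g : L2fun) (f + (t%:C)%C *: g : L2fun) =
  ridot g g * t ^+ 2 + 2 * ridot f g * t + ridot f f.
Proof.
have mI : measurable (unit_itv : set (measurableTypeR R)).
  exact: measurable_unit_itv.
have Z a h := @RintegralZl _ _ _ mu unit_itv h a mI.
have D h1 h2 := @RintegralD _ _ _ mu unit_itv h1 h2 mI.
rewrite (_ : ridot _ _ = Rintegral mu unit_itv (fun x =>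
    t ^+ 2 * rdot g g x + (2 * t * rdot f g x) + rdot f f x)).
  rewrite D; [|exact: rintD (rintZ _ (rint_dot _ _)) (rintZ _ (rint_dot _ _))
              |exact: rint_dot].
  rewrite D; [|exact: rintZ (rint_dot _ _)|exact: rintZ (rint_dot _ _)].
  rewrite Z; last exact: rint_dot.
  rewrite Z; last exact: rint_dot.
  rewrite /ridot; ring.
apply: eq_Rintegral => x _; rewrite /rdot !cdotE !mulr_sumr -!big_split/=.
apply: eq_bigr => k _.
rewrite (_ : (_ + _ : R -> 'cV[C]_n) x = f x + (t%:C)%C *: g x)// !mxE.
by case: (f x k ord0) (g x k ord0) => [? ?] [? ?] /=; ring.
Qed.

Let ridotD (f g : L2fun) :
  ridot (f + g : L2fun) (f + g : L2fun) = ridot f f + 2 * ridot f g + ridot g g.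
Proof. by have := ridot_quad f g 1; rewrite scale1r => ->; ring. Qed.

Let ridotCS (f g : L2fun) : ridot f g <= Num.sqrt (ridot f f) * Num.sqrt (ridot g g).
Proof.
rewrite -sqrtrM ?ridot_ge0//.
have [s0|s0] := leP (ridot f g) 0; first by rewrite (le_trans s0)// sqrtr_ge0.
rewrite -(ger0_norm (ltW s0)) -sqrtr_sqr; apply: ler_wsqrtr.
pose p : {poly R} := Poly [:: ridot f f; 2 * ridot f g; ridot g g].
have := @deg_le2_poly_ge0 R p; rewrite /= => /(_ (size_Poly _)).
rewrite !coef_Poly /= => H.
have : (2 * ridot f g) ^+ 2 - 4 * ridot g g * ridot f f <= 0.
  apply: H => t; have := ridot_ge0 (f + (t%:C)%C *: g : L2fun).
  by rewrite ridot_quad horner_Poly /=; congr (_ <= _); ring.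
by nra.
Qed.

(** A complex number with zero imaginary part, as required by the norm of a
    [normedModType] over [R[i]]. *)
Definition L2norm (u : L2) : C := (Num.sqrt (complex.Re (L2dot u u)))%:C%C.

Let L2normE (u : L2) : L2norm u = (Num.sqrt (ridot u u))%:C%C.
Proof. by []. Qed.

Lemma L2_ler_normD (u v : L2) : L2norm (u + v) <= L2norm u + L2norm v.
Proof.
rewrite !L2normE -raddfD lecR.
have -> : ridot (u + v : L2) (u + v : L2) =
    ridot (repr u + repr v : L2fun) (repr u + repr v : L2fun).
  have h := L2D_ae u v.
  exact: (@ridot_ae (repr (u + v)) (repr (u + v)) (repr u + repr v) (repr u + repr v) h h).
rewrite ridotD -[leRHS]ger0_norm ?addr_ge0 ?sqrtr_ge0// -sqrtr_sqr.
apply: ler_wsqrtr.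
rewrite sqrrD !sqr_sqrtr ?ridot_ge0// lerD2r lerD2l -[leRHS]mulr_natl.
by rewrite ler_pM2l ?ltr0n//; exact: ridotCS.
Qed.

Lemma L2_normrZ (a : C) (u : L2) : L2norm (a *: u) = `|a| * L2norm u.
Proof.
rewrite !L2normE normc_def -rmorphM/= -sqrtrM ?addr_ge0 ?sqr_ge0//.
congr ((Num.sqrt _)%:C)%C.
have -> : ridot (a *: u : L2) (a *: u : L2) =
    ridot (a *: repr u : L2fun) (a *: repr u : L2fun).
  have h := L2Z_ae a u.
  exact: (@ridot_ae (repr (a *: u)) (repr (a *: u)) (a *: repr u) (a *: repr u) h h).
rewrite /ridot -RintegralZl; [|exact: measurable_unit_itv|exact: rint_dot].
apply: eq_Rintegral => x _; rewrite /rdot !cdotE !mulr_sumr.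
apply: eq_bigr => k _; rewrite L2funZE !mxE.
by case: a (L2_to_fun u x k ord0) => [? ?] [? ?] /=; ring.
Qed.

Lemma L2_normr0_eq0 (u : L2) : L2norm u = 0 -> u = 0.
Proof.
rewrite L2normE => -[] /eqP; rewrite sqrtr_eq0 => u0.
have {}u0 : ridot u u = 0 by apply/eqP; rewrite eq_le u0 ridot_ge0.
apply: L2_ext; apply: (ae_eq_trans (g := cst 0)); last first.
  by apply: ae_eq_sym; have := L2_pi_ae 0; rewrite /L2_to_fun !piE.
have iu := rint_dot (repr u) (repr u).
have pos x : 0 <= rdot u u x.
  by rewrite /rdot cdotE; apply: sumr_ge0 => k _; rewrite -!expr2 addr_ge0 ?sqr_ge0.
have Z : (\int[mu]_(x in unit_itv) `|(EFin \o rdot (repr u) (repr u)) x|)%E = 0.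
  under eq_integral => x _ do rewrite /= ger0_norm ?pos//.
  rewrite -[RHS]/(0%:E) -u0 /ridot /Rintegral fineK//.
  exact: (integrable_fin_num (@measurable_unit_itv R) iu).
have [+ _] := ae_eq_integral_abs mu (@measurable_unit_itv R) (measurable_int mu iu).
move=> /(_ Z); apply: filterS => x hx xI; apply/matrixP => k j; rewrite ord1 [RHS]mxE.
have /eqP := hx xI; rewrite /= eqe /rdot cdotE psumr_eq0 => [|i _]; last first.
  by rewrite -!expr2 addr_ge0 ?sqr_ge0.
move=> /allP/(_ k (mem_index_enum _)) /=.
rewrite -!expr2 paddr_eq0 ?sqr_ge0// !sqrf_eq0 => /andP[/eqP h1 /eqP h2].
by apply/eqP; rewrite eq_complex; apply/andP; split; apply/eqP.
Qed.

HB.instance Definition _ := Lmodule_isNormed.Build C L2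
  L2_ler_normD L2_normrZ L2_normr0_eq0.

End L2.

Section Operators.
Context {K : numFieldType} {V : normedModType K}.

Definition lin_span (A : set V) : set V :=
  [set x | exists (m : nat) (a : 'I_m -> K) (v : 'I_m -> V),
     (forall i, A (v i)) /\ x = \sum_i a i *: v i].

Definition compact_operator (T : {linear V -> V}) : Prop :=
  precompact (T @` [set x : V | `|x| <= 1]).

Definition root_vector (T : {linear V -> V}) : set V :=
  [set v | v != 0 /\
     exists (z : K) (k : nat), iter k (fun w => T w - z *: w) v = 0].

Definition closed_invariant_subspace (T : {linear V -> V}) (H : set V) : Prop :=
  [/\ H 0, (forall a x y, H x -> H y -> H (a *: x + y)), closed H &
      forall x, H x -> H (T x)].

(** Completeness in [H] of the restriction of [T] to an invariant subspace [H]: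
    the root vectors of the restriction are those of [T] lying in [H]. *)
Definition root_complete_in (T : {linear V -> V}) (H : set V) : Prop :=
  H `<=` closure (lin_span (root_vector T `&` H)).

Definition compact_complete (T : {linear V -> V}) : Prop :=
  compact_operator T /\ root_complete_in T setT.

Definition spectral_synthesis (T : {linear V -> V}) : Prop :=
  compact_complete T /\
  forall H, closed_invariant_subspace T H -> root_complete_in T H.

(** An unbounded operator is given by its graph [L : set (V * V)]; [resolvent_at]
    says that [T] is the bounded everywhere-defined inverse of [L - z]. *)
Definition resolvent_at (L : set (V * V)) (z : K) (T : {linear V -> V}) : Prop :=
  continuous (T : V -> V) /\ forall f g, T g = f <-> L (f, g + z *: f).

Definition complete_operator (L : set (V * V)) : Prop :=
  [/\ closed L,
      (exists z T, resolvent_at L z T) &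
      forall z T, resolvent_at L z T -> compact_complete T].

End Operators.

Section Dissipativity.
Context {R : realType} {n : nat}.

Definition accumulative (L : set (L2 R n * L2 R n)) : Prop :=
  forall f g, L (f, g) -> complex.Im (L2dot g f) <= 0.

Definition dissipative (L : set (L2 R n * L2 R n)) : Prop :=
  forall f g, L (f, g) -> 0 <= complex.Im (L2dot g f).

End Dissipativity.

Section DiracType.
Context {R : realType} {n : nat}.
Local Notation mu := (@lebesgue_measure R).
Local Notation C := R[i].

Definition L1mx (Q : R -> 'M[C]_n) : Prop :=
  forall i j, cintegrable (fun x => Q x i j).

(** [y] is the continuous (pointwise defined) representative of an element of
    W^{1,1}([0,1]; C^n) = AC([0,1]; C^n), and [dy] represents its derivative. *)
Definition W11_with_derivative (y dy : R -> 'cV[C]_n) : Prop :=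
  (forall k, cintegrable (fun x => dy x k ord0)) /\
  forall x, x \in `[0, 1] -> forall k,
    y x k ord0 = y 0 k ord0 + cintegral `[0, x] (fun t => dy t k ord0).

(** Graph of L_{C,D}(Q). Requiring the second component to be an element of [L2]
    encodes the condition -iB^{-1}y' + Qy in L^2 of the domain. *)
Definition L_CD (B : 'M[C]_n) (Q : R -> 'M[C]_n) (Cm Dm : 'M[C]_n) :
    set (L2 R n * L2 R n) :=
  [set fg : L2 R n * L2 R n | exists y dy : R -> 'cV[C]_n,
     [/\ W11_with_derivative y dy,
         Cm *m y 0 + Dm *m y 1 = 0,
         ae_eq mu unit_itv (fg.1 : R -> 'cV[C]_n) y &
         ae_eq mu unit_itv (fg.2 : R -> 'cV[C]_n)
           (fun x => (- 'i%C) *: (invmx B *m dy x) + Q x *m y x)]].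

End DiracType.

(* Main.v *)
(** Write [T] for the resolvent at [z] and [t u] for [Im (T u, u)] (with the
    opposite sign in the dissipative case); it is nonnegative.

    Traces.  For orthonormal [e_1, ..., e_m] the sum of the [t e_j] is bounded
    independently of the sequence: integrating by parts, [t e_j] is controlled
    by the values of [y_j = T e_j] at [0] and [1] and by the integral of
    [|Q| |y_j|^2], and the sum of the [|y_j(x)|^2] is bounded uniformly in [x]
    because [u |-> (T u)(x)] is a bounded functional on [L2].

    Synthesis (after Livsic).  Let [H] be a closed invariant subspace and [E] the
    closed span of the root vectors in [H].  A finite-dimensional [T]-invariant
    subspace has an orthonormal basis in which [T] is triangular, so its trace of
    [t] is the sum of the imaginary parts of the eigenvalues; these split between
    an orthonormal sequence in [E] and one in the orthogonal complement of [H].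
    Adding a unit vector [v] of [H] orthogonal to [E] gives an orthonormal
    sequence whose trace is larger by [t v].  Since the invariant
    subspaces are dense, iterating contradicts the bound on traces unless
    [t v = 0].  Hence [T] is symmetric on the complement of [E] in [H], where a
    compact symmetric operator would have an eigenvector, so [E = H].

    Existence of the resolvent is the Fredholm alternative for a compact
    resolvent at another point; completeness of its root vectors makes the range
    dense. *)

From HB Require Import structures.
Require Import Defs.
From mathcomp Require Import all_boot all_order all_algebra.
From mathcomp Require Import complex.
From mathcomp Require Import all_classical all_reals all_analysis measurable_realfun.
From mathcomp Require Import ring lra.

Set Implicit Arguments.
Unset Strict Implicit.
Unset Printing Implicit Defensive.

Import Order.TTheory GRing.Theory Num.Theory.
Import numFieldNormedType.Exports.

Local Open Scope classical_set_scope.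
Local Open Scope ring_scope.
Local Open Scope quotient_scope.

(** * Semi-inner products and orthonormal sequences *)

(** No theory of trace-class operators enters; bounds on finite sums stand in for it. The delicate
    step is the passage from an orthonormal sequence to a $T$-invariant subspace, where alone the
    trace is a sum of eigenvalues. It rests on nonnegativity: the trace of a nonnegative form over a
    subspace dominates its trace over the projections of the sequence, and these are close to the
    original vectors. The sequence orthogonal to [H] is triangular only for the compression
    [T - P T], but its diagonal entries are those of [T], because the range of [P] is orthogonal to
    it. On the analytic side [Q] is merely integrable, so the $L^2$ norm of [y] does not control the
    integral of $|Q||y|^2$; this is why a uniform bound on [y] is required. It comes from cutting
    $|Q|$ at a height above which its integral is so small that the supremum of $|y|$ can be
    absorbed. Estimates are run on squared norms, which are real, and a sign [s] with [s ^+ 2 = 1]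
    merges the accumulative and the dissipative case. *)

Definition sqmod {R : realType} (z : R[i]) : R :=
  complex.Re z ^+ 2 + complex.Im z ^+ 2.

Section SquaredModulus.
Context {R : realType}.
Implicit Types z w : R[i].

Lemma sqmod_ge0 z : 0 <= sqmod z.
Proof. by rewrite addr_ge0 ?sqr_ge0. Qed.

Lemma sqmodE z : z * conjc z = (sqmod z)%:C%C.
Proof.
by case: z => a b; apply/eqP; rewrite eq_complex /sqmod /=; apply/andP; split;
  apply/eqP; ring.
Qed.

Lemma sqmodM z w : sqmod (z * w) = sqmod z * sqmod w.
Proof. by case: z w => a b [c d]; rewrite /sqmod /=; ring. Qed.

Lemma sqmod_conj z : sqmod (conjc z) = sqmod z.
Proof. by case: z => a b; rewrite /sqmod /= sqrrN. Qed.

Lemma sqmod_real (x : R) : sqmod (x%:C%C) = x ^+ 2.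
Proof. by rewrite /sqmod /= expr0n addr0. Qed.

Lemma sqmod_eq0 z : (sqmod z == 0) = (z == 0).
Proof. by rewrite eq_complex /= paddr_eq0 ?sqr_ge0// !sqrf_eq0. Qed.

Lemma ReD z w : complex.Re (z + w) = complex.Re z + complex.Re w.
Proof. by case: z w => a b []. Qed.

Lemma ImD z w : complex.Im (z + w) = complex.Im z + complex.Im w.
Proof. by case: z w => a b []. Qed.

Lemma Re_sum (I : Type) (r : seq I) (P : pred I) (F : I -> R[i]) :
  complex.Re (\sum_(i <- r | P i) F i) = \sum_(i <- r | P i) complex.Re (F i).
Proof. by apply: (big_morph (@complex.Re R) ReD). Qed.

Lemma Im_sum (I : Type) (r : seq I) (P : pred I) (F : I -> R[i]) :
  complex.Im (\sum_(i <- r | P i) F i) = \sum_(i <- r | P i) complex.Im (F i).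
Proof. by apply: (big_morph (@complex.Im R) ImD). Qed.

Lemma Im_le_sqmod z : complex.Im z ^+ 2 <= sqmod z.
Proof. by rewrite lerDr sqr_ge0. Qed.

End SquaredModulus.

(** Semidefinite only, so that the same Cauchy-Schwarz and trace lemmas serve both the inner product
    and the form [im_form] of the imaginary part of an operator. *)
Record psd_form {R : realType} {V : lmodType R[i]} (S : V -> V -> R[i]) : Prop :=
  PsdForm {
    form_linear : forall a x y z, S (a *: x + y) z = a * S x z + S y z;
    form_conj : forall x y, S y x = conjc (S x y);
    form_ge0 : forall x, 0 <= complex.Re (S x x) }.

Section PsdForm.
Context {R : realType} {V : lmodType R[i]} (S : V -> V -> R[i]).
Hypothesis HS : psd_form S.
Implicit Types (a : R[i]) (x y z : V).
Local Notation Re := (@complex.Re R).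

Lemma form0l x : S 0 x = 0.
Proof.
by have := form_linear HS 1 0 0 x; rewrite scale1r addr0 mul1r => /eqP;
   rewrite eq_sym -subr_eq0 addrK => /eqP.
Qed.

Lemma formDl x y z : S (x + y) z = S x z + S y z.
Proof. by have := form_linear HS 1 x y z; rewrite scale1r mul1r. Qed.

Lemma formZl a x z : S (a *: x) z = a * S x z.
Proof. by have := form_linear HS a x 0 z; rewrite !addr0 form0l addr0. Qed.

Lemma form0r x : S x 0 = 0.
Proof. by rewrite (form_conj HS) form0l conjc0. Qed.

Lemma formDr x y z : S x (y + z) = S x y + S x z.
Proof. by rewrite (form_conj HS) formDl rmorphD/= -!(form_conj HS). Qed.

Lemma formZr a x z : S x (a *: z) = conjc a * S x z.
Proof. by rewrite (form_conj HS) formZl rmorphM/= -(form_conj HS). Qed.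

Lemma formNl x z : S (- x) z = - S x z.
Proof. by rewrite -scaleN1r formZl mulN1r. Qed.

Lemma formNr x z : S x (- z) = - S x z.
Proof. by rewrite -scaleN1r formZr rmorphN1 mulN1r. Qed.

Lemma formBl x y z : S (x - y) z = S x z - S y z.
Proof. by rewrite formDl formNl. Qed.

Lemma formBr x y z : S x (y - z) = S x y - S x z.
Proof. by rewrite formDr formNr. Qed.

Lemma form_suml (I : Type) (r : seq I) (P : pred I) (F : I -> V) z :
  S (\sum_(i <- r | P i) F i) z = \sum_(i <- r | P i) S (F i) z.
Proof. exact: (big_morph (S^~ z) (fun x y => formDl x y z) (form0l z)). Qed.

Lemma form_sumr (I : Type) (r : seq I) (P : pred I) (F : I -> V) z :
  S z (\sum_(i <- r | P i) F i) = \sum_(i <- r | P i) S z (F i).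
Proof. exact: (big_morph (S z) (fun x y => formDr z x y) (form0r z)). Qed.

Lemma form_real x : S x x = (Re (S x x))%:C%C.
Proof.
have := form_conj HS x x; case: (S x x) => a b /= [] /eqP.
by rewrite -addr_eq0 -mulr2n mulrn_eq0 /= => /eqP ->.
Qed.

Lemma form_quad a x y : Re (S (x - a *: y) (x - a *: y)) =
  Re (S x x) - 2 * Re (a * S y x) + sqmod a * Re (S y y).
Proof.
rewrite formBl !formBr !formZl !formZr (form_conj HS y x) (form_real y).
by case: a (S x x) (S y x) => [? ?] [? ?] [? ?]; rewrite /sqmod /=; ring.
Qed.

Lemma form_CS x y : sqmod (S x y) <= Re (S x x) * Re (S y y).
Proof.
have [y0|y0] := eqVneq (Re (S y y)) 0.
  rewrite y0 mulr0 leNgt; apply/negP => p.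
  (* With [S y y] zero the quadratic is affine in the multiple of [y]; this multiple gives it the
     negative value [- Re (S x x) - 2]. *)
  pose k : R := (Re (S x x) + 1) / sqmod (S x y).
  have := form_ge0 HS (x - (k%:C%C * S x y) *: y).
  rewrite form_quad y0 mulr0 addr0 -mulrA (form_conj HS x y) sqmodE -rmorphM/=.
  rewrite /k divfK ?gt_eqF// => h; have := form_ge0 HS x; lra.
have {}y0 : 0 < Re (S y y) by rewrite lt_neqAle eq_sym y0 (form_ge0 HS).
pose k : R := (Re (S y y))^-1.
have := form_ge0 HS (x - (k%:C%C * S x y) *: y).
rewrite form_quad -mulrA {1}(form_conj HS x y) sqmodE -rmorphM/= sqmodM sqmod_real.
rewrite -(pmulr_lge0 _ y0) /k.
by move=> h; rewrite -subr_ge0; apply: le_trans h _; rewrite le_eqVlt; apply/orP; left; apply/eqP; field; rewrite gt_eqF.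
Qed.

Lemma form_eq0 x y : Re (S y y) = 0 -> S x y = 0.
Proof.
move=> y0; have := form_CS x y; rewrite y0 mulr0 => h.
by apply/eqP; rewrite -sqmod_eq0 eq_le h sqmod_ge0.
Qed.

Lemma form_pythagoras x y : S x y = 0 ->
  Re (S (x + y) (x + y)) = Re (S x x) + Re (S y y).
Proof.
move=> xy; rewrite formDl !formDr xy (form_conj HS x y) xy conjc0.
by rewrite addr0 add0r ReD.
Qed.

End PsdForm.
Record inner_product {R : realType} {V : lmodType R[i]} (dot : V -> V -> R[i]) :
  Prop := InnerProduct {
    inner_form :> psd_form dot;
    inner_eq0 : forall x, complex.Re (dot x x) = 0 -> x = 0 }.

Section Orthonormal.
Context {R : realType} {V : lmodType R[i]} (dot : V -> V -> R[i]).
Hypothesis Hdot : inner_product dot.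
Implicit Types (a : R[i]) (x y z e : V) (s u f : seq V).
Local Notation Re := (@complex.Re R).
Local Notation normsq x := (Re (dot x x)).

Fixpoint orthonormal_seq s : Prop :=
  if s is e :: s' then
    [/\ dot e e = 1, forall x, x \in s' -> dot x e = 0 & orthonormal_seq s']
  else True.

Definition proj s x : V := \sum_(e <- s) dot x e *: e.

(** For an orthonormal [s], membership in the linear span of [s]. *)
Definition in_span s x : Prop := proj s x = x.

Lemma projP s a x y : proj s (a *: x + y) = a *: proj s x + proj s y.
Proof.
rewrite /proj scaler_sumr -big_split/=; apply: eq_bigr => e _.
by rewrite (form_linear Hdot) scalerDl scalerA.
Qed.

Lemma proj0 s : proj s 0 = 0.
Proof. by rewrite /proj big1// => e _; rewrite (form0l Hdot) scale0r. Qed.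

Lemma proj_cons e s x : proj (e :: s) x = dot x e *: e + proj s x.
Proof. by rewrite /proj big_cons. Qed.

Lemma in_span0 s : in_span s 0. Proof. exact: proj0. Qed.

Lemma in_spanP s a x y : in_span s x -> in_span s y -> in_span s (a *: x + y).
Proof. by rewrite /in_span projP => -> ->. Qed.

Lemma in_spanD s x y : in_span s x -> in_span s y -> in_span s (x + y).
Proof. by rewrite -[x in x + _]scale1r; exact: in_spanP. Qed.

Lemma in_spanZ s a x : in_span s x -> in_span s (a *: x).
Proof.
by move=> h; rewrite -[_ *: _]addr0; apply: in_spanP => //; exact: in_span0.
Qed.

Lemma in_spanB s x y : in_span s x -> in_span s y -> in_span s (x - y).
Proof. by rewrite addrC -scaleN1r => hx hy; exact: in_spanP. Qed.

Lemma dot_conj0 x y : dot x y = 0 -> dot y x = 0.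
Proof. by move=> h; rewrite (form_conj Hdot) h conjc0. Qed.

Lemma dot_in_span s x y : in_span s x -> (forall e, e \in s -> dot y e = 0) ->
  dot y x = 0.
Proof.
move=> <- h; rewrite /proj (form_sumr Hdot) big_seq big1// => e es.
by rewrite (formZr Hdot) h// mulr0.
Qed.

Lemma proj_orthogonal s x : (forall e, e \in s -> dot x e = 0) -> proj s x = 0.
Proof. by move=> h; rewrite /proj big_seq big1// => e /h ->; rewrite scale0r. Qed.

Lemma dot_sum (c : V -> R[i]) s e : orthonormal_seq s -> e \in s ->
  dot (\sum_(g <- s) c g *: g) e = c e.
Proof.
elim: s => //= e' s IH [h1 h2 h3]; rewrite inE big_cons (formDl Hdot) (formZl Hdot).
case/orP => [/eqP ->|es]; last by rewrite (dot_conj0 (h2 _ es)) mulr0 add0r IH.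
rewrite h1 mulr1 (form_suml Hdot) big_seq big1 ?addr0// => g gs.
by rewrite (formZl Hdot) h2// mulr0.
Qed.

Lemma dot_proj s x e : orthonormal_seq s -> e \in s -> dot (proj s x) e = dot x e.
Proof. exact: dot_sum. Qed.

Lemma proj_in_span s x : orthonormal_seq s -> in_span s (proj s x).
Proof.
move=> hs; rewrite /in_span {1}/proj [RHS]/proj !big_seq.
by apply: eq_bigr => e es; rewrite dot_proj.
Qed.

Lemma mem_in_span s e : orthonormal_seq s -> e \in s -> in_span s e.
Proof.
elim: s => //= e' s IH [h1 h2 h3]; rewrite inE => /orP[/eqP ->|es];
  rewrite /in_span proj_cons.
  rewrite h1 scale1r proj_orthogonal ?addr0// => x xs.
  by apply: dot_conj0; exact: h2.
by rewrite (h2 _ es) scale0r add0r; exact: IH.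
Qed.

Lemma in_span_cons e s x : orthonormal_seq (e :: s) -> in_span s x ->
  in_span (e :: s) x.
Proof.
move=> [_ h _] hx; rewrite /in_span proj_cons hx.
suff -> : dot x e = 0 by rewrite scale0r add0r.
apply: dot_conj0; apply: (@dot_in_span s) => // y ys.
by apply: dot_conj0; exact: h.
Qed.

Lemma sub_proj_orthogonal s x y : orthonormal_seq s -> in_span s y ->
  dot (x - proj s x) y = 0.
Proof.
move=> hs /dot_in_span; apply => e es.
by rewrite (formBl Hdot) dot_proj// subrr.
Qed.

Lemma normsq_proj s x : orthonormal_seq s ->
  normsq (proj s x) = \sum_(e <- s) sqmod (dot x e).
Proof.
move=> hs; rewrite {2}/proj (form_sumr Hdot) Re_sum big_seq [RHS]big_seq.
apply: eq_bigr => e es.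
by rewrite (formZr Hdot) dot_proj// mulrC sqmodE.
Qed.

Lemma normsq_split s x : orthonormal_seq s ->
  normsq x = normsq (proj s x) + normsq (x - proj s x).
Proof.
move=> hs; rewrite -(form_pythagoras Hdot); first by rewrite addrC subrK.
by apply: dot_conj0; apply: (sub_proj_orthogonal x hs); exact: proj_in_span.
Qed.

Lemma bessel s x : orthonormal_seq s -> \sum_(e <- s) sqmod (dot x e) <= normsq x.
Proof.
by move=> hs; rewrite (normsq_split x hs) normsq_proj// lerDl (form_ge0 Hdot).
Qed.

Lemma best_approximation s x y : orthonormal_seq s -> in_span s y ->
  normsq (x - proj s x) <= normsq (x - y).
Proof.
move=> hs hy.
have -> : x - y = (x - proj s x) + (proj s x - y) by rewrite addrA subrK.
rewrite (form_pythagoras Hdot (x := x - proj s x)); first by rewrite lerDl (form_ge0 Hdot).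
apply: (sub_proj_orthogonal x hs); apply: in_spanB => //; exact: proj_in_span.
Qed.

(** Removing from [S] the rank-one form through [e] reduces the dimension. *)
Lemma trace_compression_le f : orthonormal_seq f ->
  forall (S : V -> V -> R[i]) u, psd_form S -> orthonormal_seq u ->
  \sum_(x <- u) Re (S (proj f x) (proj f x)) <= \sum_(e <- f) Re (S e e).
Proof.
elim: f => [_ S u HS hu|e f IH hf S u HS hu].
  rewrite big_nil big1// => x _.
  by rewrite /proj !big_nil (form0l HS).
have [h1 h2 h3] := hf.
have e_ker S' : psd_form S' -> Re (S' e e) = 0 -> forall x,
    S' (proj (e :: f) x) (proj (e :: f) x) = S' (proj f x) (proj f x).
  move=> HS' Se x; have Se0 y := form_eq0 HS' y Se.
  rewrite proj_cons (formDl HS') !(formDr HS') !(formZl HS') !(formZr HS').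
  by rewrite (form_conj HS' (proj f x) e) !Se0 conjc0 !mulr0 !add0r.
have [S0|S0] := eqVneq (Re (S e e)) 0.
  rewrite big_cons S0 add0r.
  by under [leLHS]eq_bigr do rewrite (e_ker _ HS S0); exact: IH.
have {}S0 : 0 < Re (S e e) by rewrite lt_neqAle eq_sym S0 (form_ge0 HS).
pose k : R := (Re (S e e))^-1.
(* [S'] remains nonnegative by Cauchy-Schwarz and has [e] in its kernel, so only the projection to
   [f] matters for it and the induction hypothesis applies. *)
pose S' x y := S x y - k%:C%C * (S x e * S e y).
have S'E x : Re (S' x x) = Re (S x x) - k * sqmod (S x e).
  by rewrite /S' (form_conj HS x e) sqmodE -rmorphM/= raddfB.
have HS' : psd_form S'.
  split=> [a x y z|x y|x].
  - rewrite /S' !(form_linear HS); ring.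
  - rewrite /S' rmorphB !rmorphM/= -!(form_conj HS) oppr0.
    by congr (_ - _ * _); rewrite mulrC.
  - rewrite S'E subr_ge0 /k mulrC ler_pdivrMr//; exact: form_CS.
have S'e : Re (S' e e) = 0.
  by rewrite S'E (form_real HS) sqmod_real /k; field; rewrite gt_eqF.
have SE x : Re (S x x) = Re (S' x x) + k * sqmod (S x e) by rewrite S'E subrK.
under [leLHS]eq_bigr do rewrite SE (e_ker _ HS' S'e).
under [leRHS]eq_bigr do rewrite SE.
rewrite !big_split/= lerD//.
  by rewrite big_cons S'e add0r; exact: IH.
rewrite -!mulr_sumr ler_pM2l ?invr_gt0//.
(* [w] represents the functional [S _ e] on the span of [e :: f]. The right-hand sum is its squared
   norm, the left-hand one the sum of its squared coefficients along [u], and Bessel's inequality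
   compares them. *)
pose w := \sum_(g <- e :: f) conjc (S g e) *: g.
have wE g : g \in e :: f -> dot w g = conjc (S g e).
  exact: (dot_sum (fun g => conjc (S g e))).
have wP : in_span (e :: f) w.
  rewrite /in_span /proj; apply: (@etrans _ _ (\sum_(g <- e :: f) conjc (S g e) *: g)).
    by rewrite big_seq [RHS]big_seq; apply: eq_bigr => g gf; rewrite wE.
  by [].
have -> : \sum_(g <- e :: f) sqmod (S g e) = normsq w.
  rewrite -[w in dot w]wP -[w in dot _ w]wP normsq_proj// !big_seq.
  by apply: eq_bigr => g gf; rewrite wE// sqmod_conj.
apply: le_trans (bessel w hu); rewrite le_eqVlt; apply/orP; left; apply/eqP.
apply: eq_bigr => x _; rewrite -[RHS]sqmod_conj -(form_conj Hdot); congr sqmod.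
rewrite /w /proj (form_suml HS) (form_sumr Hdot); apply: eq_bigr => g _.
by rewrite (formZl HS) (formZr Hdot) conjcK mulrC.
Qed.

End Orthonormal.

(** * Orthonormal bases adapted to flags of invariant subspaces *)

Section TriangularFlag.
Context {R : realType} {V : lmodType R[i]} (dot : V -> V -> R[i]).
Hypothesis Hdot : inner_product dot.
Implicit Types (a : R[i]) (x y z e v w : V) (s : seq V) (A : V -> V).
Local Notation Re := (@complex.Re R).
Local Notation normsq x := (Re (dot x x)).

(** The reversed sequence is an orthonormal basis, adapted to a flag of
    [A]-invariant subspaces, in which [A] is upper triangular. *)
Fixpoint triangular A s : Prop :=
  if s is e :: s' then
    [/\ dot e e = 1, forall x, x \in s' -> dot x e = 0,
        in_span dot (e :: s') (A e) & triangular A s']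
  else True.

Lemma triangular_orthonormal A s : triangular A s -> orthonormal_seq dot s.
Proof. by elim: s => //= e s IH [h1 h2 _ /IH]. Qed.

Lemma triangular_in_span A s x : linear A -> triangular A s ->
  in_span dot s x -> in_span dot s (A x).
Proof.
move=> lA; elim: s x => [x _|e s IH x es].
  rewrite /in_span /proj !big_nil => <-.
  by have := lA (-1) 0 0; rewrite scaler0 addr0 scaleN1r addNr.
have hs := triangular_orthonormal es; case: es => h1 h2 h3 h4 <-.
rewrite proj_cons lA; apply: (in_spanP Hdot) => //.
by apply: (in_span_cons Hdot) => //; apply: IH => //; apply: (proj_in_span Hdot); case: hs.
Qed.

Lemma normalizable x : x != 0 ->
  exists2 c : R[i], c != 0 & dot (c *: x) (c *: x) = 1.
Proof.
move=> x0; have p : 0 < normsq x.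
  rewrite lt_neqAle (form_ge0 Hdot) andbT eq_sym.
  by apply: contra_neq x0; exact: (inner_eq0 Hdot).
exists ((Num.sqrt (normsq x))^-1)%:C%C.
  by rewrite fmorph_eq0 invr_eq0 gt_eqF ?sqrtr_gt0.
rewrite (formZl Hdot) (formZr Hdot) mulrA sqmodE sqmod_real (form_real Hdot).
by rewrite -rmorphM/= exprVn sqr_sqrtr ?ltW// mulVf ?gt_eqF.
Qed.

(** One Gram-Schmidt step: [w] is an eigenvector modulo the span of [s], hence so is its component
    orthogonal to that span. The formula for [e] is part of the conclusion because
    [triangular_split] reads off from it that [e] lies in [H] or is orthogonal to [H]. *)
Lemma triangular_extend A s w (mu : R[i]) : linear A -> triangular A s ->
  in_span dot s (A w - mu *: w) -> ~ in_span dot s w ->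
  exists e c, [/\ e = c *: (w - proj dot s w), triangular A (e :: s),
    dot (A e) e = mu & in_span dot (e :: s) w].
Proof.
move=> lA hs hw nw; have os := triangular_orthonormal hs.
have x0 : w - proj dot s w != 0 by apply/eqP => /subr0_eq h; exact: nw.
have [c c0 hc] := normalizable x0.
set e := c *: _ in hc.
have eo x : in_span dot s x -> dot e x = 0.
  by move=> xs; rewrite (formZl Hdot) (sub_proj_orthogonal Hdot)// mulr0.
have oe : orthonormal_seq dot (e :: s).
  split=> // x xs; apply: (dot_conj0 Hdot); apply: eo.
  exact: (mem_in_span Hdot).
have ee : in_span dot (e :: s) e by apply: (mem_in_span Hdot) => //; rewrite mem_head.
have hp : in_span dot s (proj dot s w) by exact: (proj_in_span Hdot).
have Ae : in_span dot s (A e - mu *: e).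
  have -> : A e - mu *: e =
      c *: ((A w - mu *: w) - (A (proj dot s w) - mu *: proj dot s w)).
    have A0 : A 0 = 0 by have := lA (-1) 0 0; rewrite scaler0 addr0 scaleN1r addNr.
    have -> : A e = c *: (A w - A (proj dot s w)).
      rewrite /e -[c *: _]addr0 lA A0 addr0; congr (_ *: _).
      by rewrite addrC -scaleN1r lA scaleN1r addrC.
    rewrite /e scalerA [mu * c]mulrC -scalerA -scalerBr; congr (_ *: _).
    by rewrite scalerBr opprD addrACA -opprD.
  apply: (in_spanZ Hdot); apply: (in_spanB Hdot) => //.
  apply: (in_spanB Hdot); last exact: (in_spanZ Hdot).
  exact: triangular_in_span.
exists e, c; split => //.
- split => //; first by case: oe.
  rewrite -(subrK (mu *: e) (A e)); apply: (in_spanD Hdot).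
    exact: (in_span_cons Hdot).
  exact: (in_spanZ Hdot).
- rewrite -(subrK (mu *: e) (A e)) (formDl Hdot) (formZl Hdot) hc mulr1.
  by rewrite (dot_conj0 Hdot (eo _ Ae)) add0r.
- rewrite -(subrK (proj dot s w) w); apply: (in_spanD Hdot).
    have -> : w - proj dot s w = c^-1 *: e by rewrite scalerA mulVf ?scale1r.
    exact: (in_spanZ Hdot).
  exact: (in_span_cons Hdot).
Qed.

(** A root vector is absorbed starting from the eigenvector end of its chain: once [A v - mu *: v]
    lies in the span, [v] is an eigenvector modulo the span. *)
Lemma triangular_root A s v (mu : R[i]) k : linear A -> triangular A s ->
  iter k (fun w => A w - mu *: w) v = 0 ->
  exists s', [/\ triangular A s', forall x, in_span dot s x -> in_span dot s' x &
    in_span dot s' v].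
Proof.
move=> lA hs; elim: k v => [v /= ->|k IH v].
  by exists s; split => //; exact: in_span0.
rewrite iterSr => /IH[s1 [h1 h2 h3]].
have [vs|vs] := pselect (in_span dot s1 v); first by exists s1.
have [e [c [_ h4 _ h5]]] := triangular_extend lA h1 h3 vs.
exists (e :: s1); split => // x /h2; apply: (in_span_cons Hdot).
exact: triangular_orthonormal h4.
Qed.

End TriangularFlag.

(** * Splitting a triangular sequence along an invariant subspace *)

Section Splitting.
Context {R : realType} {V : lmodType R[i]} (dot : V -> V -> R[i]).
Hypothesis Hdot : inner_product dot.
Variables (T P : V -> V) (H : V -> Prop).
Hypothesis lT : linear T.
Hypothesis lP : linear P.
Hypothesis HP : forall x, H (P x).
Hypothesis HC : forall x h, H h -> dot (x - P x) h = 0.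
Hypothesis H_sub : forall a x y, H x -> H y -> H (a *: x + y).
Hypothesis H_inv : forall x, H x -> H (T x).
Implicit Types (a : R[i]) (x y e v w h : V) (s : seq V).
Let Q (x : V) := x - P x.

Let H0 : H 0.
Proof.
by rewrite -(addNr (P 0)) -scaleN1r; apply: H_sub; exact: HP.
Qed.

Let lQ : linear Q.
Proof.
by move=> a x y; rewrite /Q lP scalerBr opprD addrACA.
Qed.

Let Q_eq0 x : H x <-> Q x = 0.
Proof.
split=> [Hx|/subr0_eq ->]; last exact: HP.
apply: (inner_eq0 Hdot); rewrite HC//.
by rewrite /Q addrC -scaleN1r; exact: H_sub.
Qed.

Let linearB' (f : V -> V) x y : linear f -> f (x - y) = f x - f y.
Proof. by move=> lf; rewrite addrC -scaleN1r lf scaleN1r addrC. Qed.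

Let linearZ' (f : V -> V) a x : linear f -> f (a *: x) = a *: f x.
Proof.
move=> lf; have f0 : f 0 = 0 by have := linearB' 0 0 lf; rewrite !subrr.
by rewrite -[a *: x]addr0 lf f0 addr0.
Qed.

Let HB x y : H x -> H y -> H (x - y).
Proof. by rewrite addrC -scaleN1r => hx hy; exact: H_sub. Qed.

Let HZ a x : H x -> H (a *: x).
Proof. by rewrite -[a *: x]addr0 => hx; exact: H_sub. Qed.

Let H_proj s x : (forall e, e \in s -> H e) -> H (proj dot s x).
Proof.
elim: s => [_|e s IH hs]; first by rewrite /proj big_nil.
rewrite proj_cons; apply: H_sub; first by apply: hs; rewrite mem_head.
by apply: IH => g gs; apply: hs; rewrite inE gs orbT.
Qed.

(** Let [F] be the span of [s]. The construction makes [a] a basis of the intersection of [F] with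
    [H], and [g] a basis of the image of [F] under [Q], a model of the quotient of [F] by that
    intersection. The eigenvalues of [T] on [F] are those on the two pieces together. *)
Lemma triangular_split s : triangular dot T s ->
  exists a g : seq V,
    [/\ triangular dot T a, forall x, x \in a -> H x,
        triangular dot (fun x => T x - P (T x)) g,
        forall x h, x \in g -> H h -> dot x h = 0 &
        \sum_(e <- a) dot (T e) e + \sum_(e <- g) dot (T e) e =
        \sum_(e <- s) dot (T e) e].
Proof.
(* The induction also carries that the span of [a] is the part of the span of [s] inside [H], and
   that the span of [g] is the image of the span of [s] under [Q]. *)
move=> hs; suff [a [g [[h1 h2 h3 h4 h5] _]]] : exists a g : seq V,
    [/\ triangular dot T a, forall x, x \in a -> H x,
        triangular dot (Q \o T) g,
        forall x h, x \in g -> H h -> dot x h = 0 &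
        \sum_(e <- a) dot (T e) e + \sum_(e <- g) dot (T e) e =
        \sum_(e <- s) dot (T e) e] /\
    [/\ forall x, in_span dot s x -> in_span dot g (Q x),
        forall x, in_span dot s x -> H x -> in_span dot a x,
        forall x, in_span dot a x -> in_span dot s x &
        forall y, in_span dot g y -> exists2 v, in_span dot s v & y = Q v].
  by exists a, g.
have nilE x : in_span dot [::] x -> x = 0.
  by rewrite /in_span /proj big_nil.
have lQT : linear (Q \o T).
  by move=> a x y; rewrite /= lT; exact: lQ.
elim: s hs => [_|f s IH /[dup] ofs [ff fs Tf hs]].
  exists [::], [::]; split; [split => //; by rewrite !big_nil addr0|split].
  - by move=> x /nilE ->; rewrite (Q_eq0 0).1//; exact: in_span0.
  - by [].
  - by [].
  - move=> y /nilE ->; exists 0; first exact: in_span0.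
    by rewrite (Q_eq0 0).1.
have {IH}[a [g [[ha aH hg gH sum] [i1 i2 i3 i4]]]] := IH hs.
have os := triangular_orthonormal ofs.
have sub x : in_span dot s x -> in_span dot (f :: s) x by exact: in_span_cons.
have oa := triangular_orthonormal ha.
have og := triangular_orthonormal hg.
set mu := dot (T f) f.
have ffs : in_span dot (f :: s) f by apply: mem_in_span => //; rewrite mem_head.
have Tfmu : in_span dot s (T f - mu *: f).
  by rewrite -[T f in X in in_span _ _ X]Tf proj_cons addrAC subrr add0r;
    apply: proj_in_span => //; case: os.
have dec x : in_span dot (f :: s) x ->
    exists2 x', in_span dot s x' & x = dot x f *: f + x'.
  move=> <-; exists (proj dot s x).
    by apply: proj_in_span => //; case: os.
  by rewrite {1}proj_cons (_ : dot (proj dot (f :: s) x) f = dot x f)// dot_proj// mem_head.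
(* The new dimension goes to exactly one piece. If [Q f] adds nothing to the image, subtracting a
   suitable [v] in the span of [s] from [f] produces a new vector of [H], with the same eigenvalue
   [mu]. *)
have [Qf|Qf] := pselect (in_span dot g (Q f)).
  have [v vs Qv] := i4 _ Qf.
  have Hh : H (f - v) by apply/Q_eq0; rewrite (linearB' _ _ lQ) Qv subrr.
  have h1 : in_span dot a (T (f - v) - mu *: (f - v)).
    apply: i2; last by apply: HB; [exact: H_inv|exact: HZ].
    rewrite linearB'// scalerBr opprD addrACA -opprD; apply: in_spanB => //.
    apply: in_spanB => //; last exact: in_spanZ.
    exact: (triangular_in_span Hdot lT hs).
  have h2 : ~ in_span dot a (f - v).
    move=> /i3 h; have fs' : in_span dot s f.
      by rewrite -(subrK v f); exact: in_spanD.
    have : dot f f = 0.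
      by apply: (dot_in_span Hdot fs') => e es; apply: (dot_conj0 Hdot); exact: fs.
    by rewrite ff => /eqP; rewrite oner_eq0.
  have [e [c [eE he eT ev]]] := triangular_extend Hdot lT ha h1 h2.
  have eH : H e by rewrite eE; apply: HZ; apply: HB => //; exact: H_proj.
  have oe := triangular_orthonormal he.
  exists (e :: a), g; split.
    split => //; first by move=> x; rewrite inE => /orP[/eqP ->//|]; exact: aH.
    by rewrite !big_cons eT -addrA sum.
  split.
  - move=> x /dec[x' x's ->]; rewrite lQ; apply: in_spanP => //; exact: i1.
  - move=> x /dec[x' x's xE] Hx; set k := dot x f in xE.
    have xv : x - k *: (f - v) = k *: v + x'.
      by rewrite xE scalerBr opprB addrC addrA subrK.
    rewrite -(subrK (k *: (f - v)) x); apply: in_spanD => //.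
      apply: in_span_cons => //; apply: i2; last by apply: HB => //; exact: HZ.
      by rewrite xv; exact: in_spanP.
    exact: in_spanZ.
  - move=> x <-; rewrite proj_cons; apply: in_spanP => //; last first.
      by apply: sub; apply: i3; exact: proj_in_span.
    rewrite eE; apply: in_spanZ => //; apply: in_spanB => //.
      by apply: in_spanB => //; exact: sub.
    by apply: sub; apply: i3; exact: proj_in_span.
  - by move=> y /i4[v' v's ->]; exists v' => //; exact: sub.
(* Otherwise [Q f] is new, and it is an eigenvector of [Q \o T] modulo the span of [g], because [Q]
   kills [T (P f)]. *)
have h1 : in_span dot g (Q (T (Q f)) - mu *: Q f).
  have -> : Q (T (Q f)) - mu *: Q f = Q (T f - mu *: f).
    rewrite (linearB' _ _ lQ) (linearZ' _ _ lQ) (linearB' _ _ lT).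
    rewrite (linearB' (T f) _ lQ); have /Q_eq0 -> := H_inv (HP f).
    by rewrite subr0.
  exact: i1.
have [e [c [eE he eT ev]]] := triangular_extend Hdot lQT hg h1 Qf.
have oe := triangular_orthonormal he.
have eH h : H h -> dot e h = 0.
  move=> Hh; rewrite eE (formZl Hdot) (formBl Hdot) HC// (dot_conj0 Hdot) ?subr0 ?mulr0//.
  apply: (dot_in_span Hdot (proj_in_span Hdot _ og)) => x xg.
  by apply: (dot_conj0 Hdot); exact: gH.
exists a, (e :: g); split.
  split => //.
    by move=> x h; rewrite inE => /orP[/eqP ->|/gH]; [exact: eH|exact].
  rewrite !big_cons addrCA sum; congr (_ + _); rewrite -[RHS]eT /= /Q (formBl Hdot).
  by rewrite (dot_conj0 Hdot (eH _ (HP (T e)))) subr0.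
split.
- move=> x /dec[x' x's ->]; rewrite lQ; apply: in_spanP => //.
  by apply: in_span_cons => //; exact: i1.
- move=> x /dec[x' x's xE] Hx; set k := dot x f in xE.
  have [k0|k0] := eqVneq k 0.
    by apply: i2 => //; rewrite xE k0 scale0r add0r.
  (* A vector of [H] with a nonzero coefficient on [f] would force [Q f] into the span of [g]. *)
  exfalso; apply: Qf.
  have /Q_eq0 := Hx; rewrite {1}xE lQ => /eqP; rewrite addr_eq0 => /eqP QE.
  have -> : Q f = k^-1 *: (k *: Q f) by rewrite scalerA mulVf ?scale1r.
  apply: in_spanZ => //; rewrite QE -scaleN1r; apply: in_spanZ => //; exact: i1.
- by move=> x /i3; exact: sub.
- move=> y <-; rewrite proj_cons eE.
  have [v1 v1s v1E] := i4 _ (proj_in_span Hdot (Q f) og).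
  have [v2 v2s v2E] := i4 _ (proj_in_span Hdot y og).
  rewrite v1E v2E -(linearB' f _ lQ) -(linearZ' c _ lQ) -lQ.
  eexists; last by [].
  apply: in_spanP => //; last exact: sub.
  by apply: in_spanZ => //; apply: in_spanB => //; exact: sub.
Qed.

End Splitting.

(** * Compact operators and their root vectors *)

(** The norm of a [normedModType] over [R[i]] is a complex number. *)
Definition norm_from {R : realType} {V : normedModType R[i]}
    (dot : V -> V -> R[i]) : Prop :=
  forall x : V, `|x| = (Num.sqrt (complex.Re (dot x x)))%:C%C.

Section InnerProductTopology.
Context {R : realType} {V : normedModType R[i]} (dot : V -> V -> R[i]).
Hypothesis Hdot : inner_product dot.
Hypothesis Hnorm : norm_from dot.
Implicit Types (a : R[i]) (x y z e v w : V).
Local Notation Re := (@complex.Re R).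
Local Notation normsq x := (Re (dot x x)).

Lemma norm_lt x (r : R) : 0 < r -> (`|x| < r%:C%C) = (normsq x < r ^+ 2).
Proof.
move=> r0; rewrite Hnorm ltcR -[in RHS](sqr_sqrtr (form_ge0 Hdot x)).
by rewrite ltr_pXn2r// nnegrE ?sqrtr_ge0// ltW.
Qed.

Lemma norm_le x (r : R) : 0 <= r -> (`|x| <= r%:C%C) = (normsq x <= r ^+ 2).
Proof.
move=> r0; rewrite Hnorm lecR -[in RHS](sqr_sqrtr (form_ge0 Hdot x)).
by rewrite ler_pXn2r// nnegrE ?sqrtr_ge0.
Qed.

Lemma normsqZ a x : normsq (a *: x) = sqmod a * normsq x.
Proof.
by rewrite (formZl Hdot) (formZr Hdot) mulrA sqmodE (form_real Hdot) -rmorphM.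
Qed.

Lemma normsqN x : normsq (- x) = normsq x.
Proof. by rewrite (formNl Hdot) (formNr Hdot) opprK. Qed.

Lemma parallelogram x y :
  normsq (x + y) + normsq (x - y) = 2 * normsq x + 2 * normsq y.
Proof.
rewrite !(formDl Hdot) !(formDr Hdot) !(formNl Hdot) !(formNr Hdot) !ReD.
by rewrite !raddfN/=; ring.
Qed.

(** Takes the place of the triangle inequality without square roots; most factors 2, 4 and 8 in the
    choices of epsilon below come from it. *)
Lemma normsqD_le x y : normsq (x + y) <= 2 * normsq x + 2 * normsq y.
Proof. by rewrite -parallelogram lerDl (form_ge0 Hdot). Qed.

(** Radii of balls are positive elements of [R[i]], hence real, so the topology can be tested with
    real bounds on squared norms. *)
Lemma closure_normsqP (A : set V) x :
  closure A x <-> forall r : R, 0 < r -> exists2 y, A y & normsq (x - y) < r.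
Proof.
split=> [cA r r0|h B /nbhs_normP[r /= r0 rB]].
  have s0 : 0 < Num.sqrt r by rewrite sqrtr_gt0.
  have [|y [Ay]] := cA (ball_ (@Num.norm R[i] V) x (Num.sqrt r)%:C%C).
    by apply/nbhs_normP; exists (Num.sqrt r)%:C%C => //=; rewrite ltcR.
  rewrite /= norm_lt// sqr_sqrtr ?ltW// => ?; by exists y.
have [r1 rE] : exists r1 : R, r = r1%:C%C by apply/complex_realP; exact: gtr0_real.
rewrite rE ltcR in r0 rB.
have [y Ay yr] := h (r1 ^+ 2) (exprn_gt0 2 r0).
by exists y; split => //; apply: rB => /=; rewrite norm_lt.
Qed.

Lemma continuous_normsqP (T : {linear V -> V}) : continuous (T : V -> V) <->
  exists2 M : R, 0 < M & forall x, normsq (T x) <= M * normsq x.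
Proof.
split=> [/linear_bounded_continuous/linear_boundedP/pinfty_ex_gt0[r r0 hr]|[M M0 hM]].
  have [r1 rE] : exists r1 : R, r = r1%:C%C by apply/complex_realP; exact: gtr0_real.
  rewrite rE ltcR in r0 hr.
  exists (r1 ^+ 2) => [|x]; first exact: exprn_gt0.
  have := hr x; rewrite [`|x|]Hnorm -rmorphM/= norm_le; last first.
    by rewrite mulr_ge0 ?sqrtr_ge0// ltW.
  by rewrite exprMn sqr_sqrtr ?(form_ge0 Hdot).
apply/linear_bounded_continuous/linear_boundedP.
have s0 : 0 <= (Num.sqrt M)%:C%C :> R[i] by rewrite lecR sqrtr_ge0.
near=> r => x; apply: (@le_trans _ _ ((Num.sqrt M)%:C%C * `|x|)).
  rewrite [`|x|]Hnorm -rmorphM/= norm_le ?mulr_ge0 ?sqrtr_ge0//.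
  by rewrite exprMn !sqr_sqrtr ?(form_ge0 Hdot)// ltW.
rewrite ler_wpM2r//; near: r; apply: nbhs_pinfty_ge; exact: ger0_real.
Unshelve. all: by end_near. Qed.

(** The sequence is scaled into the unit ball, where precompactness of the image yields a cluster
    point. Terms of arbitrarily large index near it are all that is used later, so no subsequence is
    extracted. *)
Lemma compact_operator_cluster (T : {linear V -> V}) (u : nat -> V) (M : R) :
  compact_operator T -> (forall k, normsq (u k) <= M) ->
  exists y, forall (r : R) N, 0 < r ->
    exists2 k, (N <= k)%N & normsq (T (u k) - y) < r.
Proof.
move=> cT uM.
have [c c0 hc] : exists2 c : R, 0 < c & forall k, normsq (u k) <= c ^+ 2.
  exists (1 + `|M|); first by rewrite ltr_pwDl.
  move=> k; apply: (le_trans (uM k)); apply: (le_trans (ler_norm M)).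
  by rewrite sqrrD expr1n; have := normr_ge0 M; nra.
move: cT; rewrite /compact_operator precompactE => cT.
pose f k := T (c^-1%:C%C *: u k).
have Ff : (f @ \oo) (closure (T @` [set x : V | `|x| <= 1])).
  exists 0%N => // k _; apply: subset_closure; exists (c^-1%:C%C *: u k) => //=.
  rewrite -[1]/(1%:C%C) norm_le// normsqZ sqmod_real exprVn expr1n.
  by rewrite mulrC ler_pdivrMr ?exprn_gt0// mul1r.
have [y [_ yc]] := cT (f @ \oo) _ Ff.
exists (c%:C%C *: y) => r N r0.
have s0 : 0 < Num.sqrt (r / c ^+ 2) by rewrite sqrtr_gt0 divr_gt0 ?exprn_gt0.
have [||z [[k /= Nk <-]]] := yc (f @` [set k | (N <= k)%N])
    (ball_ (@Num.norm R[i] V) y (Num.sqrt (r / c ^+ 2))%:C%C).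
- by exists N => // k Nk; exists k.
- apply/nbhs_normP; exists (Num.sqrt (r / c ^+ 2))%:C%C => //=.
  by rewrite ltcR.
rewrite /= norm_lt// sqr_sqrtr; last by rewrite divr_ge0 ?sqr_ge0// ltW.
rewrite ltr_pdivlMr ?exprn_gt0// -normsqN opprB mulrC -sqmod_real -normsqZ => h.
exists k => //; apply: le_lt_trans h; rewrite le_eqVlt; apply/orP; left.
have fE : c%:C%C *: f k = T (u k).
  by rewrite /f (linearZ_LR T) scalerA -rmorphM/= divff ?gt_eqF// scale1r.
by apply/eqP; rewrite scalerBr fE.
Qed.

End InnerProductTopology.

Section LinearSpan.
Context {K : numFieldType} {V : normedModType K}.
Implicit Types (A : set V) (a : K) (x y : V).

Lemma lin_span0 A : lin_span A 0.
Proof. by exists 0%N, (fun=> 0), (fun=> 0); split; [case|rewrite big_ord0]. Qed.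

Lemma lin_span_mem A x : A x -> lin_span A x.
Proof.
by move=> Ax; exists 1%N, (fun=> 1), (fun=> x); split; rewrite // big_ord1 scale1r.
Qed.

Lemma lin_spanP A a x y : lin_span A x -> lin_span A y -> lin_span A (a *: x + y).
Proof.
move=> [m [b [v [Av ->]]]] [m' [b' [v' [Av' ->]]]].
exists (m + m')%N, (fun i => match fintype.split i with inl j => a * b j | inr j => b' j end),
  (fun i => match fintype.split i with inl j => v j | inr j => v' j end).
split; first by move=> i; case: fintype.split.
rewrite big_split_ord/= scaler_sumr; congr (_ + _); apply: eq_bigr => i _.
  by rewrite (unsplitK (inl i)) scalerA.
by rewrite (unsplitK (inr i)).
Qed.

Lemma lin_span_ind A (P : V -> Prop) : P 0 ->
  (forall a x y, P x -> P y -> P (a *: x + y)) -> (forall x, A x -> P x) ->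
  forall x, lin_span A x -> P x.
Proof.
move=> P0 PD PA _ [m [b [v [Av ->]]]]; apply: big_ind => // [x y Px Py|i _].
  by rewrite -[x]scale1r; exact: PD.
by rewrite -[_ *: _]addr0; apply: PD => //; exact: PA.
Qed.

End LinearSpan.

(** * Root subspaces inside an invariant subspace *)

Section RootVectors.
Context {K : numFieldType} {V : normedModType K} (T : {linear V -> V}).
Variable H : V -> Prop.
Hypothesis H0 : H 0.
Hypothesis H_sub : forall a x y, H x -> H y -> H (a *: x + y).
Hypothesis H_inv : forall x, H x -> H (T x).
Implicit Types (a z mu : K) (x y r v w : V).

Local Notation shift z := (fun w : V => T w - z *: w).

Lemma shift_linear z : linear (shift z).
Proof.
move=> a x y; rewrite linearP scalerDr opprD addrACA scalerBr !scalerA.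
by rewrite [z * a]mulrC.
Qed.

Lemma shiftB z x y : shift z (x - y) = shift z x - shift z y.
Proof. by rewrite -addrC -scaleN1r shift_linear scaleN1r addrC. Qed.

Lemma iter_shift_linear z k : linear (fun w => iter k (shift z) w).
Proof. by elim: k => [//|k IH] a x y /=; rewrite IH; exact: shift_linear. Qed.

Lemma iter_shift0 z k : iter k (shift z) 0 = 0.
Proof. by elim: k => [//|k /= ->]; rewrite linear0 scaler0 subrr. Qed.

(** Unlike [root_vector] this admits 0, so that it describes a subspace. *)
Definition gen_eigen z r : Prop := H r /\ exists k, iter k (shift z) r = 0.

Lemma gen_eigenP z a x y : gen_eigen z x -> gen_eigen z y ->
  gen_eigen z (a *: x + y).
Proof.
move=> [Hx [k xk]] [Hy [l yl]]; split; first exact: H_sub.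
exists (k + l)%N; rewrite iter_shift_linear {1}addnC !iterD xk yl.
by rewrite !iter_shift0 scaler0 addr0.
Qed.

Lemma gen_eigen_inv z x : gen_eigen z x -> gen_eigen z (T x).
Proof.
move=> [Hx [k xk]]; split; first exact: H_inv.
exists k; have -> : iter k (shift z) (T x) = T (iter k (shift z) x).
  by elim: k {xk} => //= k ->; rewrite linearB (linearZ_LR T).
by rewrite xk linear0.
Qed.

Lemma gen_eigen_span z x : gen_eigen z x -> lin_span (root_vector T `&` H) x.
Proof.
move=> [Hx [k xk]]; have [->|x0] := eqVneq x 0; first exact: lin_span0.
by apply: lin_span_mem; split => //; split => //; exists z, k.
Qed.

Lemma H_shift z x : H x -> H (shift z x).
Proof.
by move=> Hx /=; rewrite addrC -scaleNr; apply: H_sub => //; exact: H_inv.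
Qed.

(** Since [T - mu] is [T - z] plus the nonzero scalar [z - mu], a solution [y] for the right-hand
    side [(T - z) x] gives [(T - mu) (x - y) = (z - mu) *: x]. This drives an induction on the
    nilpotency order. *)
Lemma gen_eigen_solve z mu x : z != mu -> gen_eigen z x ->
  exists2 y, gen_eigen z y & shift mu y = x.
Proof.
move=> zmu [Hx [k]]; elim: k x Hx => [|k IH] x Hx.
  move=> /= ->; exists 0; last by rewrite linear0 scaler0 subrr.
  by split => //; exists 0%N.
move=> xk; have := xk; rewrite iterSr => /IH[|y [Hy [l yl]] yE].
  exact: H_shift.
have zmu0 : z - mu != 0 by rewrite subr_eq0.
exists ((z - mu)^-1 *: (x - y)).
  rewrite -[_ *: _]addr0; apply: gen_eigenP; last by split => //; exists 0%N.
  rewrite addrC -scaleN1r; apply: gen_eigenP; first by split => //; exists l.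
  by split => //; exists k.+1.
have := shift_linear mu (z - mu)^-1 (x - y) 0; rewrite !addr0 linear0 scaler0 subrr.
rewrite addr0 => ->; apply: (scalerI zmu0); rewrite scalerA divff// scale1r.
by rewrite shiftB yE /= scalerBl opprB addrC addrA subrK.
Qed.

(** The components of [(T - mu) w] at eigenvalues other than [mu] are the image under [T - mu] of
    some [y] in the span, by [gen_eigen_solve]. What remains is in the root subspace at [mu], and
    therefore so is [y - w]. This recognises vectors of a triangular flag as combinations of root
    vectors without a Jordan decomposition. *)
Lemma span_root_shift mu w : H w ->
  lin_span (root_vector T `&` H) (shift mu w) ->
  lin_span (root_vector T `&` H) w.
Proof.
move=> Hw; set LS := lin_span _ => hw.
have LSH y : LS y -> H y.
  by apply: lin_span_ind => // x [].
have [y [Hy ws]] : exists y, LS y /\ gen_eigen mu (shift mu y - shift mu w).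
  move: hw; move: (shift mu w) => u; move: u; apply: lin_span_ind.
  - exists 0; split; first exact: lin_span0.
    by rewrite linear0 scaler0 subrr subr0; split => //; exists 0%N.
  - move=> a x x' [y [Hy yx]] [y' [Hy' yx']]; exists (a *: y + y'); split.
      exact: lin_spanP.
    rewrite [X in gen_eigen _ (X - _)]shift_linear opprD addrACA -scalerBr.
    exact: gen_eigenP.
  - move=> x [[_ [z [k xk]]] Hx]; have [<-|zmu] := eqVneq z mu.
      exists 0; split; first exact: lin_span0.
      rewrite linear0 scaler0 subrr -scaleN1r addrC; apply: gen_eigenP.
        by split => //; exists k.
      by split => //; exists 0%N.
    have [|y hy yE] := gen_eigen_solve zmu (x := x).
      by split => //; exists k.
    exists y; split; first exact: gen_eigen_span hy.
    by rewrite yE subrr; split => //; exists 0%N.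
have : gen_eigen mu (y - w).
  split; first by rewrite addrC -scaleN1r; apply: H_sub => //; exact: LSH.
  have [_ [k hk]] := ws; exists k.+1; rewrite iterSr -hk; congr (iter _ _ _).
  exact: shiftB.
move=> /gen_eigen_span h; rewrite -[w](subKr y) addrC -scaleN1r.
exact: lin_spanP.
Qed.

End RootVectors.

(** * Completeness and orthogonal projection onto closed subspaces *)

Definition normsq_complete {R : realType} {V : lmodType R[i]}
    (dot : V -> V -> R[i]) : Prop :=
  forall u : nat -> V,
    (forall r : R, 0 < r -> exists N, forall m n, (N <= m)%N -> (N <= n)%N ->
      complex.Re (dot (u m - u n) (u m - u n)) < r) ->
    exists l, forall r : R, 0 < r -> exists N, forall n, (N <= n)%N ->
      complex.Re (dot (u n - l) (u n - l)) < r.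

Lemma sqmodD_le {R : realType} (z w : R[i]) :
  sqmod (z + w) <= 2 * sqmod z + 2 * sqmod w.
Proof.
case: z w => a b [c d]; rewrite /sqmod /=.
by have := sqr_ge0 (a - c); have := sqr_ge0 (b - d); nra.
Qed.

Section OrthogonalProjection.
Context {R : realType} {V : normedModType R[i]} (dot : V -> V -> R[i]).
Hypothesis Hdot : inner_product dot.
Hypothesis Hnorm : norm_from dot.
Hypothesis Hcomplete : normsq_complete dot.
Implicit Types (a : R[i]) (x y z e v w h : V).
Local Notation Re := (@complex.Re R).
Local Notation normsq x := (Re (dot x x)).

Lemma closure_submod (A : set V) :
  A 0 -> (forall a x y, A x -> A y -> A (a *: x + y)) ->
  forall a x y, closure A x -> closure A y -> closure A (a *: x + y).
Proof.
move=> A0 AD a x y /(closure_normsqP Hdot Hnorm) cx.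
move=> /(closure_normsqP Hdot Hnorm) cy.
apply/(closure_normsqP Hdot Hnorm) => r r0.
have k0 : 0 < 4 * (sqmod a + 1) by rewrite mulr_gt0// ltr_wpDl ?sqmod_ge0.
have [x' Ax' xx'] := cx (r / (4 * (sqmod a + 1))) (divr_gt0 r0 k0).
have [|y' Ay' yy'] := cy (r / 4); first by rewrite divr_gt0.
exists (a *: x' + y'); first exact: AD.
have -> : a *: x + y - (a *: x' + y') = a *: (x - x') + (y - y').
  by rewrite scalerBr opprD addrACA.
apply: le_lt_trans (normsqD_le Hdot _ _) _; rewrite (normsqZ Hdot).
rewrite ltr_pdivlMr// in xx'; rewrite ltr_pdivlMr// in yy'.
have := sqmod_ge0 a; have := form_ge0 Hdot (x - x'); nra.
Qed.

(** Testing [h0 + a *: h] with the optimal [a] bounds the failure of orthogonality by the failure of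
    [h0] to be a minimiser. In this quantitative form the orthogonality passes to the limit of a
    minimising sequence. *)
Lemma minimizer_orthogonal (H : V -> Prop) (d : R) x h0 h :
  (forall a x y, H x -> H y -> H (a *: x + y)) ->
  (forall y, H y -> d <= normsq (x - y)) -> H h0 -> H h ->
  sqmod (dot (x - h0) h) <= (normsq (x - h0) - d) * normsq h.
Proof.
move=> HD dmin Hh0 Hh; have [hz|hz] := eqVneq (normsq h) 0.
  by rewrite (form_eq0 Hdot _ hz) hz mulr0 /sqmod /= expr0n addr0.
have hp : 0 < normsq h by rewrite lt_neqAle eq_sym hz (form_ge0 Hdot).
set w := x - h0; pose a := ((normsq h)^-1)%:C%C * dot w h.
have := dmin _ (HD a h h0 Hh Hh0).
have -> : x - (a *: h + h0) = w - a *: h by rewrite opprD addrCA addrC.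
rewrite (form_quad Hdot) /a -mulrA (form_conj Hdot w h) sqmodE -rmorphM/=.
rewrite sqmodM sqmod_real => hd.
rewrite -ler_pdivrMr//; set q := sqmod _ in hd *.
have E : (normsq h)^-1 ^+ 2 * q * normsq h = (normsq h)^-1 * q by field.
by rewrite E in hd; rewrite mulrC; lra.
Qed.

Lemma projection_exists (H : set V) : H 0 -> closed H ->
  (forall a x y, H x -> H y -> H (a *: x + y)) ->
  forall x, exists2 p, H p & forall h, H h -> dot (x - p) h = 0.
Proof.
move=> H0 cH HD x.
pose D := [set normsq (x - h) | h in H].
have D0 : has_inf D.
  split; first by exists (normsq (x - 0)), 0.
  by exists 0 => _ [h _ <-]; exact: (form_ge0 Hdot).
have dmin y : H y -> inf D <= normsq (x - y).
  by move=> Hy; apply: ge_inf; [case: D0|exists y].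
have hk k : exists h, H h /\ normsq (x - h) < inf D + k.+1%:R^-1.
  have [_ [h Hh <-] hlt] := inf_adherent (ltac:(by rewrite invr_gt0) : 0 < k.+1%:R^-1 :> R) D0.
  by exists h.
have /choice[u uP] := hk.
have HB y z : H y -> H z -> H (y - z).
  by rewrite addrC -scaleN1r => hy hz; exact: HD.
have inv_small (r : R) : 0 < r -> exists N, forall m, (N <= m)%N -> m.+1%:R^-1 < r.
  move=> r0; exists (Num.truncn r^-1) => m Nm.
  rewrite invf_plt ?posrE//; apply: lt_le_trans (truncnS_gt _) _.
  by rewrite ler_nat ltnS.
have [|p pP] := Hcomplete (u := u).
  move=> r r0; have [N NP] := inv_small (r / 4) (divr_gt0 r0 (ltr0n _ 4)).
  exists N => m n Nm Nn.
  have [Hm um] := uP m; have [Hn un] := uP n.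
  have := parallelogram Hdot (x - u m) (x - u n).
  have -> : x - u m - (x - u n) = - (u m - u n) by rewrite opprB addrC subrKA opprB.
  rewrite (normsqN Hdot).
  pose c : R[i] := (2^-1 : R)%:C%C.
  have -> : x - u m + (x - u n) = (2 : R)%:C%C *: (x - (c *: u m + c *: u n)).
    rewrite -scalerDr scalerBr scalerA -rmorphM/= divff// scale1r.
    by rewrite [2%:C%C]rmorph_nat scaler_nat mulr2n opprD addrACA.
  rewrite (normsqZ Hdot) sqmod_real.
  have Hc : H (c *: u m + c *: u n).
    by apply: (HD) => //; rewrite -[_ *: _]addr0; exact: HD.
  have := dmin _ Hc; have := NP m Nm; have := NP n Nn.
  move: um un; set i1 := m.+1%:R^-1; set i2 := n.+1%:R^-1.
  move: (inf D) (normsq _) (normsq _) (normsq _) (normsq _) => *; lra.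
exists p.
  move/closure_id: cH => ->; apply/(closure_normsqP Hdot Hnorm) => r r0.
  have [N NP] := pP r r0; exists (u N); first by have [] := uP N.
  by rewrite -(normsqN Hdot) opprB; exact: NP.
move=> h Hh; apply/eqP; rewrite -sqmod_eq0 eq_le sqmod_ge0 andbT.
apply/ler_addgt0Pr => r r0; rewrite add0r.
have k0 : 0 < 4 * (normsq h + 1) by rewrite mulr_gt0// ltr_wpDl ?(form_ge0 Hdot).
have rk := divr_gt0 r0 k0.
have [N1 N1P] := inv_small _ rk; have [N2 N2P] := pP _ rk.
pose m := maxn N1 N2.
have [Hm um] := uP m.
have -> : dot (x - p) h = dot (x - u m) h + dot (u m - p) h.
  by rewrite -(formDl Hdot) subrKA.
apply: le_trans (sqmodD_le _ _) _.
have h1 := minimizer_orthogonal HD dmin Hm Hh.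
have h2 := form_CS Hdot (u m - p) h.
have h3 := N1P m (leq_maxl _ _); have h4 := N2P m (leq_maxr _ _).
rewrite ltr_pdivlMr// in h3; rewrite ltr_pdivlMr// in h4.
have h5 : (normsq (x - u m) - inf D) * normsq h <= m.+1%:R^-1 * normsq h.
  by rewrite ler_wpM2r ?(form_ge0 Hdot)// lerBlDl ltW.
have := form_ge0 Hdot h; have := form_ge0 Hdot (u m - p).
have : 0 < m.+1%:R^-1 :> R by rewrite invr_gt0.
set i := _^-1 in h3 h5 *; nra.
Qed.

Lemma projection_operator (H : set V) : H 0 -> closed H ->
  (forall a x y, H x -> H y -> H (a *: x + y)) ->
  exists P : V -> V, [/\ linear P, forall x, H (P x) &
    forall x h, H h -> dot (x - P x) h = 0].
Proof.
move=> H0 cH HD.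
have /choice[P PP] : forall x, exists p, H p /\ forall h, H h -> dot (x - p) h = 0.
  by move=> x; have [p] := projection_exists H0 cH HD x; exists p.
exists P; split=> [a x y|x|x]; [|by have [] := PP x|by have [] := PP x].
have [Hx Px] := PP x; have [Hy Py] := PP y; have [Hz Pz] := PP (a *: x + y).
set z := a *: x + y in Hz Pz *; set q := a *: P x + P y.
have Hd : H (P z - q) by rewrite addrC -scaleN1r; apply: (HD) => //; apply: (HD).
apply: subr0_eq; apply: (inner_eq0 Hdot).
have -> : dot (P z - q) (P z - q) = dot (z - q) (P z - q) - dot (z - P z) (P z - q).
  by rewrite -(formBl Hdot); congr (dot _ _); rewrite opprB [RHS]addrC subrKA.
rewrite (Pz _ Hd) subr0.
have -> : z - q = a *: (x - P x) + (y - P y) by rewrite /z /q opprD addrACA scalerBr.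
by rewrite (form_linear Hdot) (Px _ Hd) (Py _ Hd) mulr0 addr0.
Qed.

End OrthogonalProjection.

(** * Traces of the imaginary part and Livsic's argument *)

Section TraceArgument.
Context {R : realType} {V : normedModType R[i]} (dot : V -> V -> R[i]).
Hypothesis Hdot : inner_product dot.
Hypothesis Hnorm : norm_from dot.
Hypothesis Hcomplete : normsq_complete dot.
Variables (T : {linear V -> V}) (s : R).
Hypothesis s1 : s ^+ 2 = 1.
Implicit Types (a : R[i]) (x y z e v w h : V) (u f : seq V).
Local Notation Re := (@complex.Re R).
Local Notation Im := (@complex.Im R).
Local Notation normsq x := (Re (dot x x)).

(** The form of [s] times the imaginary part of [T], that is of [T] minus its adjoint divided by
    $2i$, written without constructing the adjoint. *)
Definition im_form x y : R[i] :=
  ((s / 2)%:C * - 'i)%C * (dot (T x) y - dot x (T y)).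

Lemma im_formE x : Re (im_form x x) = s * Im (dot (T x) x).
Proof.
rewrite /im_form (form_conj Hdot (T x) x).
by case: (dot (T x) x) => a b /=; field.
Qed.

Lemma im_form_symmetric x y : im_form x y = 0 -> dot (T x) y = dot x (T y).
Proof.
move=> /eqP; rewrite mulf_eq0 => /orP[|]; last by rewrite subr_eq0 => /eqP.
rewrite -sqmod_eq0 sqmodM sqmod_real exprMn s1 mul1r.
by rewrite /sqmod /= oppr0 expr0n sqrrN add0r expr1n mulr1 sqrf_eq0 invr_eq0 pnatr_eq0.
Qed.

Hypothesis im_ge0 : forall x, 0 <= s * Im (dot (T x) x).

Lemma im_form_psd : psd_form im_form.
Proof.
split=> [a x y z|x y|x]; last by rewrite im_formE.
  by rewrite /im_form linearP !(form_linear Hdot); ring.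
rewrite /im_form (form_conj Hdot (T x) y) (form_conj Hdot x (T y)).
by case: (dot (T x) y) (dot x (T y)) => a b [c d]; apply/eqP;
  rewrite eq_complex /=; apply/andP; split; apply/eqP; field.
Qed.

Variable K : R.
Hypothesis T_bounded : forall x, normsq (T x) <= K * normsq x.

(** By Cauchy-Schwarz; the constant $1+|K|$ only has to dominate the square root of [K]. *)
Lemma im_form_le x : s * Im (dot (T x) x) <= (1 + `|K|) * normsq x.
Proof.
have h1 := form_CS Hdot (T x) x; have h2 := Im_le_sqmod (dot (T x) x).
have h3 := T_bounded x; have h4 := form_ge0 Hdot x.
have h5 : K <= `|K| := ler_norm K; have h6 := normr_ge0 K.
set i := Im _ in h2 *; set n := normsq x in h1 h3 h4 *.
have h7 : normsq (T x) * n <= `|K| * n ^+ 2.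
  by rewrite expr2 mulrA ler_wpM2r// (le_trans h3)// ler_wpM2r.
have h8 : (s * i) ^+ 2 <= ((1 + `|K|) * n) ^+ 2.
  rewrite !exprMn s1 mul1r (le_trans h2)// (le_trans h1)// (le_trans h7)//.
  by rewrite ler_wpM2r ?sqr_ge0//; nra.
have h9 : 0 <= (1 + `|K|) * n by rewrite mulr_ge0// addr_ge0.
by rewrite -(ger0_norm h9); apply: le_trans (ler_norm _) _; rewrite -sqrtr_sqr -[leRHS]sqrtr_sqr ler_wsqrtr.
Qed.

Hypothesis roots_dense : forall x (r : R), 0 < r ->
  exists2 y, lin_span (root_vector T) y & normsq (x - y) < r.

Lemma triangular_absorb f y : triangular dot T f -> lin_span (root_vector T) y ->
  exists f', [/\ triangular dot T f', forall x, in_span dot f x -> in_span dot f' x &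
    in_span dot f' y].
Proof.
move=> hf [m [a [v [Av ->]]]].
suff [f' [h1 h2 h3]] : exists f', [/\ triangular dot T f',
    forall x, in_span dot f x -> in_span dot f' x &
    forall i, i \in enum 'I_m -> in_span dot f' (v i)].
  exists f'; split => //; apply: big_ind => [|x z|i _].
  - exact: in_span0.
  - exact: in_spanD.
  - by apply: in_spanZ => //; apply: h3; rewrite mem_enum.
elim: (enum 'I_m) => [|i l [f' [h1 h2 h3]]]; first by exists f.
have [_ [z [k vk]]] := Av i.
have lT : linear T by move=> b x w; rewrite linearP.
have [f'' [h4 h5 h6]] := triangular_root Hdot lT h1 vk.
exists f''; split => //; first by move=> x /h2; exact: h5.
by move=> j; rewrite inE => /orP[/eqP ->//|jl]; apply: h5; exact: h3.
Qed.

(** Each vector of [u] is near a combination of root vectors, finitely many root vectors lie in one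
    finite-dimensional invariant subspace, and the projection onto it approximates at least as
    well. *)
Lemma triangular_approx u (r : R) : 0 < r ->
  exists2 f, triangular dot T f & forall x, x \in u -> normsq (x - proj dot f x) < r.
Proof.
move=> r0; suff [f [hf hu]] : exists f, triangular dot T f /\
    forall x, x \in u -> exists2 y, in_span dot f y & normsq (x - y) < r.
  exists f => // x /hu[y yf]; apply: le_lt_trans; apply: best_approximation => //.
  exact: triangular_orthonormal hf.
elim: u => [|x u [f [hf hu]]]; first by exists [::].
have [y yT xy] := roots_dense x r0.
have [f' [h1 h2 h3]] := triangular_absorb hf yT.
exists f'; split => // z; rewrite inE => /orP[/eqP ->|/hu[y' /h2 ? ?]].
  by exists y.
by exists y'.
Qed.

Variable M : R.
Hypothesis trace_bounded : forall u, orthonormal_seq dot u ->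
  \sum_(x <- u) s * Im (dot (T x) x) <= M.

(** Each [x] in [u] splits into its projection [p] and a small rest [w]. The traces of the [p] are
    controlled by [trace_compression_le], and with $S$ for [im_form] the cross terms by
    $2\operatorname{Re}S(w,p)\le\eta S(p,p)+\eta^{-1}S(w,w)$. *)
Lemma trace_approx u (r : R) : orthonormal_seq dot u -> 0 < r ->
  exists2 f, triangular dot T f &
  \sum_(x <- u) s * Im (dot (T x) x) <= \sum_(x <- f) s * Im (dot (T x) x) + r.
Proof.
move=> hu r0; have M0 : 0 <= M by have := @trace_bounded [::] I; rewrite big_nil.
(* [eta] is such that the factor [1 + eta] on a trace at most [M] costs at most [r / 2]; [c] is such
   that each rest [w] costs at most $r/(2(1+|u|))$, which sums to at most the other half. *)
pose eta := r / (2 * (M + 1)).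
have eta0 : 0 < eta by rewrite divr_gt0// mulr_gt0// ltr_wpDl.
pose c := (1 + eta^-1) * (1 + `|K|) * (1 + (size u)%:R).
have c0 : 0 < c by rewrite !mulr_gt0// ltr_pwDl// ltW// invr_gt0.
have [f hf fu] := triangular_approx u (divr_gt0 r0 (mulr_gt0 (ltr0n R 2) c0)).
exists f => //; set t := fun x => s * Im (dot (T x) x).
have of_ := triangular_orthonormal hf.
have fM : \sum_(x <- f) t x <= M := trace_bounded of_.
have tP : \sum_(x <- u) t (proj dot f x) <= \sum_(x <- f) t x.
  have := trace_compression_le Hdot of_ im_form_psd hu.
  by under eq_bigr do rewrite im_formE; under [leRHS]eq_bigr do rewrite im_formE.
have tx x : x \in u -> t x <= (1 + eta) * t (proj dot f x) + r / (2 * (1 + (size u)%:R)).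
  move=> xu; set p := proj dot f x; set w := x - p.
  have tw : t w <= (1 + `|K|) * (r / (2 * c)).
    apply: le_trans (im_form_le w) _; rewrite ler_wpM2l ?addr_ge0//.
    by apply/ltW/fu.
  (* Nonnegativity at this vector, multiplied by [eta], is the bound on the cross term. *)
  have q1 := form_ge0 im_form_psd (p - (eta^-1)%:C%C *: w).
  rewrite (form_quad im_form_psd) sqmod_real in q1.
  have q2 : t x = t p + 2 * Re (im_form w p) + t w.
    have := form_quad im_form_psd (-1) p w.
    rewrite scaleN1r opprK {1}/w addrC subrK !im_formE -/(t x) -/(t p) -/(t w) => ->.
    by rewrite mulN1r raddfN/= mulrN opprK /sqmod /= !oppr0 expr0n addr0 sqrrN expr1n mul1r.
  rewrite -(ler_pM2l eta0) in q1.
  have q3 : 0 <= eta * t p - 2 * Re (im_form w p) + eta^-1 * t w.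
    move: q1; rewrite mulr0 !im_formE -/(t p) -/(t w).
    have -> : Re ((eta^-1)%:C%C * im_form w p) = eta^-1 * Re (im_form w p).
      by case: (im_form w p) => ? ? /=; rewrite mul0r subr0.
    move=> h; apply: (le_trans h); rewrite le_eqVlt; apply/orP; left.
    by apply/eqP; field; rewrite gt_eqF.
  have q4 : (1 + eta^-1) * t w <= r / (2 * (1 + (size u)%:R)).
    have -> : r / (2 * (1 + (size u)%:R)) =
        (1 + eta^-1) * ((1 + `|K|) * (r / (2 * c))).
      rewrite /c; field.
      by rewrite (gt_eqF eta0) (addrC eta) !gt_eqF// ltr_pwDl// ltW.
    by rewrite ler_wpM2l// ltW// ltr_pwDl// ltW// invr_gt0.
  rewrite q2; move: q3 q4; rewrite !mulrDl !mul1r; lra.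
apply: (@le_trans _ _ (\sum_(x <- u) ((1 + eta) * t (proj dot f x) +
    r / (2 * (1 + (size u)%:R))))).
  by rewrite big_seq [leRHS]big_seq; exact: ler_sum.
rewrite big_split/= -mulr_sumr big_const_seq count_predT iter_addr_0.
have e1 : r / (2 * (1 + (size u)%:R)) *+ size u <= r / 2.
  have p0 : 0 <= (size u)%:R :> R by [].
  have n0 : 0 < 1 + (size u)%:R :> R by rewrite ltr_pwDl.
  rewrite -mulr_natr.
  have -> : r / (2 * (1 + (size u)%:R)) * (size u)%:R =
      r / 2 * ((size u)%:R / (1 + (size u)%:R)) by field; rewrite gt_eqF.
  apply: ler_piMr; first by rewrite divr_ge0// ltW.
  by rewrite ler_pdivrMr// mul1r lerDr.
have e2 : (1 + eta) * \sum_(x <- u) t (proj dot f x) <= \sum_(x <- f) t x + r / 2.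
  apply: (@le_trans _ _ ((1 + eta) * \sum_(x <- f) t x)).
    by rewrite ler_wpM2l// addr_ge0// ltW.
  rewrite mulrDl mul1r lerD2l; apply: (@le_trans _ _ (eta * M)).
    by rewrite ler_wpM2l// ltW.
  have -> : r / 2 = eta * (M + 1) by rewrite /eta; field; rewrite gt_eqF// ltr_wpDl.
  by rewrite ler_wpM2l ?lerDl// ltW.
lra.
Qed.

Variable H : set V.
Hypothesis H_inv : closed_invariant_subspace T H.

Let HD a x y : H x -> H y -> H (a *: x + y).
Proof. by have [_ h _ _] := H_inv; exact: h. Qed.

(** Along the flag: with [mu] the diagonal entry at [e], the vector [T e - mu *: e] is a combination
    of the tail, whose members are already in the span, so [span_root_shift] applies. *)
Lemma triangular_roots f : triangular dot T f -> (forall x, x \in f -> H x) ->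
  forall x, x \in f -> lin_span (root_vector T `&` H) x.
Proof.
have [H0 _ _ HT] := H_inv.
elim: f => //= e f IH [ee fe Te hf] fH x; rewrite inE => /orP[/eqP ->|]; last first.
  by apply: IH => // y yf; apply: fH; rewrite inE yf orbT.
apply: (@span_root_shift _ _ T H H0 HD HT (dot (T e) e)).
  by apply: fH; rewrite mem_head.
rewrite -[T e in X in lin_span _ (X - _)]Te proj_cons addrAC subrr add0r /proj.
rewrite big_seq; apply: big_ind => [|y z hy hz|y yf].
- exact: lin_span0.
- by rewrite -[y]scale1r; exact: lin_spanP.
- rewrite -[_ *: _]addr0; apply: lin_spanP; last exact: lin_span0.
  by apply: IH => // z zf; apply: fH; rewrite inE zf orbT.
Qed.

Lemma dot_span0 (A : set V) v : (forall x, A x -> dot v x = 0) ->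
  forall x, lin_span A x -> dot v x = 0.
Proof.
move=> vA; apply: lin_span_ind => //; first exact: form0r Hdot _.
by move=> a x y vx vy; rewrite (formDr Hdot) (formZr Hdot) vx vy mulr0 addr0.
Qed.

Lemma orthonormal_cat f g : orthonormal_seq dot f -> orthonormal_seq dot g ->
  (forall x y, x \in f -> y \in g -> dot x y = 0) -> orthonormal_seq dot (f ++ g).
Proof.
elim: f => //= e f IH [h1 h2 h3] og fg; split => //.
  move=> x; rewrite mem_cat => /orP[/h2//|xg]; apply: (dot_conj0 Hdot).
  by apply: fg => //; rewrite mem_head.
by apply: IH => // x y xf; apply: fg; rewrite inE xf orbT.
Qed.

(** Every triangular sequence can be traded for one whose trace is larger by
    almost [t v], which contradicts the bound on traces unless [t v = 0]. *)
Lemma im_form_vanishes v : H v -> dot v v = 1 ->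
  (forall x, root_vector T x -> H x -> dot v x = 0) -> s * Im (dot (T v) v) = 0.
Proof.
move=> Hv vv vE; apply/eqP; rewrite eq_le im_ge0 andbT leNgt; apply/negP => tv.
have [H0 _ cH HT] := H_inv.
set t := fun x => s * Im (dot (T x) x); rewrite -/(t v) in tv.
have lT : linear T by move=> b x w; rewrite linearP.
have [P [lP HP PC]] := projection_operator Hdot Hnorm Hcomplete H0 cH HD.
suff grow k : exists2 f, triangular dot T f & k%:R * (t v / 2) <= \sum_(x <- f) t x.
  have [f hf] := grow (Num.bound `|M / (t v / 2)|).
  apply/negP; rewrite -ltNge; apply: le_lt_trans (trace_bounded _) _.
    exact: triangular_orthonormal hf.
  have tv2 : 0 < t v / 2 by rewrite divr_gt0.
  rewrite -ltr_pdivrMr//; apply: le_lt_trans (ler_norm _) _.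
  exact: archi_boundP.
elim: k => [|k [f hf kf]].
  by exists [::] => //; rewrite mul0r big_nil.
have [a [g [ha aH hg gH sum]]] := triangular_split Hdot lT lP HP PC HD HT hf.
have aE := triangular_roots ha aH.
have oa := triangular_orthonormal ha; have og := triangular_orthonormal hg.
(* [v] is orthogonal to [a], whose members are combinations of root vectors in [H], and to [g],
   which is orthogonal to all of [H]. *)
have ou : orthonormal_seq dot (v :: (a ++ g)).
  split => //; last first.
    by apply: orthonormal_cat => // x y xa yg; apply: (dot_conj0 Hdot);
      apply: (gH _ _ yg); exact: aH.
  move=> x; rewrite mem_cat => /orP[xa|xg]; last exact: gH.
  apply: (dot_conj0 Hdot); apply: dot_span0 (aE _ xa) => y [].
  exact: vE.
(* Going back to a triangular sequence costs at most half of the gain [t v], so every round still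
   adds [t v / 2]. *)
have [f' hf' ff'] := trace_approx ou (divr_gt0 tv (ltr0n R 2)).
exists f' => //; move: ff'; rewrite big_cons big_cat/= -/(t v).
have -> : \sum_(x <- a) t x + \sum_(x <- g) t x = \sum_(x <- f) t x.
  by rewrite /t -!mulr_sumr -mulrDr -!Im_sum -ImD sum.
have -> : k.+1%:R * (t v / 2) = k%:R * (t v / 2) + t v / 2.
  by rewrite -natr1 mulrDl mul1r.
rewrite -/t; lra.
Qed.

End TraceArgument.

(** * Compact symmetric operators and the abstract synthesis theorem *)

Section SpectralSynthesis.
Context {R : realType} {V : normedModType R[i]} (dot : V -> V -> R[i]).
Hypothesis Hdot : inner_product dot.
Hypothesis Hnorm : norm_from dot.
Implicit Types (a : R[i]) (x y z e v w h : V).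
Local Notation Re := (@complex.Re R).
Local Notation Im := (@complex.Im R).
Local Notation normsq x := (Re (dot x x)).

Lemma normsq_gt0 x : x != 0 -> 0 < normsq x.
Proof.
move=> x0; rewrite lt_neqAle (form_ge0 Hdot) andbT eq_sym.
by apply: contra_neq x0; exact: (inner_eq0 Hdot).
Qed.

Lemma dot_approx0 y w : (forall r : R, 0 < r ->
  exists2 x, dot x w = 0 & normsq (y - x) < r) -> dot y w = 0.
Proof.
move=> h; apply/eqP; rewrite -sqmod_eq0 eq_le sqmod_ge0 andbT.
apply/ler_addgt0Pr => r r0; rewrite add0r.
have k0 : 0 < normsq w + 1 by rewrite ltr_wpDl ?(form_ge0 Hdot).
have [x xw yx] := h _ (divr_gt0 r0 k0).
have -> : dot y w = dot (y - x) w by rewrite (formBl Hdot) xw subr0.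
apply: le_trans (form_CS Hdot _ _) _; rewrite ltr_pdivlMr// in yx.
have := form_ge0 Hdot (y - x); nra.
Qed.

Lemma normsq_approx0 y : (forall r : R, 0 < r -> normsq y < r) -> y = 0.
Proof.
move=> h; apply: (inner_eq0 Hdot); apply/eqP; rewrite eq_le (form_ge0 Hdot) andbT.
by apply/ler_addgt0Pr => r r0; rewrite add0r ltW// h.
Qed.

(** Let [m] be the supremum of $\|Tx\|^2$ over unit vectors of [N]. If [m] is 0, [T] vanishes on
    [N]. Otherwise $T^2u_k-mu_k$ tends to 0 along a maximising sequence, and a cluster point [y] of
    the $Tu_k$ satisfies $T^2y=my$. With [l] the square root of [m], either [T y + l *: y] is an
    eigenvector at [l], or it is 0 and [y] is an eigenvector at [- l]. *)
Lemma symmetric_compact_eigenvector (T : {linear V -> V}) (N : V -> Prop) :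
  continuous (T : V -> V) -> compact_operator T ->
  (forall a x y, N x -> N y -> N (a *: x + y)) ->
  (forall y, (forall r : R, 0 < r -> exists2 x, N x & normsq (y - x) < r) -> N y) ->
  (forall x, N x -> N (T x)) ->
  (forall x y, N x -> N y -> dot (T x) y = dot x (T y)) ->
  forall v, N v -> v != 0 -> exists w, [/\ N w, w != 0 & exists mu, T w = mu *: w].
Proof.
move=> /(continuous_normsqP Hdot Hnorm)[K K0 TK] cT ND Ncl NT Tsym v Nv v0.
have N0 : N 0 by rewrite -(addNr v) -scaleN1r; exact: ND.
have NZ a x : N x -> N (a *: x) by move=> Nx; rewrite -[_ *: _]addr0; exact: ND.
have NB x y : N x -> N y -> N (x - y).
  by move=> Nx Ny; rewrite addrC -scaleN1r; exact: ND.
pose D := [set normsq (T x) | x in [set x | N x /\ normsq x = 1]].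
have vp := normsq_gt0 v0.
have [c c0 cv] := normalizable Hdot v0.
have D_sup : has_sup D.
  split; first by exists (normsq (T (c *: v))), (c *: v) => //; split; [exact: NZ|rewrite cv].
  by exists K => _ [x [_ x1] <-]; apply: le_trans (TK x) _; rewrite x1 mulr1.
pose m := sup D.
have Dm x : N x -> normsq (T x) <= m * normsq x.
  move=> Nx; have [->|x0] := eqVneq x 0.
    by rewrite linear0 (form0l Hdot) mulr0.
  have [d d0 dx] := normalizable Hdot x0.
  have : normsq (T (d *: x)) <= m.
    apply: ub_le_sup; first by case: D_sup.
    by exists (d *: x) => //; split; [exact: NZ|rewrite dx].
  have nx : sqmod d * normsq x = 1 by rewrite -(normsqZ Hdot) dx.
  rewrite linearZ_LR (normsqZ Hdot) => h.
  have d2 : 0 < sqmod d by rewrite lt_neqAle sqmod_ge0 andbT eq_sym sqmod_eq0.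
  by rewrite -(ler_pM2l d2) mulrCA nx mulr1.
have m0 : 0 <= m.
  have := Dm _ (NZ c v Nv); rewrite cv mulr1; apply: le_trans; exact: (form_ge0 Hdot).
have [m_eq0|m_neq0] := eqVneq m 0.
  exists v; split => //; exists 0; rewrite scale0r; apply: (inner_eq0 Hdot).
  apply/eqP; rewrite eq_le (form_ge0 Hdot) andbT.
  by have := Dm v Nv; rewrite m_eq0 mul0r.
have {}m0 : 0 < m by rewrite lt_neqAle eq_sym m_neq0.
have /choice[u uP] k : exists x, [/\ N x, normsq x = 1 & m - k.+1%:R^-1 < normsq (T x)].
  have [_ [x [Nx x1] <-] h] := sup_adherent (ltac:(by rewrite invr_gt0) : 0 < k.+1%:R^-1 :> R) D_sup.
  by exists x.
have [|y yP] := compact_operator_cluster Hdot Hnorm (u := u) (M := 1) cT.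
  by move=> k; have [_ ->] := uP k.
have Ny : N y.
  apply: Ncl => r r0; have [k _ hk] := yP r 0%N r0.
  exists (T (u k)); first by apply: NT; have [] := uP k.
  by rewrite -(normsqN Hdot) opprB.
have near_y (r : R) : 0 < r -> exists k, [/\ k.+1%:R^-1 < r & normsq (T (u k) - y) < r].
  move=> r0; have [k Nk hk] := yP r (Num.truncn r^-1) r0; exists k; split => //.
  rewrite invf_plt ?posrE//; apply: lt_le_trans (truncnS_gt _) _.
  by rewrite ler_nat ltnS.
have y0 : y != 0.
  apply/eqP => y0; have [k [h1 h2]] := near_y (m / 2) (divr_gt0 m0 (ltr0n R 2)).
  have [_ _] := uP k; rewrite y0 subr0 in h2; apply/negP; rewrite -leNgt.
  move: h1; set i : R := k.+1%:R^-1 => h1; lra.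
(* Symmetry of [T] and $\|T^2u\|^2\le m\|Tu\|^2$ bound the expanded square by $m(m-\|Tu\|^2)$. *)
have TTu k : normsq (T (T (u k)) - m%:C%C *: u k) <= m * k.+1%:R^-1.
  have [Nu u1 uk] := uP k; rewrite (form_quad Hdot) sqmod_real u1 mulr1.
  have -> : Re (m%:C%C * dot (u k) (T (T (u k)))) = m * normsq (T (u k)).
    by rewrite -(Tsym _ _ Nu (NT _ Nu)) (form_real Hdot) -rmorphM.
  have h := Dm _ (NT _ Nu).
  have : m * (m - normsq (T (u k))) <= m * k.+1%:R^-1.
    by rewrite ler_pM2l// lerBlDl -lerBlDr ltW.
  apply: le_trans; move: h; nra.
have TTy : T (T y) = m%:C%C *: y.
  apply: subr0_eq; apply: normsq_approx0 => r r0.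
  (* The error will be at most $4(K^2+m^2)d+2Kmi$, where [d] and [i] are both below [r / q]. *)
  pose q := 8 * (K ^+ 2 + m ^+ 2 + K * m).
  have q0 : 0 < q.
    by rewrite mulr_gt0// addr_gt0 ?mulr_gt0// addr_gt0 ?exprn_gt0.
  have [k [h1 h2]] := near_y _ (divr_gt0 r0 q0).
  have -> : T (T y) - m%:C%C *: y = (T (T (y - T (u k))) + m%:C%C *: (T (u k) - y)) +
      T (T (T (u k)) - m%:C%C *: u k).
    have -> : T (T (y - T (u k))) = T (T y) - T (T (T (u k))).
      by rewrite (linearB T) (linearB T).
    by rewrite scalerBr (linearB T) (linearZ_LR T) addrAC !subrKA.
  apply: le_lt_trans (normsqD_le Hdot _ _) _.
  have e1 := normsqD_le Hdot (T (T (y - T (u k)))) (m%:C%C *: (T (u k) - y)).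
  have e2 := TK (T (T (u k)) - m%:C%C *: u k).
  have e3 := TTu k.
  have e4 := TK (T (y - T (u k))); have e5 := TK (y - T (u k)).
  rewrite (normsqZ Hdot) sqmod_real in e1.
  rewrite -(normsqN Hdot (y - _)) opprB in e5.
  rewrite ltr_pdivlMr// in h1; rewrite ltr_pdivlMr// in h2.
  set d := normsq (T (u k) - y) in e1 e5 h2.
  have d0 : 0 <= d := form_ge0 Hdot _.
  have i0 : 0 < k.+1%:R^-1 :> R by rewrite invr_gt0.
  set i := _^-1 in e3 h1 i0.
  have e6 : normsq (T (T (y - T (u k)))) <= K ^+ 2 * d.
    by rewrite (le_trans e4)// expr2 -mulrA ler_pM2l.
  have e7 : normsq (T (T (T (u k)) - m%:C%C *: u k)) <= K * m * i.
    by rewrite (le_trans e2)// -mulrA ler_pM2l.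
  rewrite /q in h1 h2.
  have k2 : 0 < K ^+ 2 by rewrite exprn_gt0.
  have m2 : 0 < m ^+ 2 by rewrite exprn_gt0.
  have km : 0 < K * m by rewrite mulr_gt0.
  have e8 : 0 <= (K * m) * d by rewrite mulr_ge0// ltW.
  have e9 : 0 <= (K ^+ 2 + m ^+ 2) * i by rewrite mulr_ge0 ?addr_ge0// ltW.
  move: e1 e6 e7 h1 h2 e8 e9; rewrite !mulrDr !mulrDl; lra.
pose l : R := Num.sqrt m; pose w := T y + l%:C%C *: y.
have ll : l%:C%C * l%:C%C = m%:C%C by rewrite -rmorphM/= -expr2 sqr_sqrtr ?ltW.
have [w0|w0] := eqVneq w 0.
  exists y; split => //; exists (- l%:C%C).
  by move/eqP: w0; rewrite addr_eq0 scaleNr => /eqP.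
exists w; split => //; first by rewrite /w addrC; apply: ND => //; exact: NT.
exists l%:C%C; rewrite /w linearD/= (linearZ_LR T) TTy -ll -scalerA scalerDr.
by rewrite addrC.
Qed.

Theorem dissipative_spectral_synthesis (T : {linear V -> V}) (s M : R) :
  normsq_complete dot -> continuous (T : V -> V) -> compact_complete T ->
  s ^+ 2 = 1 -> (forall x, 0 <= s * Im (dot (T x) x)) ->
  (forall u, orthonormal_seq dot u -> \sum_(x <- u) s * Im (dot (T x) x) <= M) ->
  spectral_synthesis T.
Proof.
move=> Hc cT [kT rT] s1 t0 tM; split => // H iH.
have [H0 HD cH HT] := iH.
have [K K0 TK] := (continuous_normsqP Hdot Hnorm T).1 cT.
have dense x (r : R) : 0 < r -> exists2 y, lin_span (root_vector T) y & normsq (x - y) < r.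
  by have := rT x I; rewrite setIT => /(closure_normsqP Hdot Hnorm); exact.
have van := im_form_vanishes Hdot Hnorm Hc s1 t0 TK dense tM iH.
pose N v := H v /\ forall x, root_vector T x -> H x -> dot v x = 0.
have ND a x y : N x -> N y -> N (a *: x + y).
  move=> [Hx xE] [Hy yE]; split; first exact: HD.
  by move=> z hz Hz; rewrite (form_linear Hdot) xE// yE// mulr0 addr0.
(* Where a nonnegative form vanishes on the diagonal, the vector is in its kernel. Symmetry
   therefore holds against every [y], and taking root vectors for [y] shows that [N] is
   invariant. *)
have NS v : N v -> forall y, dot (T v) y = dot v (T y).
  move=> Nv y; have [->|v0] := eqVneq v 0.
    by rewrite linear0 !(form0l Hdot).
  have [c c0 cv] := normalizable Hdot v0.
  have Ncv : N (c *: v).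
    rewrite -[_ *: _]addr0; apply: ND => //; split => //.
    by move=> x _ _; rewrite (form0l Hdot).
  have := van _ Ncv.1 cv Ncv.2; rewrite -(im_formE Hdot).
  move=> /(form_eq0 (im_form_psd Hdot t0) y) h.
  have := form_conj (im_form_psd Hdot t0) y (c *: v); rewrite h conjc0.
  move=> /(im_form_symmetric s1); rewrite (linearZ_LR T) !(formZl Hdot).
  exact: mulfI.
have NT v : N v -> N (T v).
  move=> /[dup] /NS Sv [Hv vE]; split; first exact: HT.
  move=> x [x0 [z [k xk]]] Hx; rewrite Sv.
  have [->|Tx0] := eqVneq (T x) 0; first exact: (form0r Hdot).
  apply: vE; last exact: HT.
  split => //; exists z; have [] := @gen_eigen_inv _ _ T H HT z x.
    by split => //; exists k.
  by [].
have Ncl y : (forall r : R, 0 < r -> exists2 x, N x & normsq (y - x) < r) -> N y.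
  move=> h; split.
    move/closure_id: cH => ->; apply/(closure_normsqP Hdot Hnorm) => r /h[x [Hx _]].
    by exists x.
  move=> w rw Hw; apply: dot_approx0 => r /h[x [_ xE] ?]; exists x => //; exact: xE.
have N_eq0 v : N v -> v = 0.
  move=> Nv; apply/eqP/negPn/negP => v0.
  have [w [[Hw wE] w0 [mu Tw]]] := symmetric_compact_eigenvector cT kT ND Ncl NT
    (fun x y Nx _ => NS x Nx y) Nv v0.
  (* An eigenvector in [N] is a root vector in [H], hence orthogonal to itself. *)
  have rw : root_vector T w.
    by split => //; exists mu, 1%N; rewrite /= Tw subrr.
  by move/eqP: w0; apply; apply: (inner_eq0 Hdot); rewrite wE.
set LS := lin_span (root_vector T `&` H).
have clS := closure_submod Hdot Hnorm (lin_span0 _) (@lin_spanP _ _ (root_vector T `&` H)).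
have cl0 : closure LS 0 by apply: subset_closure; exact: lin_span0.
have LSH : closure LS `<=` H.
  move/closure_id: cH => ->; apply: closureS => x.
  by apply: lin_span_ind => // ? [].
move=> x Hx.
have [p pE px] := projection_exists Hdot Hnorm Hc cl0 (@closed_closure _ LS) clS x.
have -> : x = p; last by [].
apply: subr0_eq; apply: N_eq0; split.
  by rewrite addrC -scaleN1r; apply: HD => //; exact: LSH.
move=> y ry Hy; apply: px; apply: subset_closure; exact: lin_span_mem.
Qed.

End SpectralSynthesis.

(** * The Fredholm alternative and existence of the resolvent *)

Section Fredholm.
Context {R : realType} {V : normedModType R[i]} (dot : V -> V -> R[i]).
Hypothesis Hdot : inner_product dot.
Hypothesis Hnorm : norm_from dot.
Implicit Types (a z : R[i]) (x y v w h : V).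
Local Notation Re := (@complex.Re R).
Local Notation normsq x := (Re (dot x x)).

Section OneMinusCompact.
Variables (T : {linear V -> V}) (c : R[i]).
Hypothesis cT : continuous (T : V -> V).
Hypothesis kT : compact_operator T.
Hypothesis inj : forall x, x - c *: T x = 0 -> x = 0.
Let A x := x - c *: T x.

Let lA : linear A.
Proof.
move=> a x y; rewrite /A linearP scalerDr opprD addrACA scalerBr !scalerA.
by rewrite [c * a]mulrC.
Qed.

Let AB x y : A (x - y) = A x - A y.
Proof. by rewrite addrC -scaleN1r lA scaleN1r addrC. Qed.

Let A_bounded : exists2 K : R, 0 < K & forall x, normsq (A x) <= K * normsq x.
Proof.
have [K K0 TK] := (continuous_normsqP Hdot Hnorm T).1 cT.
exists (2 + 2 * (sqmod c * K)) => [|x].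
  by rewrite ltr_wpDr// mulr_ge0// mulr_ge0 ?sqmod_ge0// ltW.
have := normsqD_le Hdot x (- (c *: T x)).
rewrite (normsqN Hdot) (normsqZ Hdot); move/le_trans; apply.
by have := TK x; have := sqmod_ge0 c; nra.
Qed.

(** If [T (u k)] clusters at [w] and [A (u k)] is close to [x], then [u k]
    clusters at [x + c *: w], whose image is [x]. *)
Let cluster_solution (u : nat -> V) (M : R) x :
  (forall k, normsq (u k) <= M) ->
  (forall k, normsq (A (u k) - x) < k.+1%:R^-1) ->
  exists2 y, A y = x & forall r : R, 0 < r -> exists k, normsq (u k - y) < r.
Proof.
move=> uM ux; have [w wP] := compact_operator_cluster Hdot Hnorm kT uM.
have close (r : R) : 0 < r ->
    exists2 k, normsq (A (u k) - x) < r & normsq (u k - (x + c *: w)) < r.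
  move=> r0; have q0 : 0 < 2 * (1 + sqmod c).
    by rewrite mulr_gt0// ltr_pwDl// sqmod_ge0.
  have rq := divr_gt0 r0 q0.
  have [k Nk hk] := wP _ (Num.truncn (r / (2 * (1 + sqmod c)))^-1) rq.
  have hk' : normsq (A (u k) - x) < r / (2 * (1 + sqmod c)).
    apply: lt_trans (ux k) _; rewrite invf_plt ?posrE//.
    by apply: lt_le_trans (truncnS_gt _) _; rewrite ler_nat ltnS.
  rewrite ltr_pdivlMr// in hk; rewrite ltr_pdivlMr// in hk'.
  have n1 := form_ge0 Hdot (A (u k) - x); have n2 := form_ge0 Hdot (T (u k) - w).
  have c0 := sqmod_ge0 c.
  exists k; first by apply: le_lt_trans hk'; nra.
  have -> : u k - (x + c *: w) = (A (u k) - x) + c *: (T (u k) - w).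
    by rewrite /A scalerBr opprD addrA [u k - _ - x]addrAC subrKA.
  apply: le_lt_trans (normsqD_le Hdot _ _) _; rewrite (normsqZ Hdot); nra.
have [K K0 AK] := A_bounded.
exists (x + c *: w); last by move=> r r0; have [k _ h] := close r r0; exists k.
apply: subr0_eq; apply: (normsq_approx0 Hdot) => r r0.
have q0 : 0 < 2 * (1 + K) by rewrite mulr_gt0// ltr_pwDl// ltW.
have [k h1 h2] := close _ (divr_gt0 r0 q0).
have -> : A (x + c *: w) - x = (A (u k) - x) - A (u k - (x + c *: w)).
  by rewrite [A (u k - _)]AB opprB [RHS]addrC subrKA.
apply: le_lt_trans (normsqD_le Hdot _ _) _; rewrite (normsqN Hdot).
have h3 := AK (u k - (x + c *: w)).
rewrite ltr_pdivlMr// in h1; rewrite ltr_pdivlMr// in h2.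
have n1 := form_ge0 Hdot (A (u k) - x).
have n2 := form_ge0 Hdot (u k - (x + c *: w)); nra.
Qed.

(** Otherwise unit vectors whose images under [A] tend to 0 would cluster at a vector of the kernel,
    which injectivity makes 0, against their norm being 1. *)
Let bounded_below : exists2 K : R, 0 < K & forall x, normsq x <= K * normsq (A x).
Proof.
apply: contrapT => h.
have hk k : exists x, normsq x = 1 /\ normsq (A x - 0) < k.+1%:R^-1.
  have [x kx] : exists x, k.+1%:R * normsq (A x) < normsq x.
    apply: contrapT => h'; apply: h; exists k.+1%:R => // x.
    by rewrite leNgt; apply/negP => ?; apply: h'; exists x.
  have x0 : x != 0.
    apply: contraTneq kx => ->; rewrite (form0l Hdot) ltNge mulr_ge0//.
    exact: (form_ge0 Hdot).
  have [d d0 dx] := normalizable Hdot x0.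
  exists (d *: x); rewrite dx subr0; split => //.
  have -> : A (d *: x) = d *: A x by rewrite /A (linearZ_LR T) scalerBr !scalerA mulrC.
  have nx : sqmod d * normsq x = 1 by rewrite -(normsqZ Hdot) dx.
  have d2 : 0 < sqmod d by rewrite lt_neqAle sqmod_ge0 andbT eq_sym sqmod_eq0.
  by rewrite (normsqZ Hdot) -[ltRHS]mulr1 ltr_pdivlMl// mulrCA -[ltRHS]nx ltr_pM2l.
have [u uP] := choice hk.
have [|y Ay yP] := @cluster_solution u 1 0 _ (fun k => (uP k).2).
  by move=> k; rewrite (uP k).1.
have y0 := inj Ay.
have [k] := yP 1 ltr01; rewrite y0 subr0 (uP k).1 ltxx.
by [].
Qed.

(** For nonzero [c], [A] is [- c] times [T - c^-1], which maps every root subspace at another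
    eigenvalue onto itself, while injectivity excludes root vectors at [c^-1]. So the range contains
    all root vectors. A preimage of an arbitrary [x] is a cluster point of approximate preimages,
    which [bounded_below] keeps bounded. *)
Lemma fredholm_alternative : root_complete_in T setT ->
  exists S : V -> V, [/\ linear S, forall x, A (S x) = x &
    exists2 K : R, 0 < K & forall x, normsq (S x) <= K * normsq x].
Proof.
move=> rT; have [K K0 AK] := bounded_below.
have A_root r : root_vector T r -> exists y, A y = r.
  move=> [r0 [z [k rk]]].
  have [c0|c0] := eqVneq c 0.
    by exists r; rewrite /A c0 scale0r subr0.
  have zc : z != c^-1.
    apply: contra_neq r0 => zc; subst z.
    elim: k rk => [//|k IH]; set w := iter k _ r in IH * => /= Tw.
    apply: IH; apply: inj; apply: (scalerI (invr_neq0 c0)).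
    rewrite scaler0 scalerBr scalerA mulVf// scale1r -opprB.
    by apply/eqP; rewrite oppr_eq0; apply/eqP.
  have gr : gen_eigen T (fun=> True) z r by split => //; exists k.
  have [y _ yE] := gen_eigen_solve I (fun _ _ _ _ _ => I) (fun _ _ => I) zc gr.
  exists (- (c^-1 *: y)).
  have -> : A (- (c^-1 *: y)) = T y - c^-1 *: y.
    by rewrite /A linearN scalerN opprK (linearZ_LR T) scalerA mulfV// scale1r addrC.
  exact: yE.
have A_span y : lin_span (root_vector T) y -> exists x, A x = y.
  apply: (@lin_span_ind _ _ _ (fun y => exists x, A x = y)) => [|a y1 y2 [x1 <-] [x2 <-]|//].
    by exists 0; rewrite /A linear0 scaler0 subrr.
  by exists (a *: x1 + x2); exact: lA.
have surj x : exists y, A y = x.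
  have hk k : exists y, normsq (A y - x) < k.+1%:R^-1.
    have := rT x I; rewrite setIT => /(closure_normsqP Hdot Hnorm).
    move=> /(_ k.+1%:R^-1)[|_ /A_span[y <-] h]; first by rewrite invr_gt0.
    by exists y; rewrite -(normsqN Hdot) opprB.
  have [u uP] := choice hk.
  (* [A (u k)] differs from [x] by squared norm at most 1, so its own squared norm is at most
     [2 + 2 * normsq x]. *)
  have [|y Ay _] := @cluster_solution u (K * (2 + 2 * normsq x)) x _ uP; last by exists y.
  move=> k; apply: (le_trans (AK _)); rewrite ler_pM2l//.
  have := normsqD_le Hdot (A (u k) - x) x; rewrite subrK; move/le_trans; apply.
  rewrite lerD2r -[leRHS]mulr1 ler_pM2l//; apply: le_trans (ltW (uP k)) _.
  by rewrite invf_le1// ler1n.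
have [S SP] := choice surj.
exists S; split => //; last by exists K => // x; apply: le_trans (AK _) _; rewrite SP.
move=> a x y; apply: subr0_eq; apply: inj; rewrite -/(A _) AB lA !SP.
exact: subrr.
Qed.

End OneMinusCompact.

(** With [T0] the resolvent at [z0] and [c = z - z0], the equation $(L-z)f=g$ reads
    [f - c *: T0 f = T0 g]. The resolvent at [z] is thus $(1-cT_0)^{-1}T_0$, and the hypothesis on
    [z] is the injectivity of $1-cT_0$. *)
Lemma resolvent_exists (L : set (V * V)) z : complete_operator L ->
  (forall f, L (f, z *: f) -> f = 0) -> exists T, resolvent_at L z T.
Proof.
move=> [_ [z0 [T0 /[dup] rT0 [cT0 LT0]]] cL] inj.
have [kT0 rT] := cL _ _ rT0; pose c := z - z0.
have injA x : x - c *: T0 x = 0 -> x = 0.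
  move=> /subr0_eq xE; apply: inj.
  have -> : z *: x = c *: x + z0 *: x by rewrite -scalerDl subrK.
  by apply/LT0; rewrite (linearZ_LR T0).
have [S [lS SA [K K0 SK]]] := fredholm_alternative cT0 kT0 injA rT.
have lT : linear (S \o T0) by move=> a x y; rewrite /= linearP lS.
pose T : {linear V -> V} := HB.pack (S \o T0) (GRing.isLinear.Build _ _ _ _ _ lT).
exists T; split.
  have [K1 K10 T0K] := (continuous_normsqP Hdot Hnorm T0).1 cT0.
  apply/(continuous_normsqP Hdot Hnorm); exists (K * K1); first exact: mulr_gt0.
  by move=> x; apply: (le_trans (SK _)); rewrite -mulrA ler_pM2l.
move=> f g.
have -> : L (f, g + z *: f) <-> T0 (g + c *: f) = f.
  rewrite LT0 -addrA -scalerDl subrK; exact: iff_refl.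
rewrite linearD (linearZ_LR T0) /=; split=> [<-|h].
  by rewrite -{1}(SA (T0 g)) subrK.
apply: subr0_eq; apply: injA; rewrite linearB scalerBr opprD addrACA -opprD SA.
have -> : f - c *: T0 f = T0 g by rewrite -{1}h addrK.
exact: subrr.
Qed.

End Fredholm.

(** * The Hilbert space [L2] *)

Section ComplexIntegral.
Context {R : realType}.
Local Notation mu := (@lebesgue_measure R).
Local Notation Re := (@complex.Re R).
Local Notation Im := (@complex.Im R).
Local Notation rint f := (mu.-integrable unit_itv (EFin \o f)).
Local Notation cint f := (cintegral unit_itv f).
Implicit Types f g : R -> R[i].

Let mI := @measurable_unit_itv R.

Lemma cintegrableP (a : R[i]) f g : cintegrable f -> cintegrable g ->
  cintegrable (fun x => a * f x + g x).
Proof.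
move=> [fr fi] [gr gi]; split.
  have := rintD (rintD (rintZ (Re a) fr) (rintZ (- Im a) fi)) gr.
  congr (mu.-integrable _ _); apply/funext => x /=; congr (_%:E).
  by case: a (f x) (g x) => ? ? [? ?] [? ?] /=; ring.
have := rintD (rintD (rintZ (Re a) fi) (rintZ (Im a) fr)) gi.
congr (mu.-integrable _ _); apply/funext => x /=; congr (_%:E).
by case: a (f x) (g x) => ? ? [? ?] [? ?] /=; ring.
Qed.

Lemma cintegralP_on (D : set (measurableTypeR R)) (a : R[i]) f g : measurable D ->
  mu.-integrable D (EFin \o (fun x => Re (f x))) ->
  mu.-integrable D (EFin \o (fun x => Im (f x))) ->
  mu.-integrable D (EFin \o (fun x => Re (g x))) ->
  mu.-integrable D (EFin \o (fun x => Im (g x))) ->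
  cintegral D (fun x => a * f x + g x) = a * cintegral D f + cintegral D g.
Proof.
move=> mD fr fi gr gi.
have iD (h1 h2 : R -> R) : mu.-integrable D (EFin \o h1) ->
    mu.-integrable D (EFin \o h2) -> mu.-integrable D (EFin \o (fun x => h1 x + h2 x)).
  by move=> i1 i2; have := integrableD mD i1 i2; exact.
have iZ (c : R) (h1 : R -> R) : mu.-integrable D (EFin \o h1) ->
    mu.-integrable D (EFin \o (fun x => c * h1 x)).
  by move=> i1; have := integrableZl mD c i1; exact.
have RD h1 h2 := @RintegralD _ _ _ mu D h1 h2 mD.
have RZ h c := @RintegralZl _ _ _ mu D h c mD.
have E1 : Rintegral mu D (fun x => Re (a * f x + g x)) =
    Rintegral mu D (fun x => Re a * Re (f x) + (- Im a) * Im (f x) + Re (g x)).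
  apply: eq_Rintegral => x _.
  by case: a (f x) (g x) => ? ? [? ?] [? ?] /=; ring.
have E2 : Rintegral mu D (fun x => Im (a * f x + g x)) =
    Rintegral mu D (fun x => Re a * Im (f x) + Im a * Re (f x) + Im (g x)).
  clear E1; apply: eq_Rintegral => x _.
  by case: a (f x) (g x) => ? ? [? ?] [? ?] /=; ring.
rewrite /cintegral E1 E2.
rewrite RD ?RD ?RZ//; try exact: iZ; try exact: (iD _ _ (iZ _ _ _) (iZ _ _ _)).
by case: a E1 E2 => ? ? _ _; apply/eqP; rewrite eq_complex /=; apply/andP; split;
  apply/eqP; ring.
Qed.

Lemma cintegralP (a : R[i]) f g : cintegrable f -> cintegrable g ->
  cint (fun x => a * f x + g x) = a * cint f + cint g.
Proof. by move=> [? ?] [? ?]; exact: cintegralP_on. Qed.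

Lemma cintegral_conj f : cintegrable f ->
  cint (fun x => conjc (f x)) = conjc (cint f).
Proof.
move=> [fr fi]; rewrite /cintegral /=; congr Complex.
  by apply: eq_Rintegral => x _; case: (f x).
rewrite -mulN1r -RintegralZl//; apply: eq_Rintegral => x _.
by case: (f x) => ? ? /=; rewrite mulN1r.
Qed.

Lemma Rintegral_ae_eq (D : set (measurableTypeR R)) (u v : R -> R) :
  measurable D -> measurable_fun D u -> measurable_fun D v ->
  ae_eq mu D u v -> Rintegral mu D u = Rintegral mu D v.
Proof.
move=> mD mu_ mv uv; rewrite /Rintegral; congr fine; apply: ae_eq_integral => //.
- exact/measurable_EFinP.
- exact/measurable_EFinP.
- by apply: filterS uv => x h /h /= ->.
Qed.

Lemma rint_measurable (u : R -> R) : rint u -> measurable_fun unit_itv u.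
Proof. by move=> /integrableP[/measurable_EFinP]. Qed.

Lemma cintegral_ae_eq f g : cintegrable f -> cintegrable g ->
  ae_eq mu unit_itv f g -> cint f = cint g.
Proof.
move=> [fr fi] [gr gi] fg; rewrite /cintegral; congr Complex;
  apply: Rintegral_ae_eq => //; try exact: rint_measurable;
  by apply: filterS fg => x h /h ->.
Qed.

End ComplexIntegral.

Section L2InnerProduct.
Context {R : realType} {n : nat}.
Local Notation mu := (@lebesgue_measure R).
Local Notation Re := (@complex.Re R).
Local Notation Im := (@complex.Im R).
Local Notation H := (L2 R n).

Lemma cdotP (a : R[i]) (x y z : 'cV[R[i]]_n) :
  cdot (a *: x + y) z = a * cdot x z + cdot y z.
Proof.
rewrite /cdot mulr_sumr -big_split/=; apply: eq_bigr => k _.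
by rewrite !mxE mulrDl mulrA.
Qed.

Lemma cdot_conj (x y : 'cV[R[i]]_n) : cdot y x = conjc (cdot x y).
Proof.
rewrite /cdot rmorph_sum; apply: eq_bigr => k _.
by rewrite /= rmorphM/= conjcK mulrC.
Qed.

Lemma cdot_integrable (f g : L2fun R n) : cintegrable (fun x => cdot (f x) (g x)).
Proof.
split.
  have h k : true -> mu.-integrable unit_itv (EFin \o (fun x =>
    (Re (f x k ord0) * Re (g x k ord0) + Im (f x k ord0) * Im (g x k ord0)))).
    move=> _; have [fr fi] := L2funP f k; have [gr gi] := L2funP g k.
    exact: rintD (L2real_mul fr gr) (L2real_mul fi gi).
  have := integrable_sum (@measurable_unit_itv R) (index_enum 'I_n) h.
  by congr (mu.-integrable _ _); apply/funext => x /=; rewrite cdotE sumEFin.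
have h k : true -> mu.-integrable unit_itv (EFin \o (fun x =>
  (Im (f x k ord0) * Re (g x k ord0) + (-1) * (Re (f x k ord0) * Im (g x k ord0))))).
  move=> _; have [fr fi] := L2funP f k; have [gr gi] := L2funP g k.
  exact: rintD (L2real_mul fi gr) (rintZ _ (L2real_mul fr gi)).
have := integrable_sum (@measurable_unit_itv R) (index_enum 'I_n) h.
congr (mu.-integrable _ _); apply/funext => x /=; rewrite sumEFin; congr (_%:E).
rewrite /cdot Im_sum; apply: eq_bigr => k _.
by case: (f x k ord0) (g x k ord0) => ? ? [? ?] /=; ring.
Qed.

Lemma L2dot_integrable (u v : H) : cintegrable (fun x => cdot (u x) (v x)).
Proof. exact: cdot_integrable. Qed.

Lemma L2dot_psd : psd_form (@L2dot R n).
Proof.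
split=> [a x y z|x y|x].
- rewrite /L2dot -cintegralP; [|exact: L2dot_integrable..].
  apply: cintegral_ae_eq; [exact: L2dot_integrable| |].
    by apply: cintegrableP; exact: L2dot_integrable.
  apply: filterS2 (L2D_ae (a *: x) y) (L2Z_ae a x) => t h1 h2 tI.
  by rewrite -cdotP h1// h2.
- rewrite /L2dot -cintegral_conj; last exact: L2dot_integrable.
  by congr cintegral; apply/funext => t; exact: cdot_conj.
- apply: Rintegral_ge0 => t _; rewrite cdotE.
  by apply: sumr_ge0 => k _; rewrite -!expr2 addr_ge0 ?sqr_ge0.
Qed.

Lemma L2_inner_product : inner_product (@L2dot R n).
Proof.
split=> [|x x0]; first exact: L2dot_psd.
by apply: L2_normr0_eq0; rewrite /L2norm x0 sqrtr0.
Qed.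

Lemma L2_norm_from : norm_from (@L2dot R n).
Proof. by []. Qed.

End L2InnerProduct.

(** * Completeness of the space of square integrable functions *)

Section L2Complete.
Context {R : realType}.
Local Notation mu := (@lebesgue_measure R).
Local Notation Re := (@complex.Re R).
Local Notation Im := (@complex.Im R).
Local Notation rint f := (mu.-integrable unit_itv (EFin \o f)).
Local Notation sqint f := (Rintegral mu unit_itv (fun x : R => f x ^+ 2)).

Let mI := @measurable_unit_itv R.

Lemma rint_fine (u : R -> R) : rint u ->
  (\int[mu]_(x in unit_itv) (u x)%:E)%E = (Rintegral mu unit_itv u)%:E.
Proof. by move=> iu; rewrite /Rintegral fineK//; exact: integrable_fin_num. Qed.

Lemma mu_unit_itv : mu unit_itv = 1%E.
Proof. by rewrite /unit_itv lebesgue_measure_itv/= lte_fin ltr01 oppr0 adde0. Qed.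

Lemma rint_cst (c : R) : rint (fun=> c).
Proof.
apply: measurable_bounded_integrable => //.
- have h : (mu unit_itv < +oo)%E by rewrite mu_unit_itv; exact: ltry.
  exact: h.
- by exists `|c|; split; [exact: num_real|move=> M cM x _; exact: ltW].
Qed.

Lemma Rintegral_cst1 (c : R) : Rintegral mu unit_itv (fun=> c) = c.
Proof.
have h := @Rintegral_cst _ _ _ mu unit_itv mI c.
rewrite h (_ : fine (mu unit_itv) = 1) ?mulr1//.
by have := mu_unit_itv; rewrite /= => ->.
Qed.

Lemma rint_norm (u : R -> R) : rint u -> rint (fun x => `|u x|).
Proof. by move=> iu; have := integrable_abse iu. Qed.

Lemma L2real_rint (u : R -> R) : L2real u -> rint u.
Proof.
move=> hu; have h1 : L2real (fun=> 1 : R).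
  by split; [exact: measurable_cst|have := rint_cst (1 ^+ 2)].
by have := L2real_mul hu h1; congr (mu.-integrable _ _); apply/funext => x /=;
  rewrite mulr1.
Qed.

(** From $(|u|-a)^2\ge0$ one has $|u|\le u^2/(2a)+a/2$ pointwise, integrated over an interval of
    length 1. *)
Lemma Rintegral_norm_le (u : R -> R) (a : R) : L2real u -> 0 < a ->
  sqint u <= a ^+ 2 -> Rintegral mu unit_itv (fun x => `|u x|) <= a.
Proof.
move=> hu a0 ua.
apply: (@le_trans _ _ (Rintegral mu unit_itv (fun x => (2 * a)^-1 * u x ^+ 2 + a / 2))).
  apply: le_Rintegral => //.
  - exact/rint_norm/L2real_rint.
  - by apply: rintD; [apply: rintZ; case: hu|exact: rint_cst].
  move=> x _; have := sqr_ge0 (`|u x| - a); rewrite -(real_normK (num_real (u x))).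
  move=> h; rewrite -subr_ge0.
  have -> : (2 * a)^-1 * `|u x| ^+ 2 + a / 2 - `|u x| = (2 * a)^-1 * (`|u x| - a) ^+ 2.
    by field; rewrite gt_eqF.
  by rewrite mulr_ge0// invr_ge0 mulr_ge0// ltW.
have [_ iu] := hu.
rewrite (@RintegralD _ _ _ mu unit_itv)//; [|exact: rintZ|exact: rint_cst].
rewrite Rintegral_cst1 (@RintegralZl _ _ _ mu unit_itv)//.
have : (2 * a)^-1 * sqint u <= (2 * a)^-1 * a ^+ 2.
  by rewrite ler_pM2l// invr_gt0 mulr_gt0.
have -> : (2 * a)^-1 * a ^+ 2 = a / 2 by field; rewrite gt_eqF.
lra.
Qed.

(** The integrals of the absolute increments are dominated by a geometric series, so their sum is
    finite almost everywhere; there the telescoping series converges absolutely. *)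
Lemma subsequence_ae_cvg (v : nat -> R -> R) :
  (forall k, L2real (v k)) ->
  (forall k, sqint (v k.+1 \- v k) <= (1 / (2 ^ (k + 1))%:R) ^+ 2) ->
  {ae mu, forall x, unit_itv x -> cvgn (v^~ x)}.
Proof.
move=> hv vk; pose w k := v k.+1 \- v k.
have hw k : L2real (w k) by exact: L2realB.
have mw k : measurable_fun unit_itv (fun x => `|w k x|%:E).
  by apply/measurable_EFinP; apply: rint_measurable; exact/rint_norm/L2real_rint.
pose g x : \bar R := (\sum_(k <oo) `|w k x|%:E)%E.
have g0 x : (0 <= g x)%E by apply: nneseries_ge0 => k _ _.
have mg : measurable_fun unit_itv g.
  by apply: ge0_emeasurable_sum => // k x _ _; rewrite lee_fin.
have gi : mu.-integrable unit_itv g.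
  apply/integrableP; split => //.
  under eq_integral do rewrite gee0_abs//.
  rewrite integral_nneseries//.
  apply: (@le_lt_trans _ _ (\sum_(k <oo) (1 / (2 ^ (k + 1))%:R)%:E)%E).
    apply: lee_nneseries => [k _ _|k _].
      by apply: integral_ge0 => x _; rewrite lee_fin.
    rewrite (@rint_fine (fun x => `|w k x|)); last exact/rint_norm/L2real_rint.
    rewrite lee_fin; apply: Rintegral_norm_le => //.
    exact: vk.
  have := @cvg_geometric_eseries_half R 1 0 => /cvg_lim.
  by move=> h; rewrite /eseries in h; rewrite h// ltry.
apply: filterS (integrable_ae mI gi) => x gx xI.
have {}gx := gx xI.
have : cvgn (series (fun k => w k x)).
  apply: normed_cvg; apply: nondecreasing_is_cvgn.
    by apply: nondecreasing_series => k _ _ /=; exact: normr_ge0.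
  exists (fine (g x)) => _ [k _ <-]; rewrite -lee_fin fineK//.
  rewrite /series/= -sumEFin; apply: nneseries_lim_ge => i _ _.
  by rewrite lee_fin.
have -> : series (fun k => w k x) = (fun k => v k x - v 0%N x).
  apply/funext => k; rewrite /series/= (telescope_sumr (fun k => v k x))//.
move=> h; have -> : v^~ x = (fun k => v 0%N x + (v k x - v 0%N x)).
  by apply/funext => k; rewrite addrC subrK.
exact: (is_cvgD (is_cvg_cst _) h).
Qed.

(** Fatou's lemma for the squares of [u \- v k]. With [u] a late term of a Cauchy sequence it yields
    both square integrability of the limit and convergence to it. *)
Lemma L2real_fatou (v : nat -> R -> R) (u l : R -> R) (c : R) N :
  L2real u -> (forall k, L2real (v k)) -> measurable_fun unit_itv l ->
  {ae mu, forall x, unit_itv x -> v^~ x @ \oo --> l x} ->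
  (forall k, (N <= k)%N -> sqint (u \- v k) <= c) ->
  L2real (u \- l) /\ sqint (u \- l) <= c.
Proof.
move=> hu hv ml vl uc.
have mul : measurable_fun unit_itv (u \- l) by apply: measurable_funB => //; case: hu.
pose F k x : \bar R := ((u x - v k x) ^+ 2)%:E.
have mF k : measurable_fun unit_itv (F k).
  apply/measurable_EFinP; apply: measurable_funX; apply: measurable_funB.
    by case: hu.
  by case: (hv k).
have F0 k x : unit_itv x -> (0 <= F k x)%E by rewrite lee_fin sqr_ge0.
have := fatou mu mI mF F0.
have -> : (\int[mu]_(x in unit_itv) limn_einf (F^~ x) =
    \int[mu]_(x in unit_itv) ((u x - l x) ^+ 2)%:E)%E.
  apply: ae_eq_integral => //.
  - rewrite /limn_einf; apply: measurableT_comp => //.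
    apply: (@measurable_fun_limn_esup _ _ _ _ (fun k x => - F k x)%E) => k.
    exact: measurableT_comp.
  - by apply/measurable_EFinP; apply: measurable_funX.
  apply: (@filterS _ _ (ae_filter_ringOfSetsType mu) _ _ _ vl) => x h xI.
  have {}h := h xI.
  have : F^~ x @ \oo --> ((u x - l x) ^+ 2)%:E.
    apply: cvg_EFin; first exact: nearW.
    rewrite /F /comp/=.
    by apply: cvgM; apply: cvgB => //; exact: cvg_cst.
  by move=> /cvg_limn_einf_sup[].
have : (limn_einf (fun k => \int[mu]_(x in unit_itv) F k x) <= c%:E)%E.
  rewrite limn_einf_lim; apply: lime_le; first exact: is_cvg_einfs.
  (* The index [maxn k N] lies in the [k]-th tail and also beyond [N], where the bound [c] holds. *)
  apply: nearW => k; apply: ge_ereal_inf; exists (\int[mu]_(x in unit_itv) F (maxn k N) x)%E.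
    by exists (maxn k N) => //=; exact: leq_maxl.
  have /L2realB hB := hu; have [_ iB] := hB _ (hv (maxn k N)).
  rewrite (@rint_fine (fun x => (u x - v (maxn k N) x) ^+ 2))// lee_fin.
  by apply: uc; exact: leq_maxr.
move=> h1 h2; have {h1 h2}h := le_trans h2 h1.
have iul : rint (fun x => (u x - l x) ^+ 2).
  apply/integrableP; split; first by apply/measurable_EFinP; apply: measurable_funX.
  apply: le_lt_trans (ltry c); apply: le_trans h; rewrite le_eqVlt; apply/orP; left.
  by apply/eqP; apply: eq_integral => x _ /=; rewrite ger0_norm ?sqr_ge0.
by split; [split|rewrite -lee_fin -rint_fine].
Qed.

Lemma L2real_complete (u : nat -> R -> R) : (forall k, L2real (u k)) ->
  (forall r : R, 0 < r -> exists N, forall m n, (N <= m)%N -> (N <= n)%N ->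
    sqint (u m \- u n) < r) ->
  exists2 l, L2real l & forall r : R, 0 < r -> exists N, forall n, (N <= n)%N ->
    sqint (u n \- l) < r.
Proof.
move=> hu cu.
have a0 k : 0 < (1 / (2 ^ (k + 1))%:R) ^+ 2 :> R.
  by rewrite exprn_gt0// divr_gt0// ltr0n expn_gt0.
have /choice[f fP] k := cu _ (a0 k).
(* Running maxima are nondecreasing, so [q k] and [q k.+1] both reach [f k]; adding [k] makes the
   indices unbounded, as the tail estimate requires. *)
pose p k := (\max_(i < k.+1) f i)%N.
have fp k : (f k <= p k)%N by exact: (leq_bigmax (ord_max : 'I_k.+1)).
have pS k : (p k <= p k.+1)%N.
  by rewrite /p [leqRHS]big_ord_recr/= leq_maxl.
pose q k := (p k + k)%N; pose v k := u (q k).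
have qf k : (f k <= q k)%N by rewrite (leq_trans (fp k))// leq_addr.
have qfS k : (f k <= q k.+1)%N.
  by rewrite (leq_trans (fp k))// (leq_trans (pS k))// leq_addr.
have hv k : L2real (v k) by exact: hu.
have vS k : sqint (v k.+1 \- v k) <= (1 / (2 ^ (k + 1))%:R) ^+ 2.
  by apply/ltW/fP.
have vcvg := subsequence_ae_cvg hv vS.
(* The upper limit is defined everywhere and measurable, and agrees with the limit wherever the
   latter exists. *)
pose l x : R := fine (limn_esup (fun k => (v k x)%:E)).
have ml : measurable_fun unit_itv l.
  apply: measurableT_comp => //; apply: measurable_fun_limn_esup => k.
  by apply/measurable_EFinP; case: (hv k).
have vl : {ae mu, forall x, unit_itv x -> v^~ x @ \oo --> l x}.
  apply: (@filterS _ _ (ae_filter_ringOfSetsType mu) _ _ _ vcvg) => x h /h /cvg_ex[y vy].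
  have : (fun k => (v k x)%:E) @ \oo --> y%:E.
    by apply: cvg_EFin => //; exact: nearW.
  by rewrite /l => /cvg_limn_einf_sup[_ ->] /=.
have tail (r : R) : 0 < r -> exists N, forall n, (N <= n)%N ->
    L2real (u n \- l) /\ sqint (u n \- l) <= r.
  move=> r0; have [N NP] := cu _ r0; exists N => n Nn.
  apply: (@L2real_fatou v (u n) l r N) => // k Nk; apply/ltW/NP => //.
  by rewrite (leq_trans Nk)// leq_addl.
have [N /(_ N (leqnn _))[hNl _]] := tail 1 ltr01.
exists l.
  have := L2realB (hu N) hNl; congr (L2real _); apply/funext => x /=.
  by rewrite opprB addrC subrK.
move=> r r0; have [N' N'P] := tail (r / 2) (divr_gt0 r0 (ltr0n R 2)).
by exists N' => n /N'P[_ h]; apply: le_lt_trans h _; lra.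
Qed.

End L2Complete.

Section L2SpaceComplete.
Context {R : realType} {n : nat}.
Local Notation mu := (@lebesgue_measure R).
Local Notation Re := (@complex.Re R).
Local Notation Im := (@complex.Im R).
Local Notation sqint f := (Rintegral mu unit_itv (fun x : R => f x ^+ 2)).
Local Notation H := (L2 R n).
Implicit Types u v : H.

Let mI := @measurable_unit_itv R.

Lemma L2B_ae u v :
  ae_eq mu unit_itv ((u - v : H) : R -> 'cV[R[i]]_n) (fun x => u x - v x).
Proof.
rewrite -scaleN1r; apply: filterS2 (L2D_ae u (-1 *: v)) (L2Z_ae (-1) v).
by move=> x h1 h2 xI; rewrite h1// h2// scaleN1r.
Qed.

Lemma L2P_ae (a : R[i]) u v :
  ae_eq mu unit_itv ((a *: u + v : H) : R -> 'cV[R[i]]_n) (fun x => a *: u x + v x).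
Proof.
apply: filterS2 (L2D_ae (a *: u) v) (L2Z_ae a u) => x h1 h2 xI.
by rewrite h1// h2.
Qed.

(** The representative [g] is free because the chosen representative of a difference in [L2] agrees
    with the pointwise difference only almost everywhere. *)
Lemma L2_normsqE u (g : R -> 'cV[R[i]]_n) :
  (forall k, L2real (fun x => Re (g x k ord0)) /\ L2real (fun x => Im (g x k ord0))) ->
  ae_eq mu unit_itv (u : R -> 'cV[R[i]]_n) g ->
  Re (L2dot u u) = \sum_k (sqint (fun x => Re (g x k ord0)) +
                           sqint (fun x => Im (g x k ord0))).
Proof.
move=> hg ug.
have -> : Re (L2dot u u) = Rintegral mu unit_itv (fun x => \sum_k
    (Re (g x k ord0) ^+ 2 + Im (g x k ord0) ^+ 2)).
  apply: Rintegral_ae_eq => //.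
  - by have [/rint_measurable] := L2dot_integrable u u.
  - apply: measurable_sum => k; apply: measurable_funD; apply: measurable_funX.
      by have [[]] := hg k.
    by have [_ []] := hg k.
  apply: filterS ug => x h xI; rewrite cdotE; apply: eq_bigr => k _.
  by rewrite h.
rewrite /Rintegral; under eq_integral do rewrite -sumEFin.
rewrite integral_sum//; last first.
  by move=> k; have [[_ h1] [_ h2]] := hg k; exact: rintD.
rewrite (eq_bigr (fun k => (sqint (fun x => Re (g x k ord0)) +
    sqint (fun x => Im (g x k ord0)))%:E)); first by rewrite sumEFin.
move=> k _; have [[_ h1] [_ h2]] := hg k.
rewrite -(RintegralD _ h1 h2)//.
by rewrite (rint_fine (rintD h1 h2)).
Qed.

Lemma L2_complete : normsq_complete (@L2dot R n).
Proof.
move=> u0; pose u : nat -> H := u0; rewrite -/u => cu.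
have comp (i : 'I_n) : exists l : (R -> R) * (R -> R), [/\ L2real l.1, L2real l.2,
    forall r : R, 0 < r -> exists N, forall k, (N <= k)%N ->
      sqint (fun x => Re (u k x i ord0) - l.1 x) < r &
    forall r : R, 0 < r -> exists N, forall k, (N <= k)%N ->
      sqint (fun x => Im (u k x i ord0) - l.2 x) < r].
  have cauchy (r : R) : 0 < r -> exists N, forall m k, (N <= m)%N -> (N <= k)%N ->
      sqint (fun x => Re (u m x i ord0) - Re (u k x i ord0)) +
      sqint (fun x => Im (u m x i ord0) - Im (u k x i ord0)) < r.
    move=> /cu[N NP]; exists N => m k Nm Nk; apply: le_lt_trans (NP m k Nm Nk).
    rewrite (@L2_normsqE _ (fun x => u m x - u k x)); last first.
    - exact: L2B_ae.
    - move=> j; have [a1 a2] := L2funP (repr (u m)) j; have [b1 b2] := L2funP (repr (u k)) j.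
      split; [move: (L2realB a1 b1)|move: (L2realB a2 b2)];
        by congr L2real; apply/funext => x /=; rewrite !mxE;
           case: (L2_to_fun _ _ _ _) (L2_to_fun _ _ _ _) => ? ? [].
    have E (f : R[i] -> R) : {morph f : x y / x - y} -> forall j,
        sqint (fun x => f ((u m x - u k x) j ord0)) =
        sqint (fun x => f (u m x j ord0) - f (u k x j ord0)).
      by move=> fB j; apply: eq_Rintegral => x _; rewrite !mxE fB.
    rewrite (bigD1 i)//= !E; try by move=> [? ?] [].
    rewrite lerDl; apply: sumr_ge0 => j _.
    by rewrite addr_ge0// Rintegral_ge0// => x _; rewrite sqr_ge0.
  have [|r r0|l1 hl1 l1P] := @L2real_complete R (fun k x => Re (u k x i ord0)).
  - by move=> k; have [] := L2funP (repr (u k)) i.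
  - have [N NP] := cauchy r r0; exists N => m k Nm Nk.
    apply: le_lt_trans (NP m k Nm Nk); rewrite lerDl Rintegral_ge0// => x _.
    exact: sqr_ge0.
  have [|r r0|l2 hl2 l2P] := @L2real_complete R (fun k x => Im (u k x i ord0)).
  - by move=> k; have [] := L2funP (repr (u k)) i.
  - have [N NP] := cauchy r r0; exists N => m k Nm Nk.
    apply: le_lt_trans (NP m k Nm Nk); rewrite lerDr Rintegral_ge0// => x _.
    exact: sqr_ge0.
  by exists (l1, l2).
have [l lP] := choice comp.
pose g (x : R) : 'cV[R[i]]_n := \col_i Complex ((l i).1 x) ((l i).2 x).
have hg : g \in @L2pred R n.
  rewrite inE => i; have [h1 h2 _ _] := lP i.
  by split; [move: h1|move: h2]; congr L2real; apply/funext => x; rewrite mxE.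
pose G : L2fun R n := MkL2fun hg.
exists (\pi_H G) => r r0.
(* Each of the [n] components contributes at most [2 * r']; the added 1 makes the total strictly
   smaller than [r] and covers [n = 0]. *)
pose r' := r / (2 * (n%:R + 1)).
have r'0 : 0 < r' by rewrite divr_gt0// mulr_gt0// ltr_wpDl.
have hN (i : 'I_n) : exists N, forall k, (N <= k)%N ->
    sqint (fun x => Re (u k x i ord0) - (l i).1 x) +
    sqint (fun x => Im (u k x i ord0) - (l i).2 x) <= 2 * r'.
  have [_ _ h1 h2] := lP i.
  have [N1 P1] := h1 _ r'0; have [N2 P2] := h2 _ r'0.
  exists (maxn N1 N2) => k; rewrite geq_max => /andP[/P1 k1 /P2 k2].
  by rewrite mulr_natl mulr2n lerD// ltW.
have [N NP] := choice hN.
exists (\max_i N i)%N => k Nk.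
rewrite (@L2_normsqE _ (fun x => u k x - g x)); last first.
- apply: filterS2 (L2B_ae (u k) (\pi_H G)) (L2_pi_ae G) => x h1 h2 xI.
  by rewrite h1// h2.
- move=> j; have [a1 a2] := L2funP (repr (u k)) j; have [b1 b2] := L2funP G j.
  split; [move: (L2realB a1 b1)|move: (L2realB a2 b2)];
    by congr L2real; apply/funext => x /=; rewrite !mxE;
      case: (L2_to_fun _ _ _ _) => ? ?.
apply: (@le_lt_trans _ _ (\sum_(i < n) 2 * r')).
  apply: ler_sum => i _; apply: le_trans (NP i k _); last first.
    by apply: leq_trans Nk; exact: leq_bigmax.
  rewrite le_eqVlt; apply/orP; left; apply/eqP.
  by congr (_ + _); apply: eq_Rintegral => x _; rewrite !mxE;
      case: (L2_to_fun _ _ _ _) => ? ?.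
rewrite sumr_const card_ord -[ltLHS]mulr_natr.
have n1 : 0 < n%:R + 1 :> R by rewrite ltr_wpDl.
have -> : 2 * r' * n%:R = n%:R / (n%:R + 1) * r.
  by rewrite /r'; field; rewrite gt_eqF.
by rewrite -[ltRHS]mul1r ltr_pM2r// ltr_pdivrMr// mul1r ltrDl.
Qed.

End L2SpaceComplete.

(** * Integration by parts for primitives of integrable functions *)

Section Primitive.
Context {R : realType}.
Local Notation mu := (@lebesgue_measure R).
Local Notation rint f := (mu.-integrable unit_itv (EFin \o f)).
Local Notation prim h x := (Rintegral mu `[0, x]%classic h).

Let mI := @measurable_unit_itv R.

Lemma rint_sub_itv (h : R -> R) (a b : itv_bound R) : rint h ->
  (BLeft 0 <= a)%O -> (b <= BRight 1)%O ->
  mu.-integrable [set` Interval a b] (EFin \o h).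
Proof.
move=> hi a0 b1; apply: (integrableS mI) hi; first exact: measurable_itv.
by apply: subset_itv.
Qed.

Section Symmetrization.
Variable h : R -> R.
Hypothesis hi : rint h.
Let g : measurableTypeR R -> R := h \_ unit_itv.
Let f (p : measurableTypeR R * measurableTypeR R) : \bar R := (g p.1 * (if p.2 <= p.1 then g p.2 else 0))%:E.

Let mg : measurable_fun [set: measurableTypeR R] g.
Proof.
exact: (measurable_restrictT h mI).1 (rint_measurable hi).
Qed.

Let ig : mu.-integrable setT (EFin \o g).
Proof.
by have := (@integrable_mkcond _ _ R mu unit_itv (EFin \o h) mI).1 hi; rewrite restrict_EFin.
Qed.

Let mf : measurable_fun [set: measurableTypeR R * measurableTypeR R] f.
Proof.
apply/measurable_EFinP; apply: measurable_funM.
  exact: (measurableT_comp mg measurable_fst).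
apply: measurable_fun_ifT => //.
  by apply: measurable_fun_ler; [exact: measurable_snd|exact: measurable_fst].
exact: (measurableT_comp mg measurable_snd).
Qed.

Let f_integrable : (mu \x mu)%E.-integrable setT f.
Proof.
apply/(@integrable12ltyP _ _ _ _ R mu mu f mf).
have [_ gfin] := integrableP _ _ _ ig.
have := integrable_norm ig => /= ign.
pose c := Rintegral mu setT (fun x => `|g x|).
have cE : (\int[mu]_y `|(g y)%:E| = c%:E)%E.
  rewrite /c /Rintegral fineK//; exact: (integrable_fin_num measurableT ign).
have mag : measurable_fun [set: measurableTypeR R] (fun y => `|(g y)%:E|%E).
  by apply: measurableT_comp => //; exact/measurable_EFinP.
apply: (@le_lt_trans _ _ (\int[mu]_x (`|(g x)%:E| * c%:E))%E).
  apply: ge0_le_integral => //.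
  - by move=> x _; exact: integral_ge0.
  - apply: (@measurable_fun_fubini_tonelli_F _ _ _ _ R mu (abse \o f)).
      exact: measurableT_comp.
    by move=> p; exact: abse_ge0.
  - have h1 : measurable_fun [set: measurableTypeR R] (fun x => (`|g x| * c)%:E).
      apply/measurable_EFinP; apply: measurable_funM => //; exact: measurableT_comp.
    exact: h1.
  - move=> x _; rewrite -cE -ge0_integralZl//.
    have h1 : measurable_fun [set: measurableTypeR R] (fun y => (`|g x| * `|g y|)%:E).
      apply/measurable_EFinP; apply: measurable_funM => //; exact: measurableT_comp.
    have h2 : measurable_fun [set: measurableTypeR R]
        (fun y => (`|g x * (if y <= x then g y else 0)|)%:E).
      apply/measurable_EFinP; apply: measurableT_comp => //.
      apply: measurable_funM => //; apply: measurable_fun_ifT => //.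
      exact: measurable_fun_ler.
    apply: ge0_le_integral => // y _; rewrite /f/= -EFinM lee_fin normrM ler_wpM2l//.
    by case: ifP => // _; rewrite normr0.
rewrite ge0_integralZr//; last by rewrite lee_fin Rintegral_ge0.
by rewrite cE -EFinM ltry.
Qed.

Let int_restrict (a b : itv_bound R) : (BLeft 0 <= a)%O -> (b <= BRight 1)%O ->
  (\int[mu]_t ((h \_ [set` Interval a b]) t)%:E =
    (Rintegral mu [set` Interval a b] h)%:E)%E.
Proof.
move=> a0 b1; rewrite /Rintegral fineK; last first.
  have mJ : measurable ([set` Interval a b] : set (measurableTypeR R)).
    exact: measurable_itv.
  exact: (integrable_fin_num mJ (rint_sub_itv hi a0 b1)).
by rewrite [RHS]integral_mkcond restrict_EFin.
Qed.

Let int_restrictZ (c : R) (a b : itv_bound R) :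
  (BLeft 0 <= a)%O -> (b <= BRight 1)%O ->
  (\int[mu]_t (c * (h \_ [set` Interval a b]) t)%:E =
    (c * Rintegral mu [set` Interval a b] h)%:E)%E.
Proof.
move=> a0 b1; under eq_integral do rewrite EFinM.
rewrite integralZl//; first by rewrite int_restrict.
have mJ : measurable ([set` Interval a b] : set (measurableTypeR R)).
  exact: measurable_itv.
have := (@integrable_mkcond _ _ R mu _ (EFin \o h) mJ).1 (rint_sub_itv hi a0 b1).
by rewrite restrict_EFin.
Qed.

Let inner1 x : (\int[mu]_t f (x, t) =
  (((fun x => h x * Rintegral mu `[0%R, x] h) \_ unit_itv) x)%:E)%E.
Proof.
rewrite /f /=; have [xI|xI] := boolP (x \in unit_itv); last first.
  rewrite patchE (negPf xI); under eq_integral do rewrite /g patchE (negPf xI) mul0r.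
  exact: integral0.
have := xI; rewrite inE /unit_itv/= in_itv/= => /andP[x0 x1].
rewrite !patchE xI -int_restrictZ ?bnd_simp//; apply: eq_integral => t _.
rewrite /g patchE xI !patchE; congr (_ * _)%:E.
rewrite !mem_setE !in_itv/=; case: (leP t x) => tx; last by rewrite andbF.
by rewrite (le_trans tx x1) !andbT.
Qed.

Let inner2 t : (\int[mu]_x f (x, t) =
  (((fun t => h t * Rintegral mu `[t, 1%R] h) \_ unit_itv) t)%:E)%E.
Proof.
rewrite /f /=; have [tI|tI] := boolP (t \in unit_itv); last first.
  rewrite patchE (negPf tI).
  under eq_integral do rewrite {2}/g patchE (negPf tI) if_same mulr0.
  exact: integral0.
have := tI; rewrite inE /unit_itv/= in_itv/= => /andP[t0 t1].
rewrite !patchE tI -int_restrictZ ?bnd_simp//; apply: eq_integral => x _.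
rewrite /g [in X in _ * X]patchE tI !patchE mulrC.
rewrite !mem_setE !in_itv/=; case: (leP t x) => tx; last by rewrite mul0r mulr0.
by rewrite (le_trans t0 tx).
Qed.

Let G : R -> R := fun x => h x * prim h x.

Let iG : rint G.
Proof.
apply/(@integrable_mkcond _ _ R mu _ (EFin \o G) mI).
rewrite restrict_EFin; have := integrable_fubini_F f_integrable.
by congr (mu.-integrable _ _); apply/funext => x; exact: inner1.
Qed.

(** Let $P$ be the primitive of [h]. Fubini for $h(x)h(t)$ on the triangle $t\le x$ of the unit
    square turns the integral of $hP$ into that of $h(t)(P(1)-P(t))$, so twice the integral is
    $P(1)^2$. Almost everywhere differentiation of $P^2$ is avoided. *)
Lemma integral_mul_primitive : rint (fun x => h x * prim h x) /\
  Rintegral mu unit_itv (fun x => h x * prim h x) = (prim h 1) ^+ 2 / 2.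
Proof.
split; first exact: iG.
have : Rintegral mu unit_itv G =
    Rintegral mu unit_itv (fun t => h t * Rintegral mu `[t, 1] h).
  have L : (\int[mu]_x \int[mu]_t f (x, t) = \int[mu]_x ((G \_ unit_itv) x)%:E)%E.
    by apply: eq_integral => x _; exact: inner1.
  have L' : (\int[mu]_t \int[mu]_x f (x, t) =
      \int[mu]_t (((fun t => h t * Rintegral mu `[t, 1%R] h) \_ unit_itv) t)%:E)%E.
    by apply: eq_integral => t _; exact: inner2.
  have M (k : R -> R) : Rintegral mu unit_itv k =
      fine (\int[mu]_x ((k \_ unit_itv) x)%:E)%E by exact: Rintegral_mkcond.
  by rewrite (M G) (M (fun t => _ * _)) -L -L'; congr fine; exact: Fubini f_integrable.
have -> : Rintegral mu unit_itv (fun t => h t * Rintegral mu `[t, 1] h) =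
    Rintegral mu unit_itv (fun t => prim h 1 * h t - G t).
  apply: eq_Rintegral => t; rewrite inE /unit_itv/= in_itv/= => /andP[t0 t1].
  rewrite /G mulrC -[h t * _]mulrC -mulrBl; congr (_ * _).
  rewrite (Rintegral_itvB (a := BLeft 0) (b := BRight 1) (x := t) hi) ?bnd_simp//.
  rewrite Rintegral_itv_obnd_cbnd//; apply: rint_sub_itv => //; rewrite bnd_simp.
have D := @RintegralB _ _ _ mu unit_itv (fun t => prim h 1 * h t) G mI.
rewrite D//; last exact: rintZ.
rewrite (@RintegralZl _ _ _ mu unit_itv)// => GE.
have E2 : Rintegral mu unit_itv G = prim h 1 * prim h 1 - Rintegral mu unit_itv G.
  exact: GE.
have E3 : Rintegral mu unit_itv G = prim h 1 ^+ 2 / 2.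
  apply: (mulIf (_ : 2 != 0)) => //.
  by rewrite divfK// expr2 mulr_natr mulr2n {1}E2 subrK.
exact: E3.
Qed.

End Symmetrization.

Lemma integral_deriv_mul (h u : R -> R) : rint h ->
  (forall x, unit_itv x -> u x = u 0 + prim h x) ->
  rint (fun x => h x * u x) /\
  Rintegral mu unit_itv (fun x => h x * u x) = (u 1 ^+ 2 - u 0 ^+ 2) / 2.
Proof.
move=> hi hu; have [iG GE] := integral_mul_primitive hi.
have E x : unit_itv x -> h x * u x = u 0 * h x + h x * prim h x.
  by move=> /hu ->; ring.
have i1 : rint (fun x => u 0 * h x + h x * prim h x).
  by apply: rintD => //; exact: rintZ.
split.
  apply: eq_integrable i1 => // x; rewrite inE => /E /= ->.
  by [].
have -> : Rintegral mu unit_itv (fun x => h x * u x) =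
    Rintegral mu unit_itv (fun x => u 0 * h x + h x * prim h x).
  by apply: eq_Rintegral => x; rewrite inE => /E.
have D := @RintegralD _ _ _ mu unit_itv (fun t => u 0 * h t) _ mI.
rewrite D//; last exact: rintZ.
rewrite (@RintegralZl _ _ _ mu unit_itv)// GE.
rewrite (hu 1); last by rewrite /unit_itv/= in_itv/= ler01 lexx.
by rewrite /unit_itv; field.
Qed.

End Primitive.

(** Equivalent to the modulus but free of square roots; it is subadditive and submultiplicative, and
    its integrability is immediate from that of the two parts. *)
Definition onemod {R : realType} (z : R[i]) : R :=
  `|complex.Re z| + `|complex.Im z|.

Section OneModulus.
Context {R : realType}.
Implicit Types z w : R[i].

Lemma onemod_ge0 z : 0 <= onemod z.
Proof. by rewrite addr_ge0. Qed.

Lemma onemodD z w : onemod (z + w) <= onemod z + onemod w.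
Proof.
case: z w => a b [c d]; rewrite /onemod /=.
by have := ler_normD a c; have := ler_normD b d; lra.
Qed.

Lemma onemodN z : onemod (- z) = onemod z.
Proof. by case: z => a b; rewrite /onemod /= !normrN. Qed.

Lemma onemodM z w : onemod (z * w) <= onemod z * onemod w.
Proof.
case: z w => a b [c d]; rewrite /onemod /=.
have h1 : `|a * c - b * d| <= `|a| * `|c| + `|b| * `|d|.
  by rewrite -!normrM; exact: ler_normB.
have h2 : `|a * d + b * c| <= `|a| * `|d| + `|b| * `|c|.
  by rewrite -!normrM; exact: ler_normD.
lra.
Qed.

Lemma onemod_sum (I : Type) (r : seq I) (F : I -> R[i]) :
  onemod (\sum_(i <- r) F i) <= \sum_(i <- r) onemod (F i).
Proof.
elim: r => [|i r IH]; first by rewrite !big_nil /onemod /= normr0 addr0.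
by rewrite !big_cons; apply: le_trans (onemodD _ _) _; rewrite lerD2l.
Qed.

Lemma sqmod_le_onemod z : sqmod z <= onemod z ^+ 2.
Proof.
case: z => a b; rewrite /sqmod /onemod /= -(real_normK (num_real a)).
by rewrite -(real_normK (num_real b)); have := normr_ge0 a; have := normr_ge0 b; nra.
Qed.

(** Bounding $|a||c|$ by $|a|^2+|c|^2$ decouples the components of [y] in the terms with [Q], so
    that sums over an orthonormal sequence can be bounded one component at a time. *)
Lemma normr_Im_mul3 (a c q : R[i]) :
  `|complex.Im (a * conjc (q * c))| <= onemod q * (sqmod a + sqmod c).
Proof.
case: a c q => a1 a2 [c1 c2] [q1 q2]; rewrite /onemod /sqmod /=.
have -> : a1 * - (q1 * c2 + q2 * c1) + a2 * (q1 * c1 - q2 * c2) =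
    q1 * (a2 * c1 - a1 * c2) - q2 * (a1 * c1 + a2 * c2) by ring.
apply: le_trans (ler_normB _ _) _; rewrite !normrM mulrDl.
have h1 := sqr_ge0 (a2 - c1); have h2 := sqr_ge0 (a2 + c1).
have h3 := sqr_ge0 (a1 - c2); have h4 := sqr_ge0 (a1 + c2).
have h5 := sqr_ge0 (a1 - c1); have h6 := sqr_ge0 (a1 + c1).
have h7 := sqr_ge0 (a2 - c2); have h8 := sqr_ge0 (a2 + c2).
apply: lerD; apply: ler_wpM2l => //; rewrite ler_norml; apply/andP; split; nra.
Qed.

End OneModulus.

(** * Estimates for integrals over the unit interval *)

Section IntegralBounds.
Context {R : realType}.
Local Notation mu := (@lebesgue_measure R).
Local Notation rint f := (mu.-integrable unit_itv (EFin \o f)).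
Implicit Types u v : R -> R.

Let mI := @measurable_unit_itv R.

Lemma rint_sum (I : Type) (r : seq I) (F : I -> R -> R) : (forall i, rint (F i)) ->
  rint (fun x => \sum_(i <- r) F i x) /\
  Rintegral mu unit_itv (fun x => \sum_(i <- r) F i x) =
    \sum_(i <- r) Rintegral mu unit_itv (F i).
Proof.
move=> iF; elim: r => [|i r [IH1 IH2]].
  have -> : (fun x => \sum_(i <- [::]) F i x) = fun=> 0.
    by apply/funext => x; rewrite big_nil.
  by rewrite big_nil Rintegral_cst1; split => //; exact: rint_cst.
have -> : (fun x => \sum_(j <- i :: r) F j x) =
    fun x => F i x + \sum_(j <- r) F j x.
  by apply/funext => x; rewrite big_cons.
rewrite big_cons -IH2; split; first exact: rintD.
have D := @RintegralD _ _ _ mu unit_itv (F i) _ mI.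
by rewrite D.
Qed.

Lemma rint_max u v : rint u -> rint v -> rint (fun x => Num.max (u x) (v x)).
Proof.
move=> iu iv; have h := rintD (rint_norm iu) (rint_norm iv).
apply: (le_integrable mI) h => //=.
  apply/measurable_EFinP; apply: measurable_maxr; exact: rint_measurable.
move=> x _; rewrite lee_fin [leRHS]ger0_norm ?addr_ge0//.
by have [_|_] := leP (u x) (v x); rewrite ?lerDl ?lerDr.
Qed.

(** Replacing [v] by the maximum of [u] and [v], which equals [v] almost everywhere, makes the
    inequality hold everywhere. *)
Lemma ae_le_Rintegral u v : rint u -> rint v ->
  {ae mu, forall x, unit_itv x -> u x <= v x} ->
  Rintegral mu unit_itv u <= Rintegral mu unit_itv v.
Proof.
move=> iu iv uv; pose w x := Num.max (u x) (v x).
have iw : rint w by exact: rint_max.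
have <- : Rintegral mu unit_itv w = Rintegral mu unit_itv v.
  apply: Rintegral_ae_eq => //; try exact: rint_measurable.
  apply: (@filterS _ _ (ae_filter_ringOfSetsType mu) _ _ _ uv) => x h xI.
  by rewrite /w; apply/max_idPr; exact: h.
by apply: le_Rintegral => // x _; rewrite /w le_max lexx.
Qed.

Lemma Rintegral_itv_le u (a b : itv_bound R) : rint u ->
  (BLeft 0 <= a)%O -> (b <= BRight 1)%O ->
  `|Rintegral mu [set` Interval a b] u| <= Rintegral mu unit_itv (fun x => `|u x|).
Proof.
move=> iu a0 b1; have mJ : measurable ([set` Interval a b] : set (measurableTypeR R)).
  exact: measurable_itv.
apply: le_trans (le_normr_Rintegral mJ (rint_sub_itv iu a0 b1)) _.
have iJ : mu.-integrable [set` Interval a b] (EFin \o (fun x => `|u x|)).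
  by apply: rint_sub_itv => //; exact: rint_norm.
rewrite /Rintegral fine_le//.
- exact: (integrable_fin_num mJ iJ).
- exact: (integrable_fin_num mI (rint_norm iu)).
apply: ge0_subset_integral => //.
- by apply/measurable_EFinP; apply: rint_measurable; exact: rint_norm.
- exact: subset_itv.
Qed.

Lemma primitive_variation u x a : rint u -> unit_itv x -> unit_itv a ->
  `|Rintegral mu `[0, x]%classic u - Rintegral mu `[0, a]%classic u| <=
  Rintegral mu unit_itv (fun x => `|u x|).
Proof.
move=> iu; wlog ax : x a / a <= x => [hw|].
  move=> xI aI; have [ax|/ltW xa] := leP a x; first exact: hw.
  by rewrite distrC; exact: hw.
rewrite /unit_itv /= !in_itv /= => /andP[x0 x1] /andP[a0 a1].
rewrite (@Rintegral_itvB R u (BLeft 0) (BRight x) a) ?bnd_simp//.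
  by apply: Rintegral_itv_le; rewrite ?bnd_simp.
by apply: rint_sub_itv; rewrite ?bnd_simp.
Qed.

(** Dominated convergence of the excess of [u] over [N] to 0. Applied to the size of [Q], it splits
    [Q] into a bounded part and one of small integral. *)
Lemma rint_truncation u (r : R) : rint u -> 0 < r -> exists N : nat,
  Rintegral mu unit_itv (fun x => Num.max (u x - N%:R) 0) <= r.
Proof.
move=> iu r0.
pose f (N : nat) x := Num.max (u x - N%:R) 0.
have if_ N : rint (f N).
  apply: rint_max; last exact: rint_cst.
  have := rintD iu (rint_cst (- N%:R)); exact.
have cvf x : (fun N => (f N x)%:E) @ \oo --> (0 : R)%:E.
  apply: cvg_near_cst; exists (Num.bound `|u x|) => // N /= bN.
  congr EFin; apply/max_idPr.
  rewrite subr_le0; apply: le_trans (ler_norm _) _; apply/ltW.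
  apply: lt_le_trans (archi_boundP (normr_ge0 _)) _; by rewrite ler_nat.
have [|||||_ _] := @dominated_convergence _ _ _ mu unit_itv mI
  (fun N x => (f N x)%:E) (fun=> 0%E) (fun x => `|u x|%:E).
- by move=> N; apply/measurable_EFinP; exact: rint_measurable.
- exact: measurable_cst.
- by apply: nearW => x _; exact: cvf.
- exact: rint_norm.
- apply: nearW => x N _; rewrite lee_fin /f ger0_norm ?le_max ?lexx ?orbT//.
  rewrite ge_max normr_ge0 andbT; apply: le_trans (ler_norm (u x)).
  by rewrite lerBlDr lerDl.
rewrite integral0 => /fine_cvgP[_ /cvgrPdist_lt /(_ r r0)[N _ /(_ N (leqnn N))]] /=.
rewrite sub0r normrN => h; exists N; apply: le_trans (ler_norm _) _; exact: ltW.
Qed.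

End IntegralBounds.

(** * Solutions of the Dirac type system *)

Section DiracSolutions.
Context {R : realType} {n : nat}.
Local Notation mu := (@lebesgue_measure R).
Local Notation Re := (@complex.Re R).
Local Notation Im := (@complex.Im R).
Local Notation H := (L2 R n).
Local Notation rint f := (mu.-integrable unit_itv (EFin \o f)).
Local Notation rI f := (Rintegral mu unit_itv f).
Local Notation normsq x := (Re (L2dot x x)).
Variables (b : 'rV[R[i]]_n) (Q : R -> 'M[R[i]]_n) (z : R[i]).
Hypothesis b_unit : diag_mx b \in unitmx.

(** [w] is represented by [y] and [-i B^-1 y' + Q y - z y = u]. *)
Definition dirac_solution (u w : H) (y dy : R -> 'cV[R[i]]_n) : Prop :=
  [/\ W11_with_derivative y dy,
      ae_eq mu unit_itv (w : R -> 'cV[R[i]]_n) y &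
      ae_eq mu unit_itv (u : R -> 'cV[R[i]]_n)
        (fun x => (- 'i%C) *: (invmx (diag_mx b) *m dy x) + Q x *m y x - z *: y x)].

Lemma cintegrable_sub_itv (f : R -> R[i]) (x : R) : cintegrable f -> unit_itv x ->
  mu.-integrable `[0, x]%classic (EFin \o (fun t => Re (f t))) /\
  mu.-integrable `[0, x]%classic (EFin \o (fun t => Im (f t))).
Proof.
move=> [fr fi]; rewrite /unit_itv /= in_itv/= => /andP[x0 x1].
by split; apply: rint_sub_itv; rewrite ?bnd_simp.
Qed.

Lemma dirac_solutionP (a : R[i]) u1 w1 y1 dy1 u2 w2 y2 dy2 :
  dirac_solution u1 w1 y1 dy1 -> dirac_solution u2 w2 y2 dy2 ->
  dirac_solution (a *: u1 + u2) (a *: w1 + w2)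
    (fun x => a *: y1 x + y2 x) (fun x => a *: dy1 x + dy2 x).
Proof.
move=> [[i1 p1] s1 e1] [[i2 p2] s2 e2]; split.
- split=> [k|x xI k].
    have := cintegrableP a (i1 k) (i2 k).
    by congr cintegrable; apply/funext => x; rewrite !mxE.
  rewrite !mxE p1// p2//.
  have xI' : unit_itv x by [].
  have [j1 j2] := cintegrable_sub_itv (i1 k) xI'.
  have [j3 j4] := cintegrable_sub_itv (i2 k) xI'.
  have E := @cintegralP_on R `[0, x]%classic a _ _ (measurable_itv _) j1 j2 j3 j4.
  rewrite [X in _ = _ + X](_ : _ = cintegral `[0, x]%classic
    (fun t => a * dy1 t k ord0 + dy2 t k ord0)); last first.
    by congr cintegral; apply/funext => t; rewrite !mxE.
  by rewrite E; ring.
- apply: filterS3 (L2P_ae a w1 w2) s1 s2 => x h0 h1 h2 xI.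
  by rewrite h0// h1// h2.
- apply: filterS3 (L2P_ae a u1 u2) e1 e2 => x h0 h1 h2 xI.
  rewrite h0// h1// h2// !mulmxDr -!scalemxAr !scalerDr !scalerN !scalerA.
  apply/matrixP => i j; rewrite !mxE; ring.
Qed.

Lemma dirac_solution0 : dirac_solution 0 0 (fun=> 0) (fun=> 0).
Proof.
have ae0 : ae_eq mu unit_itv ((0 : H) : R -> 'cV[R[i]]_n) (cst 0).
  have h := L2_pi_ae (0 : L2fun R n); apply: filterS h => x h xI.
  have -> : (0 : H) = \pi_H (0 : L2fun R n) by rewrite !piE.
  by rewrite h.
have c0 : cintegrable (fun=> 0 : R[i]).
  by split; have := @rint_cst R 0; exact.
split => //.
- split=> [k|x xI k].
    by move: c0; congr cintegrable; apply/funext => x; rewrite mxE.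
  rewrite !mxE add0r; apply/esym.
  rewrite [LHS](_ : _ = cintegral `[0, x]%classic (fun=> 0)); last first.
    by congr cintegral; apply/funext => t; rewrite mxE.
  by rewrite /cintegral /= /Rintegral integral0.
- by apply: filterS ae0 => x h xI; rewrite h// !mulmx0 !scaler0 subr0 addr0.
Qed.

Lemma dirac_solution_sum (I : Type) (r : seq I) (c : I -> R[i]) (u w : I -> H)
    (y dy : I -> R -> 'cV[R[i]]_n) :
  (forall i, dirac_solution (u i) (w i) (y i) (dy i)) ->
  dirac_solution (\sum_(i <- r) c i *: u i) (\sum_(i <- r) c i *: w i)
    (fun x => \sum_(i <- r) c i *: y i x) (fun x => \sum_(i <- r) c i *: dy i x).
Proof.
move=> h; elim: r => [|i r IH].
  rewrite !big_nil.
  have E : (fun x : R => \sum_(i <- [::]) c i *: y i x) = fun=> 0.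
    by apply/funext => x; rewrite big_nil.
  have E' : (fun x : R => \sum_(i <- [::]) c i *: dy i x) = fun=> 0.
    by apply/funext => x; rewrite big_nil.
  by rewrite E E'; exact: dirac_solution0.
rewrite !big_cons; have := dirac_solutionP (c i) (h i) IH.
by congr dirac_solution; apply/funext => x; rewrite big_cons.
Qed.

Lemma b_neq0 k : b ord0 k != 0.
Proof.
by move: b_unit; rewrite unitmxE det_diag unitfE => /prodf_neq0; exact.
Qed.

Lemma invmx_diagE (v : 'cV[R[i]]_n) k :
  (invmx (diag_mx b) *m v) k ord0 = (b ord0 k)^-1 * v k ord0.
Proof.
apply: (mulfI (b_neq0 k)); rewrite mulrA mulfV ?b_neq0// mul1r.
have <- : (diag_mx b *m (invmx (diag_mx b) *m v)) k ord0 = v k ord0.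
  by rewrite mulmxA mulmxV// mul1mx.
by rewrite [in RHS]mul_diag_mx mxE.
Qed.

Lemma dirac_solutionE u w y dy : dirac_solution u w y dy ->
  {ae mu, forall x, unit_itv x -> forall k,
    [/\ L2_to_fun w x k ord0 = y x k ord0,
        L2_to_fun u x k ord0 = - 'i%C * ((b ord0 k)^-1 * dy x k ord0) +
          \sum_l Q x k l * y x l ord0 - z * y x k ord0 &
        dy x k ord0 = 'i%C * b ord0 k * (L2_to_fun u x k ord0 + z * y x k ord0 -
          \sum_l Q x k l * y x l ord0)]}.
Proof.
move=> [_ wy uy]; apply: filterS2 wy uy => x h1 h2 xI k.
have uE : L2_to_fun u x k ord0 = - 'i%C * ((b ord0 k)^-1 * dy x k ord0) +
          \sum_l Q x k l * y x l ord0 - z * y x k ord0.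
  by rewrite h2// !mxE -invmx_diagE !mxE.
split => //; first by rewrite h1.
rewrite uE; set q := \sum_l _.
have -> : - 'i%C * ((b ord0 k)^-1 * dy x k ord0) + q - z * y x k ord0 +
   z * y x k ord0 - q = - 'i%C * ((b ord0 k)^-1 * dy x k ord0) by ring.
have -> : 'i%C * b ord0 k * (- 'i%C * ((b ord0 k)^-1 * dy x k ord0)) =
    - 'i%C ^+ 2 * (b ord0 k / b ord0 k) * dy x k ord0 by ring.
by rewrite sqr_i opprK mulfV ?b_neq0// !mul1r.
Qed.

End DiracSolutions.

Lemma term_le_sum {R : numDomainType} {I : finType} (F : I -> R) i :
  (forall j, 0 <= F j) -> F i <= \sum_j F j.
Proof. by move=> F0; rewrite (bigD1 i)//= lerDl sumr_ge0. Qed.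

(** * Uniform bound on solutions *)

Section SupBound.
Context {R : realType} {n : nat}.
Local Notation mu := (@lebesgue_measure R).
Local Notation Re := (@complex.Re R).
Local Notation Im := (@complex.Im R).
Local Notation H := (L2 R n).
Local Notation rint f := (mu.-integrable unit_itv (EFin \o f)).
Local Notation rI f := (Rintegral mu unit_itv f).
Local Notation normsq x := (Re (L2dot x x)).

Let mI := @measurable_unit_itv R.

Lemma rint_onemod (f : R -> R[i]) : cintegrable f -> rint (fun x => onemod (f x)).
Proof. by move=> [fr fi]; apply: rintD; exact: rint_norm. Qed.

Lemma L2_component_real (u : H) k :
  L2real (fun x => Re (L2_to_fun u x k ord0)) /\
  L2real (fun x => Im (L2_to_fun u x k ord0)).
Proof. exact: (L2funP (repr u)). Qed.

Lemma L2_component_integrable (u : H) k :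
  cintegrable (fun x => L2_to_fun u x k ord0).
Proof. by have [h1 h2] := L2_component_real u k; split; exact: L2real_rint. Qed.

Lemma rI_onemod_component_le (u : H) k (a : R) : 0 < a -> normsq u <= a ^+ 2 ->
  rI (fun x => onemod (L2_to_fun u x k ord0)) <= 2 * a.
Proof.
move=> a0 ua; have [h1 h2] := L2_component_real u k.
have E := L2_normsqE (L2_component_real u) (ae_eq_refl _ _ _).
have le : rI (fun x => Re (L2_to_fun u x k ord0) ^+ 2) +
    rI (fun x => Im (L2_to_fun u x k ord0) ^+ 2) <= normsq u.
  rewrite E; apply: (@term_le_sum _ _ (fun k => rI (fun x => Re (L2_to_fun u x k ord0) ^+ 2) +
    rI (fun x => Im (L2_to_fun u x k ord0) ^+ 2))) => j.
  by rewrite addr_ge0// Rintegral_ge0// => x _; rewrite sqr_ge0.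
have p1 : 0 <= rI (fun x => Re (L2_to_fun u x k ord0) ^+ 2).
  by rewrite Rintegral_ge0// => x _; rewrite sqr_ge0.
have p2 : 0 <= rI (fun x => Im (L2_to_fun u x k ord0) ^+ 2).
  by rewrite Rintegral_ge0// => x _; rewrite sqr_ge0.
have D := @RintegralD _ _ _ mu unit_itv _ _ mI (rint_norm (L2real_rint h1)) (rint_norm (L2real_rint h2)).
rewrite /onemod D mulr_natl mulr2n; apply: lerD; apply: Rintegral_norm_le => //.
  by apply: le_trans (le_trans le ua); rewrite lerDl.
by apply: le_trans (le_trans le ua); rewrite lerDr.
Qed.

Lemma onemod_primitive_le (y dy : R -> 'cV[R[i]]_n) x a k :
  W11_with_derivative y dy -> unit_itv x -> unit_itv a ->
  onemod (y x k ord0 - y a k ord0) <= rI (fun t => onemod (dy t k ord0)).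
Proof.
move=> [idy yE] xI aI; have [fr fi] := idy k.
rewrite (yE x)// (yE a)//.
have D := @RintegralD _ _ _ mu unit_itv _ _ mI (rint_norm fr) (rint_norm fi).
rewrite /onemod D.
have e1 := primitive_variation fr xI aI; have e2 := primitive_variation fi xI aI.
case: (y 0 k ord0) => y1 y2; apply: lerD => /=.
  by apply: le_trans e1; rewrite opprD addrACA subrr add0r.
by apply: le_trans e2; rewrite opprD addrACA subrr add0r.
Qed.

Variables (b : 'rV[R[i]]_n) (Q : R -> 'M[R[i]]_n) (z : R[i]).
Hypothesis b_unit : diag_mx b \in unitmx.
Hypothesis Q_L1 : L1mx Q.
Local Notation beta := (\sum_k onemod (b ord0 k)).
Local Notation q := (fun x => \sum_k \sum_l onemod (Q x k l)).
Local Notation vmod v := (\sum_k onemod (v k ord0)).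

Lemma rint_Qmod : rint q.
Proof.
have h k : rint (fun x => \sum_l onemod (Q x k l)).
  by have [] := @rint_sum R _ (index_enum 'I_n) (fun l x => onemod (Q x k l))
    (fun l => rint_onemod (Q_L1 k l)).
by have [] := @rint_sum R _ (index_enum 'I_n) _ h.
Qed.

Lemma vmod_ge0 (v : 'cV[R[i]]_n) : 0 <= vmod v.
Proof. by apply: sumr_ge0 => k _; exact: onemod_ge0. Qed.

Lemma onemod_le_vmod (v : 'cV[R[i]]_n) k : onemod (v k ord0) <= vmod v.
Proof.
by apply: (@term_le_sum _ _ (fun k => onemod (v k ord0))) => j; exact: onemod_ge0.
Qed.

Lemma beta_ge0 : 0 <= beta.
Proof. by apply: sumr_ge0 => k _; exact: onemod_ge0. Qed.

Lemma rint_vmod (u : H) : rint (fun x => vmod (L2_to_fun u x)).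
Proof.
by have [] := @rint_sum R _ (index_enum 'I_n) (fun k x => onemod (L2_to_fun u x k ord0))
  (fun k => rint_onemod (L2_component_integrable u k)).
Qed.

Lemma rI_vmod_le (u : H) (a : R) : 0 < a -> normsq u <= a ^+ 2 ->
  rI (fun x => vmod (L2_to_fun u x)) <= n%:R * (2 * a).
Proof.
move=> a0 ua.
have [_ ->] := @rint_sum R _ (index_enum 'I_n) (fun k x => onemod (L2_to_fun u x k ord0))
  (fun k => rint_onemod (L2_component_integrable u k)).
apply: (@le_trans _ _ (\sum_(k < n) 2 * a)).
  by apply: ler_sum => k _; exact: rI_onemod_component_le.
by rewrite sumr_const card_ord -[leLHS]mulr_natl.
Qed.

(** The part of [q] below [N] is charged to [w], whose integral the $L^2$ norm controls; only the
    excess over [N] is charged to the uniform bound [S]. *)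
Lemma onemod_derivative_le (u w : H) y dy (S : R) (N : nat) :
  dirac_solution b Q z u w y dy -> (forall x, unit_itv x -> vmod (y x) <= S) ->
  forall k, {ae mu, forall x, unit_itv x -> onemod (dy x k ord0) <=
    beta * (vmod (L2_to_fun u x) + (onemod z + N%:R) * vmod (L2_to_fun w x) +
      S * Num.max (q x - N%:R) 0)}.
Proof.
move=> /(dirac_solutionE b_unit) sol yS k.
apply: (@filterS _ _ (ae_filter_ringOfSetsType mu) _ _ _ sol) => x h xI.
have wy : vmod (L2_to_fun w x) = vmod (y x).
  by apply: eq_bigr => l _; have [-> _ _] := h xI l.
have [_ _ ->] := h xI k; rewrite wy; have sS := yS x xI.
set s := vmod (y x) in sS *; set e := Num.max _ _.
have s0 : 0 <= s by exact: vmod_ge0.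
have e0 : 0 <= e by rewrite le_max lexx orbT.
have qe : q x <= N%:R + e by rewrite -lerBlDl le_max lexx.
have i1 : onemod ('i%C * b ord0 k) <= beta.
  apply: le_trans (onemodM _ _) _; rewrite {1}/onemod /= normr0 normr1 add0r mul1r.
  by apply: (@term_le_sum _ _ (fun k => onemod (b ord0 k))) => j; exact: onemod_ge0.
apply: le_trans (onemodM _ _) _; apply: ler_pM => //; try exact: onemod_ge0.
apply: le_trans (onemodD _ _) _; rewrite onemodN.
have i2 : onemod (L2_to_fun u x k ord0 + z * y x k ord0) <=
    vmod (L2_to_fun u x) + onemod z * s.
  apply: le_trans (onemodD _ _) _; apply: lerD; first exact: onemod_le_vmod.
  apply: le_trans (onemodM _ _) _; rewrite ler_wpM2l ?onemod_ge0//.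
  exact: onemod_le_vmod.
have i3 : onemod (\sum_l Q x k l * y x l ord0) <= q x * s.
  apply: le_trans (onemod_sum _ _) _.
  apply: (@le_trans _ _ ((\sum_l onemod (Q x k l)) * s)).
    rewrite mulr_suml; apply: ler_sum => l _; apply: le_trans (onemodM _ _) _.
    by rewrite ler_wpM2l ?onemod_ge0//; exact: onemod_le_vmod.
  rewrite ler_wpM2r//.
  apply: (@term_le_sum _ _ (fun k => \sum_l onemod (Q x k l))) => j.
  by apply: sumr_ge0 => l _; exact: onemod_ge0.
have i4 : q x * s <= N%:R * s + S * e.
  apply: (@le_trans _ _ ((N%:R + e) * s)); first by rewrite ler_wpM2r.
  by rewrite mulrDl lerD2l mulrC ler_wpM2r.
apply: le_trans (lerD i2 (le_trans i3 i4)) _.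
by rewrite le_eqVlt; apply/orP; left; apply/eqP; ring.
Qed.

(** A value of [y] is at most the mean of [w] plus the variation of [y], and the variation is at
    most $L^2$ norms plus a small multiple of the supremum. Hence the supremum $S$ satisfies $S\le
    Aa+S/2$, that is $S\le 2Aa$. *)
Lemma dirac_sup_bound (K : R) : 0 < K -> exists M : R, 0 <= M /\
  forall (u w : H) y dy (a : R), dirac_solution b Q z u w y dy -> 0 < a ->
    normsq u <= a ^+ 2 -> normsq w <= (K * a) ^+ 2 ->
    forall x, unit_itv x -> forall k, sqmod (y x k ord0) <= (M * a) ^+ 2.
Proof.
move=> K0; have b0 := beta_ge0.
pose c := n%:R * beta.
have c0 : 0 <= c by rewrite mulr_ge0.
have c1 : 0 < 2 * (c + 1) by rewrite mulr_gt0// ltr_wpDl.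
(* The excess over [N] has integral at most $1/(2(c+1))$ and is later multiplied by [c], so it
   contributes at most half of the supremum. *)
have [N NP] := rint_truncation rint_Qmod (divr_gt0 ltr01 c1).
set e := fun x => Num.max _ _ in NP.
pose m := onemod z + N%:R.
have m0 : 0 <= m by rewrite addr_ge0// onemod_ge0.
pose A := n%:R * (2 * K) + c * (n%:R * 2 + m * (n%:R * (2 * K))).
have A0 : 0 <= A.
  by rewrite addr_ge0// ?mulr_ge0 ?addr_ge0 ?mulr_ge0 ?addr_ge0// ?mulr_ge0// ltW.
exists (2 * A); split; first by rewrite mulr_ge0.
move=> u w y dy a sol a0 ua wa.
have [W _ _] := sol.
have s_le (S : R) : (forall x, unit_itv x -> vmod (y x) <= S) ->
    forall x, unit_itv x -> vmod (y x) <= A * a + S / 2.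
  move=> yS x xI.
  have S0 : 0 <= S by apply: le_trans (yS x xI); exact: vmod_ge0.
  pose E t := beta * (vmod (L2_to_fun u t) + m * vmod (L2_to_fun w t) + S * e t).
  have ie : rint e.
    apply: rint_max; last exact: rint_cst.
    by have := rintD rint_Qmod (rint_cst (- N%:R)); exact.
  have iE1 : rint (fun t => vmod (L2_to_fun u t) + m * vmod (L2_to_fun w t)).
    by apply: rintD; [exact: rint_vmod|apply: rintZ; exact: rint_vmod].
  have iE2 : rint (fun t => vmod (L2_to_fun u t) + m * vmod (L2_to_fun w t) + S * e t).
    by apply: rintD => //; exact: rintZ.
  have iE : rint E by exact: rintZ.
  have RE : rI E = beta * (rI (fun t => vmod (L2_to_fun u t)) +
      m * rI (fun t => vmod (L2_to_fun w t)) + S * rI e).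
    rewrite /E (@RintegralZl _ _ _ mu unit_itv)//; congr (_ * _).
    rewrite (@RintegralD _ _ _ mu unit_itv)//; last exact: rintZ.
    rewrite (@RintegralZl _ _ _ mu unit_itv)//; congr (_ + _).
    rewrite (@RintegralD _ _ _ mu unit_itv)//; last 2 first.
    - exact: rint_vmod.
    - by apply: rintZ; exact: rint_vmod.
    by rewrite (@RintegralZl _ _ _ mu unit_itv)//; exact: rint_vmod.
  have dyE k : rI (fun t => onemod (dy t k ord0)) <= rI E.
    apply: ae_le_Rintegral => //; first by apply: rint_onemod; have [h _] := W.
    exact: (@onemod_derivative_le u w y dy S N sol yS k).
  have var t : unit_itv t -> vmod (y x) <= vmod (y t) + n%:R * rI E.
    move=> tI; rewrite -[n in n%:R]card_ord mulr_natl -sumr_const -big_split/=.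
    apply: ler_sum => k _; rewrite -[y x k ord0](subrKC (y t k ord0)).
    apply: le_trans (onemodD _ _) _; rewrite lerD2l.
    exact: le_trans (onemod_primitive_le k W xI tI) (dyE k).
  have mean : vmod (y x) - n%:R * rI E <= rI (fun t => vmod (L2_to_fun w t)).
    rewrite -[leLHS]Rintegral_cst1; apply: ae_le_Rintegral.
    - exact: rint_cst.
    - exact: rint_vmod.
    have [_ wy _] := sol; apply: filterS wy => t h tI.
    by rewrite h// lerBlDr; exact: var.
  have r1 := rI_vmod_le a0 ua.
  have r2 := rI_vmod_le (mulr_gt0 K0 a0) wa.
  have r3 : c * (S * rI e) <= S / 2.
    apply: (@le_trans _ _ (c * (S * (1 / (2 * (c + 1)))))).
      by rewrite ler_wpM2l// ler_wpM2l.
    have -> : c * (S * (1 / (2 * (c + 1)))) = S / 2 * (c / (c + 1)).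
      by field; rewrite gt_eqF// ltr_wpDl.
    apply: ler_piMr; first by rewrite divr_ge0.
    by rewrite ler_pdivrMr ?ltr_wpDl// mul1r lerDl.
  have r4 : c * (rI (fun t => vmod (L2_to_fun u t)) + m * rI (fun t => vmod (L2_to_fun w t)))
      <= c * (n%:R * (2 * a) + m * (n%:R * (2 * (K * a)))).
    by rewrite ler_wpM2l// lerD// ler_wpM2l.
  have cE : n%:R * rI E = c * (rI (fun t => vmod (L2_to_fun u t)) +
      m * rI (fun t => vmod (L2_to_fun w t))) + c * (S * rI e).
    by rewrite RE /c; ring.
  have AE : A * a = n%:R * (2 * (K * a)) + c * (n%:R * (2 * a) + m * (n%:R * (2 * (K * a)))).
    by rewrite /A; ring.
  move: mean; rewrite cE lerBlDr AE => mean; apply: (le_trans mean).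
  rewrite -addrA; apply: lerD => //; exact: lerD.
(* The supremum must be known to be finite before it can be absorbed; this crude bound depends on
   the solution. *)
have [S0 S0P] : exists S0, forall x, unit_itv x -> vmod (y x) <= S0.
  have I0 : unit_itv (0 : R) by rewrite /unit_itv/= in_itv/= lexx ler01.
  exists (vmod (y 0) + \sum_k rI (fun t => onemod (dy t k ord0))) => x xI.
  rewrite -big_split/=; apply: ler_sum => k _.
  rewrite -[y x k ord0](subrKC (y 0 k ord0)).
  apply: le_trans (onemodD _ _) _; rewrite lerD2l.
  exact: onemod_primitive_le.
pose Y := [set vmod (y x) | x in unit_itv].
have supY : has_sup Y.
  split; first by exists (vmod (y 0)), 0 => //; rewrite /unit_itv/= in_itv/= lexx ler01.
  by exists S0 => _ [x xI <-]; exact: S0P.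
have supP x : unit_itv x -> vmod (y x) <= sup Y.
  by move=> xI; apply: ub_le_sup; [case: supY|exists x].
have : sup Y <= A * a + sup Y / 2.
  apply: ge_sup; first by case: supY.
  by move=> _ [x xI <-]; exact: s_le.
move=> supA x xI k.
apply: le_trans (sqmod_le_onemod _) _.
rewrite ler_pXn2r// ?nnegrE ?onemod_ge0//.
  apply: le_trans (onemod_le_vmod _ _) _; apply: le_trans (supP x xI) _.
  by move: supA; set Z := sup Y; move=> ?; rewrite -mulrA; lra.
by rewrite mulr_ge0 ?mulr_ge0// ltW.
Qed.

End SupBound.

Lemma normsq_sum {R : realType} {V : lmodType R[i]} (dot : V -> V -> R[i])
    (Hdot : inner_product dot) (c : V -> R[i]) (s : seq V) : orthonormal_seq dot s ->
  complex.Re (dot (\sum_(e <- s) c e *: e) (\sum_(e <- s) c e *: e)) =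
  \sum_(e <- s) sqmod (c e).
Proof.
move=> os; rewrite (form_sumr Hdot) Re_sum big_seq [RHS]big_seq.
apply: eq_bigr => e es.
by rewrite (formZr Hdot) (dot_sum Hdot)// mulrC sqmodE.
Qed.

(** * The bound on traces for the resolvent *)

Section TraceBound.
Context {R : realType} {n : nat}.
Local Notation mu := (@lebesgue_measure R).
Local Notation Re := (@complex.Re R).
Local Notation Im := (@complex.Im R).
Local Notation H := (L2 R n).
Local Notation rint f := (mu.-integrable unit_itv (EFin \o f)).
Local Notation rI f := (Rintegral mu unit_itv f).
Local Notation normsq x := (Re (L2dot x x)).

Let mI := @measurable_unit_itv R.

Lemma ae_all_seq (I : eqType) (s : seq I) (P : I -> R -> Prop) :
  (forall i, {ae mu, forall x, P i x}) ->
  {ae mu, forall x, forall i, i \in s -> P i x}.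
Proof.
move=> aP; elim: s => [|i s IH]; first by apply: nearW.
apply: (@filterS2 _ _ (ae_filter_ringOfSetsType mu) _ _ _ _ (aP i) IH) => x h1 h2 j.
by rewrite inE => /orP[/eqP ->|/h2].
Qed.

Variables (b : 'rV[R[i]]_n) (Q : R -> 'M[R[i]]_n) (z : R[i]).
Hypothesis b_unit : diag_mx b \in unitmx.
Hypothesis b_real : forall k, Im (b ord0 k) = 0.
Hypothesis Q_L1 : L1mx Q.
Local Notation beta k := (Re (b ord0 k))^-1.

(** The integrand is half the derivative of $|y_k|^2$, so the derivative of [y] leaves the trace and
    only boundary values stay. *)
Lemma integral_boundary (y dy : R -> 'cV[R[i]]_n) k : W11_with_derivative y dy ->
  rint (fun x => Re (dy x k ord0) * Re (y x k ord0) +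
    Im (dy x k ord0) * Im (y x k ord0)) /\
  rI (fun x => Re (dy x k ord0) * Re (y x k ord0) +
    Im (dy x k ord0) * Im (y x k ord0)) =
  (sqmod (y 1 k ord0) - sqmod (y 0 k ord0)) / 2.
Proof.
move=> [idy yE]; have [fr fi] := idy k.
have pr x : unit_itv x -> Re (y x k ord0) = Re (y 0 k ord0) +
    Rintegral mu `[0, x]%classic (fun t => Re (dy t k ord0)).
  by move=> xI; rewrite (yE x xI) ReD.
have pi x : unit_itv x -> Im (y x k ord0) = Im (y 0 k ord0) +
    Rintegral mu `[0, x]%classic (fun t => Im (dy t k ord0)).
  by move=> xI; rewrite (yE x xI) ImD.
have [i1 e1] := @integral_deriv_mul R _ (fun x => Re (y x k ord0)) fr pr.
have [i2 e2] := @integral_deriv_mul R _ (fun x => Im (y x k ord0)) fi pi.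
split; first exact: rintD.
have D := @RintegralD _ _ _ mu unit_itv _ _ mI i1 i2.
by rewrite D e1 e2 /sqmod -mulrDl opprD addrACA.
Qed.

(** The equation is substituted for [u]. Because [b] is real, the leading term is an exact
    derivative, which is kept as it stands; the terms with [Q] and [z] are estimated in absolute
    value. *)
Lemma dirac_im_le (s : R) (u w : H) y dy : s ^+ 2 = 1 ->
  dirac_solution b Q z u w y dy ->
  {ae mu, forall x, unit_itv x -> s * Im (cdot (L2_to_fun w x) (L2_to_fun u x)) <=
    \sum_k (s * beta k * (Re (dy x k ord0) * Re (y x k ord0) +
                          Im (dy x k ord0) * Im (y x k ord0)) +
      (\sum_l onemod (Q x k l) * (sqmod (y x k ord0) + sqmod (y x l ord0)) +
       `|Im z| * sqmod (y x k ord0)))}.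
Proof.
move=> s1 /(dirac_solutionE b_unit) sol.
apply: (@filterS _ _ (ae_filter_ringOfSetsType mu) _ _ _ sol) => x h xI.
have sN : `|s| = 1.
  by apply/eqP; rewrite -sqr_norm_eq1 // s1.
rewrite /cdot Im_sum mulr_sumr; apply: ler_sum => k _.
have [-> -> _] := h xI k.
set d := dy x k ord0; set yk := y x k ord0; set S := \sum_l Q x k l * _.
have bE : (b ord0 k)^-1 = (beta k)%:C%C.
  by rewrite fmorphV/=; congr (_^-1); move: (b_real k); case: (b ord0 k) => ? ? /= ->.
have -> : Im (yk * conjc (- 'i%C * ((b ord0 k)^-1 * d) + S - z * yk)) =
    beta k * (Re d * Re yk + Im d * Im yk) + Im (yk * conjc S) + Im z * sqmod yk.
  rewrite bE /sqmod; case: d yk S z => ? ? [? ?] [? ?] [? ?] /=; ring.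
rewrite !(mulrDr s) -addrA; apply: lerD; first by rewrite mulrA.
apply: lerD; last first.
  apply: le_trans (ler_norm _) _; rewrite !normrM sN mul1r.
  by rewrite (ger0_norm (sqmod_ge0 yk)).
apply: le_trans (ler_norm _) _; rewrite normrM sN mul1r /S rmorph_sum mulr_sumr Im_sum.
apply: le_trans (ler_norm_sum _ _ _) _; apply: ler_sum => l _.
exact: normr_Im_mul3.
Qed.

Variable T : {linear H -> H}.
Hypothesis T_sol : forall u, exists y dy, dirac_solution b Q z u (T u) y dy.

Lemma dirac_trace_bound (s : R) : s ^+ 2 = 1 -> continuous (T : H -> H) ->
  exists M : R, forall u, orthonormal_seq (@L2dot R n) u ->
    \sum_(x <- u) s * Im (L2dot (T x) x) <= M.
Proof.
move=> s1 /(continuous_normsqP L2_inner_product L2_norm_from)[K0 K00 TK].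
have /choice[Y YP] : forall u, exists p : (R -> 'cV[R[i]]_n) * (R -> 'cV[R[i]]_n),
    dirac_solution b Q z u (T u) p.1 p.2.
  by move=> u; have [y [dy h]] := T_sol u; exists (y, dy).
have K1 : 0 < Num.sqrt K0 by rewrite sqrtr_gt0.
have [M [M0 MP]] := dirac_sup_bound z b_unit Q_L1 K1.
have pointwise r x k : orthonormal_seq (@L2dot R n) r -> unit_itv x ->
    \sum_(e <- r) sqmod ((Y e).1 x k ord0) <= M ^+ 2.
  move=> or xI; set sg := \sum_(e <- r) _.
  have sg0 : 0 <= sg by apply: sumr_ge0 => e _; exact: sqmod_ge0.
  have [->|sgn] := eqVneq sg 0; first exact: sqr_ge0.
  have {}sg0 : 0 < sg by rewrite lt_neqAle eq_sym sgn.
  (* With the conjugate values as coefficients, both the squared norm of [g] and the [k]-th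
     component at [x] of its solution equal [sg]. The uniform bound then says $sg^2\le M^2sg$. *)
  pose c e := conjc ((Y e).1 x k ord0).
  pose g : H := \sum_(e <- r) c e *: e.
  have gE : normsq g = sg.
    rewrite (normsq_sum L2_inner_product c or).
    by apply: eq_bigr => e _; exact: sqmod_conj.
  have Tg : T g = \sum_(e <- r) c e *: T e.
    by rewrite linear_sum; apply: eq_bigr => e _; rewrite linearZ_LR.
  (* The chosen [Y] need not be linear, so the combination of the chosen solutions is used for [g]
     in place of [Y g]. *)
  have sol := dirac_solution_sum r c YP.
  have a0 : 0 < Num.sqrt sg by rewrite sqrtr_gt0.
  rewrite -/g -Tg in sol.
  have g1 : normsq g <= Num.sqrt sg ^+ 2 by rewrite (sqr_sqrtr (ltW sg0)) gE.
  have g2 : normsq (T g) <= (Num.sqrt K0 * Num.sqrt sg) ^+ 2.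
    by rewrite exprMn (sqr_sqrtr (ltW K00)) (sqr_sqrtr (ltW sg0)) -gE; exact: TK.
  have := MP _ _ _ _ _ sol a0 g1 g2 x xI k.
  have -> : (\sum_(e <- r) c e *: (Y e).1 x) k ord0 = sg%:C%C.
    rewrite summxE /sg rmorph_sum; apply: eq_bigr => e _.
    by rewrite mxE /c mulrC sqmodE.
  rewrite sqmod_real exprMn (sqr_sqrtr (ltW sg0)) expr2 => h.
  by rewrite -(ler_pM2r sg0).
pose B x := \sum_k (\sum_l onemod (Q x k l) * (M ^+ 2 + M ^+ 2) + `|Im z| * M ^+ 2).
have iB : rint B.
  have h k : rint (fun x => \sum_l onemod (Q x k l) * (M ^+ 2 + M ^+ 2) + `|Im z| * M ^+ 2).
    apply: rintD; last exact: rint_cst.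
    have hl l : rint (fun x => onemod (Q x k l) * (M ^+ 2 + M ^+ 2)).
      have := rintZ (M ^+ 2 + M ^+ 2) (rint_onemod (Q_L1 k l)).
      by congr (mu.-integrable _ _); apply/funext => x /=; rewrite mulrC.
    by have [] := @rint_sum R _ (index_enum 'I_n) _ hl.
  by have [] := @rint_sum R _ (index_enum 'I_n) _ h.
(* The first sum bounds the boundary values at 0 and 1; [B] majorises the terms with [Q] and [z],
   uniformly over orthonormal sequences. *)
exists (\sum_k `|beta k| * M ^+ 2 + rI B) => r or.
pose F e x := \sum_k (s * beta k *
  (Re ((Y e).2 x k ord0) * Re ((Y e).1 x k ord0) +
   Im ((Y e).2 x k ord0) * Im ((Y e).1 x k ord0))).
have bd e k := @integral_boundary (Y e).1 (Y e).2 k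
  (let: And3 h _ _ := YP e in h).
have Fs e : rint (F e) /\ rI (F e) = \sum_k s * beta k *
    ((sqmod ((Y e).1 1 k ord0) - sqmod ((Y e).1 0 k ord0)) / 2).
  have [h1 ->] := @rint_sum R _ (index_enum 'I_n) _
    (fun k => rintZ (s * beta k) (bd e k).1).
  split => //; apply: eq_bigr => k _.
  by rewrite (@RintegralZl _ _ _ mu unit_itv)//; [rewrite (bd e k).2|exact: (bd e k).1].
have lhs_rint (e : H) : rint (fun x => s * Im (cdot (L2_to_fun (T e) x) (L2_to_fun e x))).
  by apply: rintZ; have [] := L2dot_integrable (T e) e.
have -> : \sum_(x <- r) s * Im (L2dot (T x) x) =
    rI (fun x => \sum_(e <- r) s * Im (cdot (L2_to_fun (T e) x) (L2_to_fun e x))).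
  have [_ ->] := @rint_sum R _ r _ lhs_rint; apply: eq_bigr => e _.
  rewrite (@RintegralZl _ _ _ mu unit_itv)//.
  by have [] := L2dot_integrable (T e) e.
have [iF FE] := @rint_sum R _ r F (fun e => (Fs e).1).
have ae_bound := ae_all_seq r (fun e => dirac_im_le s1 (YP e)).
apply: (@le_trans _ _ (rI (fun x => \sum_(e <- r) F e x + B x))).
  apply: ae_le_Rintegral.
  - by have [] := @rint_sum R _ r _ lhs_rint.
  - exact: rintD.
  apply: (@filterS _ _ (ae_filter_ringOfSetsType mu) _ _ _ ae_bound) => x h xI.
  rewrite big_seq; apply: le_trans (ler_sum _ (fun e er => h e er xI)) _.
  rewrite -big_seq; under eq_bigr do rewrite big_split/=.
  rewrite big_split/= lerD2l exchange_big/=; apply: ler_sum => k _.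
  rewrite big_split/=; apply: lerD; last first.
    by rewrite -mulr_sumr ler_wpM2l//; exact: pointwise.
  rewrite exchange_big/=; apply: ler_sum => l _.
  rewrite -mulr_sumr big_split/= ler_wpM2l ?onemod_ge0//.
  by apply: lerD; exact: pointwise.
rewrite (@RintegralD _ _ _ mu unit_itv)// FE lerD2r.
under eq_bigr do rewrite (Fs _).2.
rewrite exchange_big/=; apply: ler_sum => k _.
rewrite -mulr_sumr -mulr_suml sumrB.
have I0 : unit_itv (0 : R) by rewrite /unit_itv/= in_itv/= lexx ler01.
have I1 : unit_itv (1 : R) by rewrite /unit_itv/= in_itv/= lexx ler01.
have a1 := pointwise r 1 k or I1; have a0 := pointwise r 0 k or I0.
set A1 := \sum_(i <- r) _ in a1 *; set A0 := \sum_(i <- r) _ in a0 *.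
have p1 : 0 <= A1 by apply: sumr_ge0 => e _; exact: sqmod_ge0.
have p0 : 0 <= A0 by apply: sumr_ge0 => e _; exact: sqmod_ge0.
apply: le_trans (ler_norm _) _; rewrite normrM normrM.
have -> : `|s| = 1 by apply/eqP; rewrite -sqr_norm_eq1 // s1.
rewrite mul1r ler_wpM2l// ler_norml; apply/andP; split.
  rewrite lerNl -mulNr opprB ler_pdivrMr//.
  by rewrite lerBlDr; apply: le_trans a0 _; rewrite mulr_natr mulr2n -addrA lerDl addr_ge0// sqr_ge0.
rewrite ler_pdivrMr// lerBlDr; apply: le_trans a1 _.
by rewrite mulr_natr mulr2n -addrA lerDl addr_ge0// sqr_ge0.
Qed.

End TraceBound.

(** * Application to the resolvent of the Dirac type operator *)

Section ResolventSynthesis.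
Context {R : realType} {n : nat}.
Local Notation Re := (@complex.Re R).
Local Notation Im := (@complex.Im R).
Local Notation H := (L2 R n).
Variables (b : 'rV[R[i]]_n) (Q : R -> 'M[R[i]]_n) (C D : 'M[R[i]]_n).
Hypothesis b_unit : diag_mx b \in unitmx.
Hypothesis b_real : forall k, Im (b ord0 k) = 0.
Hypothesis Q_L1 : L1mx Q.
Let L := L_CD (diag_mx b) Q C D.

Lemma L_CD_dirac_solution (z : R[i]) (u w : H) : L (w, u + z *: w) ->
  exists y dy, dirac_solution b Q z u w y dy.
Proof.
move=> [y [dy [W _ /= wy uy]]]; exists y, dy; split => //.
have ae := L2P_ae z w u; rewrite [z *: w + u]addrC in ae.
apply: filterS3 ae uy wy => x h1 h2 h3 xI.
have <- : L2_to_fun (u + z *: w) x - z *: L2_to_fun w x = L2_to_fun u x.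
  by rewrite h1// addrAC subrr add0r.
by rewrite h2// h3.
Qed.

(** The sign [s] is [1] for accumulative and [-1] for dissipative operators. *)
Lemma resolvent_spectral_synthesis (s : R) (z : R[i]) : s ^+ 2 = 1 ->
  complete_operator L -> (forall f g, L (f, g) -> s * Im (L2dot g f) <= 0) ->
  0 < s * Im z ->
  exists T : {linear H -> H}, resolvent_at L z T /\ spectral_synthesis T.
Proof.
move=> s1 cL aL zs.
have Hdot := @L2_inner_product R n.
have Im_scale (f : H) : Im (L2dot (z *: f) f) = Im z * Re (L2dot f f).
  have ImM (c : R[i]) (r : R) : Im (c * r%:C%C) = Im c * r.
    by case: c => ? ? /=; rewrite mulr0 add0r.
  by rewrite (formZl Hdot) (form_real Hdot) ImM.
have inj (f : H) : L (f, z *: f) -> f = 0.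
  move=> /aL; rewrite Im_scale mulrA => h; apply: (inner_eq0 Hdot).
  apply/eqP; rewrite eq_le (form_ge0 Hdot) andbT.
  by rewrite -(pmulr_rle0 _ zs).
have [T rT] := resolvent_exists Hdot L2_norm_from cL inj.
exists T; split => //.
have [cT LT] := rT; have [_ _ /(_ z T rT) kT] := cL.
have LTu u : L (T u, u + z *: T u) by apply/LT.
have sol u := L_CD_dirac_solution (LTu u).
have [M MP] := dirac_trace_bound b_unit b_real Q_L1 sol s1 cT.
apply: (dissipative_spectral_synthesis Hdot L2_norm_from (@L2_complete R n)
  cT kT s1 _ MP) => u.
(* The sign condition on [L] at [T u] gives $s\operatorname{Im}(Tu,u)\ge
   s\operatorname{Im}z\,\|Tu\|^2$: the imaginary part of the resolvent has the opposite sign to that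
   of [L]. *)
have := aL _ _ (LTu u); rewrite (formDl Hdot) ImD Im_scale mulrDr.
have -> : Im (L2dot u (T u)) = - Im (L2dot (T u) u).
  by rewrite (form_conj Hdot (T u) u); case: (L2dot (T u) u).
have : 0 <= s * (Im z * Re (L2dot (T u) (T u))).
  by rewrite mulrA mulr_ge0 ?(form_ge0 Hdot)// ltW.
by rewrite mulrN; lra.
Qed.

End ResolventSynthesis.

Local Close Scope quotient_scope.
Local Open Scope sesquilinear_scope.

Theorem theorem6p12 (R : realType) (n : nat) (b : 'rV[R[i]]_n)
    (Q : R -> 'M[R[i]]_n) (C D : 'M[R[i]]_n)
    (B_nonsingular : diag_mx b \in unitmx)
    (Q_L1 : L1mx Q)
    (rank_CD : \rank (row_mx C D) = n)
    (B_selfadjoint : diag_mx b = (diag_mx b)^t*) :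
  let L := L_CD (diag_mx b) Q C D in
  (complete_operator L -> accumulative L ->
     forall z : R[i], 0 < complex.Im z ->
       exists T : {linear L2 R n -> L2 R n},
         resolvent_at L z T /\ spectral_synthesis T) /\
  (complete_operator L -> dissipative L ->
     forall z : R[i], complex.Im z < 0 ->
       exists T : {linear L2 R n -> L2 R n},
         resolvent_at L z T /\ spectral_synthesis T).
Proof.
move=> L.
have b_real k : complex.Im (b ord0 k) = 0.
  have /matrixP/(_ k k) := B_selfadjoint; rewrite !mxE eqxx !mulr1n.
  case: (b ord0 k) => x y [] /eqP.
  by rewrite -addr_eq0 -mulr2n mulrn_eq0 /= => /eqP.
split=> [cL aL z z0|cL dL z z0].
  apply: (resolvent_spectral_synthesis B_nonsingular b_real Q_L1 (s := 1)) => //.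
  - by rewrite expr1n.
  - by move=> f g /aL; rewrite mul1r.
  - by rewrite mul1r.
apply: (resolvent_spectral_synthesis B_nonsingular b_real Q_L1 (s := -1)) => //.
- by rewrite sqrrN expr1n.
- by move=> f g /dL; rewrite mulN1r oppr_le0.
- by rewrite mulN1r oppr_gt0.
Qed.
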